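(* Let $\Bbbk$ be a field, let $B$ be a coquasi-bialgebra over $\Bbbk$, and let ${}^B\mathfrak{M}_f$ be the monoidal category of finite-dimensional left $B$-comodules. Then: (1) $B$ admits a preantipode if and only if ${}^B\mathfrak{M}_f$ is right rigid. (2) $B$ is a coquasi-Hopf algebra (i.e. admits a coquasi-antipode) if and only if ${}^B\mathfrak{M}_f$ is right rigid and, in addition, the right duals can be given by endowing the $\Bbbk$-linear duals with a suitable comodule structure; that is, right duals in ${}^B\mathfrak{M}_f$ can be chosen so that the right dual of each $V$ is the vector space $V^*=\mathrm{Hom}_\Bbbk(V,\Bbbk)$ with some left $B$-coaction (and some evaluation and dual basis maps in ${}^B\mathfrak{M}_f$), the right dual of each comodule morphism $f$ being the linear transpose $f^*$.
   Context: Sweedler notation: $\Delta(h)=\sum h_1\otimes h_2$; left coactions $\rho(v)=\sum v_{-1}\otimes v_0$; $\otimes=\otimes_\Bbbk$. Coquasi-bialgebra: a coassociative counital $\Bbbk$-coalgebra $(B,\Delta,\varepsilon)$ with coalgebra maps $m:B\otimes B\to B$ (written $ab$), $u:\Bbbk\to B$ ($1_B=u(1)$) and a convolution invertible linear map $\omega:B\otimes B\otimes B\to\Bbbk$ (reassociator) such that, for all $a,b,c,d\in B$: $\sum\omega(a_1\otimes b_1\otimes c_1d_1)\,\omega(a_2b_2\otimes c_2\otimes d_2)=\sum\omega(b_1\otimes c_1\otimes d_1)\,\omega(a_1\otimes b_2c_2\otimes d_2)\,\omega(a_2\otimes b_3\otimes c_3)$; $\omega(a\otimes 1_B\otimes b)=\varepsilon(a)\varepsilon(b)$;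 $1_Ba=a=a1_B$; $\sum a_1(b_1c_1)\,\omega(a_2\otimes b_2\otimes c_2)=\sum\omega(a_1\otimes b_1\otimes c_1)\,(a_2b_2)c_2$. Monoidal structure on left $B$-comodules: $V\otimes W$ has coaction $v\otimes w\mapsto\sum v_{-1}w_{-1}\otimes v_0\otimes w_0$; the unit is $\Bbbk$ with coaction $k\mapsto 1_B\otimes k$; the associativity constraint is $\mathfrak{a}_{U,V,W}((u\otimes v)\otimes w)=\sum\omega^{-1}(u_{-1}\otimes v_{-1}\otimes w_{-1})\,u_0\otimes(v_0\otimes w_0)$; the unit constraints are the canonical ones. Right rigid: a right dual of an object $X$ of a monoidal category $(\mathcal{C},\otimes,\mathbb{I},\mathfrak{a})$ is an object $X^\star$ with morphisms $\mathsf{ev}_X:X\otimes X^\star\to\mathbb{I}$, $\mathsf{db}_X:\mathbb{I}\to X^\star\otimes X$ such that (unit constraints suppressed) $(\mathsf{ev}_X\otimes X)\,\mathfrak{a}^{-1}_{X,X^\star,X}\,(X\otimes\mathsf{db}_X)=\mathrm{id}_X$ and $(X^\star\otimes\mathsf{ev}_X)\,\mathfrak{a}_{X^\star,X,X^\star}\,(\mathsf{db}_X\otimes X^\star)=\mathrm{id}_{X^\star}$. The category is right rigid if every object has a right dual. Given chosen right duals, the dual $f^\star:Y^\star\to X^\star$ of $f:X\to Y$ is the unique morphism with $\mathsf{ev}_X(X\otimes f^\star)=\mathsf{ev}_Y(f\otimes Y^\star)$. Preantipode for a coquasi-bialgebra $B$: a $\Bbbk$-linear map $S:B\to B$ with,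 for all $h\in B$, $\sum S(h_1)_1h_2\otimes S(h_1)_2=1_B\otimes S(h)$; $\sum S(h_2)_1\otimes h_1S(h_2)_2=S(h)\otimes 1_B$; $\sum\omega(h_1\otimes S(h_2)\otimes h_3)=\varepsilon(h)$. Coquasi-Hopf algebra: a coquasi-bialgebra $B$ with a coquasi-antipode, i.e. a triple $(s,\alpha,\beta)$ with $s:B\to B$ an anti-coalgebra endomorphism and $\alpha,\beta\in B^*$ such that, for all $h\in B$: $\sum h_1\beta(h_2)s(h_3)=\beta(h)1_B$; $\sum s(h_1)\alpha(h_2)h_3=\alpha(h)1_B$; $\sum\omega(h_1\otimes\beta(h_2)s(h_3)\alpha(h_4)\otimes h_5)=\varepsilon(h)$; $\sum\omega^{-1}(s(h_1)\otimes\alpha(h_2)h_3\beta(h_4)\otimes s(h_5))=\varepsilon(h)$. *)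

(* Defs.v *)
From HB Require Import structures.
From mathcomp Require Import all_boot all_order all_algebra.
From mathcomp Require Import sesquilinear boolp.

Set Implicit Arguments.
Unset Strict Implicit.
Unset Printing Implicit Defensive.
Import GRing.Theory.
Local Open Scope ring_scope.
Local Open Scope quotient_scope.

Declare Scope sweedler_scope.
Local Open Scope sweedler_scope.

Reserved Notation "U ⊗ V" (at level 35, right associativity).
Reserved Notation "a ⋅ b" (at level 33, left associativity).
Reserved Notation "\tsum_ ( x , y <- t ) E"
  (at level 41, E at level 41, x, y at level 50,
   format "'[' \tsum_ ( x ,  y  <-  t ) '/  '  E ']'").

Notation bilin f := (bilinear_for *:%R *:%R f).

(* Tensor product of two vector spaces: two formal sums of pairs are           *)
(* identified when every bilinear map to every vector space gives them the     *)
(* same value.  The lemmas [pure_bilin], [tsum_pure], [tsum_linear] and        *)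
(* [tens_ext] below form the universal property.                               *)
Section TensorType.
Variables (k : fieldType) (U V : lmodType k).

Definition formal_eval (W : nmodType) (f : U -> V -> W) (s : seq (U * V)) : W :=
  \sum_(p <- s) f p.1 p.2.

Definition formal_eq (s t : seq (U * V)) : Prop :=
  forall (W : lmodType k) (f : U -> V -> W),
    bilin f -> formal_eval f s = formal_eval f t.

Definition formal_eqb (s t : seq (U * V)) : bool := `[< formal_eq s t >].

Lemma formal_eqb_equiv : equiv_class_of formal_eqb.
Proof.
split=> [s|s t|t s r].
- by apply/asboolP.
- by apply/asboolP/asboolP => h W f hf; rewrite h.
- by move=> /asboolP h1 /asboolP h2; apply/asboolP => W f hf; rewrite h1 // h2.
Qed.

Canonical formal_equiv := EquivRelPack formal_eqb_equiv.
Canonical formal_encModRel := defaultEncModRel formal_eqb.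

Definition tensor := {eq_quot formal_eqb}.
HB.instance Definition _ := EqQuotient.on tensor.
HB.instance Definition _ := Choice.on tensor.

Definition tens_of (s : seq (U * V)) : tensor := \pi_tensor s.

Lemma tens_ofP (s t : seq (U * V)) : tens_of s = tens_of t <-> formal_eq s t.
Proof.
split=> [/eqmodP h|h]; first exact/asboolP.
by apply/eqmodP/asboolP.
Qed.

Lemma repr_tens_of s : formal_eq (repr (tens_of s)) s.
Proof. by apply/tens_ofP; rewrite /tens_of reprK. Qed.

Lemma tens_of_repr (t : tensor) : tens_of (repr t) = t.
Proof. exact: reprK. Qed.

Lemma tensorP (s t : tensor) : s = t <-> formal_eq (repr s) (repr t).
Proof. by rewrite -[s in s = _]tens_of_repr -[t in _ = t]tens_of_repr tens_ofP. Qed.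

Definition tens0 : tensor := tens_of [::].
Definition tens_add (s t : tensor) : tensor := tens_of (repr s ++ repr t).
Definition tens_scale (a : k) (t : tensor) : tensor :=
  tens_of [seq (a *: p.1, p.2) | p <- repr t].
Definition tens_opp (t : tensor) : tensor := tens_scale (-1) t.

Section Eval.
Variables (W : lmodType k) (f : U -> V -> W) (hf : bilin f).
Let ev (t : tensor) := formal_eval f (repr t).

Lemma bilinZl a u v : f (a *: u) v = a *: f u v.
Proof.
have h0 : f 0 v = 0.
  have /= := hf.1 v 1 0 0; rewrite !scale1r addr0 => h.
  by apply: (addIr (f 0 v)); rewrite add0r -h.
by have /= := hf.1 v a u 0; rewrite h0 !addr0.
Qed.

Lemma ev_tens_of s : ev (tens_of s) = formal_eval f s.
Proof. exact: repr_tens_of. Qed.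

Lemma ev0 : ev tens0 = 0.
Proof. by rewrite ev_tens_of /formal_eval big_nil. Qed.

Lemma evD s t : ev (tens_add s t) = ev s + ev t.
Proof. by rewrite ev_tens_of /formal_eval big_cat. Qed.

Lemma evZ a t : ev (tens_scale a t) = a *: ev t.
Proof.
rewrite ev_tens_of /formal_eval big_map scaler_sumr.
by apply: eq_bigr => p _; rewrite bilinZl.
Qed.

End Eval.

Local Ltac tens_by := apply/tensorP => W f hf; rewrite ?(evD, evZ, ev0) //.

Lemma tens_addA : associative tens_add.
Proof. by move=> s t r; tens_by; rewrite addrA. Qed.
Lemma tens_addC : commutative tens_add.
Proof. by move=> s t; tens_by; rewrite addrC. Qed.
Lemma tens_add0 : left_id tens0 tens_add.
Proof. by move=> s; tens_by; rewrite add0r. Qed.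
Lemma tens_addN : left_inverse tens0 tens_opp tens_add.
Proof. by move=> s; tens_by; rewrite scaleN1r addNr. Qed.

HB.instance Definition _ :=
  GRing.isZmodule.Build tensor tens_addA tens_addC tens_add0 tens_addN.

Lemma tens_scaleA a b t : tens_scale a (tens_scale b t) = tens_scale (a * b) t.
Proof. by tens_by; rewrite scalerA. Qed.
Lemma tens_scale1 : left_id 1 tens_scale.
Proof. by move=> t; tens_by; rewrite scale1r. Qed.
Lemma tens_scaleDr : right_distributive tens_scale +%R.
Proof. by move=> a s t; tens_by; rewrite scalerDr. Qed.
Lemma tens_scaleDl t : {morph tens_scale^~ t : a b / a + b >-> a + b}.
Proof. by move=> a b; tens_by; rewrite scalerDl. Qed.

HB.instance Definition _ := GRing.Zmodule_isLmodule.Build k tensor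
  tens_scaleA tens_scale1 tens_scaleDr tens_scaleDl.

Definition pure (u : U) (v : V) : tensor := tens_of [:: (u, v)].

(* Sweedler sum: the value at [t = \sum u_i ⊗ v_i] of the linear map induced   *)
(* by [f].  It is meaningful (independent of the chosen representative) when   *)
(* [f] is bilinear, which is the only way it is used below.                    *)
Definition tsum (W : nmodType) (f : U -> V -> W) (t : tensor) : W :=
  formal_eval f (repr t).

End TensorType.

Arguments tsum {k U V W} f t.
Notation "U ⊗ V" := (tensor U%type V%type) : type_scope.
Notation "u ⊗ v" := (pure u v) : ring_scope.
Notation "\tsum_ ( x , y <- t ) E" := (tsum (fun x y => E) t) : ring_scope.

Section TensorTheory.
Variables (k : fieldType).
Implicit Types U V W : lmodType k.

Lemma tsum_pure U V W (f : U -> V -> W) u v : bilin f -> tsum f (u ⊗ v) = f u v.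
Proof.
move=> hf; rewrite /tsum ev_tens_of //.
by rewrite /formal_eval big_seq1.
Qed.

Lemma tsum_linear U V W (f : U -> V -> W) : bilin f -> linear (tsum f).
Proof. by move=> hf a s t; rewrite {1}/tsum evD // evZ. Qed.

Lemma pure_bilin U V : bilin (@pure k U V).
Proof.
split=> [v|u] a x y; apply/tensorP => W f hf;
  rewrite evD // evZ // !ev_tens_of // /formal_eval !big_seq1 /=.
- exact: hf.1.
- exact: hf.2.
Qed.

Lemma pureDl U V (u u' : U) (v : V) : (u + u') ⊗ v = u ⊗ v + u' ⊗ v.
Proof. by have /= := (pure_bilin U V).1 v 1 u u'; rewrite !scale1r. Qed.
Lemma pureDr U V (u : U) (v v' : V) : u ⊗ (v + v') = u ⊗ v + u ⊗ v'.
Proof. by have /= := (pure_bilin U V).2 u 1 v v'; rewrite !scale1r. Qed.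
Lemma pure0l U V (v : V) : (0 : U) ⊗ v = 0.
Proof. by apply: (addIr (0 ⊗ v)); rewrite -pureDl !add0r. Qed.
Lemma pure0r U V (u : U) : u ⊗ (0 : V) = 0.
Proof. by apply: (addIr (u ⊗ 0)); rewrite -pureDr !add0r. Qed.
Lemma pureZl U V a (u : U) (v : V) : (a *: u) ⊗ v = a *: (u ⊗ v).
Proof. by have /= := (pure_bilin U V).1 v a u 0; rewrite pure0l !addr0. Qed.
Lemma pureZr U V a (u : U) (v : V) : u ⊗ (a *: v) = a *: (u ⊗ v).
Proof. by have /= := (pure_bilin U V).2 u a v 0; rewrite pure0r !addr0. Qed.

Lemma tens_of_sum U V (s : seq (U * V)) :
  tens_of s = \sum_(p <- s) p.1 ⊗ p.2 :> U ⊗ V.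
Proof.
elim: s => [|p s ih]; first by rewrite big_nil.
rewrite big_cons -ih; apply/tensorP => W f hf.
rewrite evD // !ev_tens_of // /formal_eval big_cons big_seq1.
by [].
Qed.

Lemma tsum_repr U V (t : U ⊗ V) : t = \sum_(p <- repr t) p.1 ⊗ p.2.
Proof. by rewrite -tens_of_sum tens_of_repr. Qed.

Lemma tens_ext U V W (f g : U ⊗ V -> W) : linear f -> linear g ->
  (forall u v, f (u ⊗ v) = g (u ⊗ v)) -> f =1 g.
Proof.
move=> hf hg h t.
pose F : {linear _ -> _} := HB.pack f (GRing.isLinear.Build _ _ _ _ f hf).
pose G : {linear _ -> _} := HB.pack g (GRing.isLinear.Build _ _ _ _ g hg).
rewrite -[f]/(F : _ -> _) -[g]/(G : _ -> _).
by rewrite (tsum_repr t) !linear_sum; apply: eq_bigr => p _; apply: h.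
Qed.

End TensorTheory.

Section Linearity.
Variables (k : fieldType) (T U V W U' V' : lmodType k).

Lemma lin_id : linear (fun x : T => x). Proof. by []. Qed.

Lemma lin_app (L : {linear U -> V}) (E : T -> U) :
  linear E -> linear (fun x => L (E x)).
Proof. by move=> hE a x y; rewrite hE linearP. Qed.

Lemma lin_sum (f : U -> V -> W) (E : T -> U ⊗ V) :
  bilin f -> linear E -> linear (fun x => tsum f (E x)).
Proof. by move=> hf hE a x y; rewrite hE tsum_linear. Qed.

Lemma lin_sum_par (F : T -> U -> V -> W) (t : U ⊗ V) :
  (forall u v, linear (fun x => F x u v)) -> linear (fun x => tsum (F x) t).
Proof.
move=> hF a x y; rewrite /tsum /formal_eval scaler_sumr -big_split.
by apply: eq_bigr => p _; rewrite hF.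
Qed.

Lemma lin_purel (E : T -> U) (v : V) : linear E -> linear (fun x => E x ⊗ v).
Proof. by move=> hE a x y; rewrite hE pureDl pureZl. Qed.

Lemma lin_purer (E : T -> V) (u : U) : linear E -> linear (fun x => u ⊗ E x).
Proof. by move=> hE a x y; rewrite hE pureDr pureZr. Qed.

Lemma lin_scalel (E : T -> k^o) (u : U) : linear E -> linear (fun x => E x *: u).
Proof. by move=> hE a x y; rewrite hE scalerDl scalerA. Qed.

Lemma lin_scaler (E : T -> U) (c : k) : linear E -> linear (fun x => c *: E x).
Proof. by move=> hE a x y; rewrite hE scalerDr !scalerA mulrC. Qed.

End Linearity.

Ltac lin := lazymatch goal with
  | |- bilinear_for _ _ _ => split=> ?; lin
  | |- forall _, _ => intro; lin
  | |- _ => solve [lin1]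
  end
with lin1 := first
  [ assumption | match goal with H : forall _, _ |- _ => exact: H end
  | exact: lin_id
  | apply: lin_purel; lin1 | apply: lin_purer; lin1
  | apply: lin_scalel; lin1 | apply: lin_scaler; lin1
  | apply: lin_app; lin1
  | apply: lin_sum; lin | apply: lin_sum_par => ? ?; lin1].

Section TensorMap.
Variables (k : fieldType) (U V U' V' : lmodType k).

Definition tmap (f : U -> U') (g : V -> V') (t : U ⊗ V) : U' ⊗ V' :=
  \tsum_(u, v <- t) f u ⊗ g v.

Section Linear.
Variables (f : {linear U -> U'}) (g : {linear V -> V'}).
Lemma tmap_bilin : bilin (fun u v => f u ⊗ g v).
Proof. lin. Qed.
Lemma tmap_is_linear : linear (tmap f g).
Proof. rewrite /tmap. lin. Qed.
HB.instance Definition _ := GRing.isLinear.Build _ _ _ _ (tmap f g) tmap_is_linear.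
Lemma tmap_pure u v : tmap f g (u ⊗ v) = f u ⊗ g v.
Proof. by rewrite /tmap tsum_pure //; lin. Qed.
End Linear.
End TensorMap.

Section SumTheory.
Variables (k : fieldType) (U V U' V' : lmodType k).

Lemma eq_tsum (W : nmodType) (f g : U -> V -> W) (t : U ⊗ V) :
  (forall u v, f u v = g u v) -> tsum f t = tsum g t.
Proof. by move=> h; apply: eq_bigr => p _. Qed.

Lemma tsum_app (W W' : lmodType k) (L : W -> W') (f : U -> V -> W) (t : U ⊗ V) :
  linear L -> L (tsum f t) = \tsum_(u, v <- t) L (f u v).
Proof.
move=> hL.
pose F : {linear _ -> _} := HB.pack L (GRing.isLinear.Build _ _ _ _ L hL).
by rewrite -[L]/(F : _ -> _) linear_sum.
Qed.

Lemma tsum_exchange (W : nmodType) (f : U -> V -> U' -> V' -> W)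
    (s : U ⊗ V) (t : U' ⊗ V') :
  \tsum_(a, b <- s) \tsum_(c, d <- t) f a b c d =
  \tsum_(c, d <- t) \tsum_(a, b <- s) f a b c d.
Proof. exact: exchange_big. Qed.

Lemma tsum_id (t : U ⊗ V) : \tsum_(u, v <- t) u ⊗ v = t.
Proof. by rewrite {2}[t]tsum_repr. Qed.

End SumTheory.

Section TensorVect.
Import VectorInternalTheory.
Variables (k : fieldType) (U V : vectType k).

Definition tens2mx (t : U ⊗ V) : 'M[k]_(dim U, dim V) :=
  \tsum_(u, v <- t) ((v2r u)^T *m v2r v).

Definition mx2tens (M : 'M[k]_(dim U, dim V)) : U ⊗ V :=
  \sum_i \sum_j M i j *: (r2v (delta_mx 0 i) ⊗ r2v (delta_mx 0 j)).

Lemma tens2mx_bilin : bilin (fun (u : U) (v : V) => (v2r u)^T *m v2r v).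
Proof.
split=> [v|u] a x y /=; rewrite linearP /=.
- by rewrite linearP /= mulmxDl scalemxAl.
- by rewrite mulmxDr scalemxAr.
Qed.

Lemma tens2mx_is_linear : linear tens2mx.
Proof. exact: tsum_linear tens2mx_bilin. Qed.

Lemma mx2tens_is_linear : linear mx2tens.
Proof.
move=> a M N; rewrite /mx2tens scaler_sumr -big_split; apply: eq_bigr => i _ /=.
rewrite scaler_sumr -big_split; apply: eq_bigr => j _ /=.
by rewrite !mxE scalerDl scalerA.
Qed.

HB.instance Definition _ :=
  GRing.isLinear.Build _ _ _ _ tens2mx tens2mx_is_linear.
HB.instance Definition _ :=
  GRing.isLinear.Build _ _ _ _ mx2tens mx2tens_is_linear.

Lemma tens2mxK : cancel tens2mx mx2tens.
Proof.
have hl : linear (mx2tens \o tens2mx) by move=> a x y; exact: linearP.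
move=> t; apply: (tens_ext hl (@lin_id _ _)) => u v /=.
rewrite /tens2mx tsum_pure; last exact: tens2mx_bilin.
pose P (w : V) : {linear U -> (U ⊗ V)%type} := HB.pack (fun u => u ⊗ w)
  (GRing.isLinear.Build _ _ _ _ _ ((@pure_bilin k U V).1 w)).
pose Q (w : U) : {linear V -> (U ⊗ V)%type} := HB.pack (fun v => w ⊗ v)
  (GRing.isLinear.Build _ _ _ _ _ ((@pure_bilin k U V).2 w)).
rewrite /mx2tens -{2}[u]v2rK -{2}[v]v2rK.
rewrite [in RHS](row_sum_delta (v2r u)) [in RHS](row_sum_delta (v2r v)).
rewrite -[RHS]/(P _ _) !linear_sum; apply: eq_bigr => i _.
rewrite -[RHS]/(Q _ _) linear_sum; apply: eq_bigr => j _ /=.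
by rewrite !linearZ /= pureZl pureZr scalerA !mxE big_ord1 !mxE.
Qed.

Lemma mx2tensK : cancel mx2tens tens2mx.
Proof.
move=> M; rewrite linear_sum [RHS]matrix_sum_delta; apply: eq_bigr => i _.
rewrite linear_sum; apply: eq_bigr => j _; rewrite linearZ /=; congr (_ *: _).
rewrite /tens2mx tsum_pure; last exact: tens2mx_bilin.
by rewrite !r2vK trmx_delta mul_delta_mx.
Qed.

Lemma tens_vect_iso : Vector.axiom (dim U * dim V) (U ⊗ V).
Proof.
exists (mxvec \o tens2mx).
  by move=> a x y /=; rewrite !linearP.
exists (mx2tens \o vec_mx) => x /=.
- by rewrite mxvecK tens2mxK.
- by rewrite mx2tensK vec_mxK.
Qed.

HB.instance Definition _ := Lmodule_hasFinDim.Build k (U ⊗ V)%type tens_vect_iso.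

End TensorVect.

Section Coalgebra.
Variable k : fieldType.

Record coalgebra := Coalgebra {
  coalg_sort :> lmodType k;
  comul : {linear coalg_sort -> (coalg_sort ⊗ coalg_sort)%type};
  counit : {linear coalg_sort -> k^o};
  comulA : forall h,
    \tsum_(x, h3 <- comul h) \tsum_(h1, h2 <- comul x) h1 ⊗ (h2 ⊗ h3) =
    \tsum_(h1, x <- comul h) h1 ⊗ comul x;
  comul1l : forall h, \tsum_(h1, h2 <- comul h) counit h1 *: h2 = h;
  comul1r : forall h, \tsum_(h1, h2 <- comul h) counit h2 *: h1 = h
}.

Local Arguments comul {c}.
Local Arguments counit {c}.

Record coaction (C : coalgebra) (V : lmodType k) := Coaction {
  coact :> {linear V -> (C ⊗ V)%type};
  coactA : forall v,
    \tsum_(c, w <- coact v) \tsum_(c1, c2 <- comul c) c1 ⊗ (c2 ⊗ w) =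
    \tsum_(c, w <- coact v) c ⊗ coact w;
  coact1 : forall v, \tsum_(c, w <- coact v) counit c *: w = v
}.

Record fdcomod (C : coalgebra) := FdComod {
  fdcomod_sort :> vectType k;
  fdcomod_coact : coaction C fdcomod_sort
}.

End Coalgebra.

Arguments comul {k c}.
Arguments counit {k c}.

Notation "'Δ' h" := (comul h) (at level 10, h at level 8) : sweedler_scope.
Notation "'ε' h" := (counit h) (at level 10, h at level 8) : sweedler_scope.
Notation ρ X := (coact (fdcomod_coact X)).


(* The unit map u : k -> B is given by its value [unit1] = u(1).  [reassocV]   *)
(* is the convolution inverse of [reassoc]; being unique, it is recorded as    *)
(* data.                                                                       *)
Record coquasi_ops (k : fieldType) (C : coalgebra k) := CoquasiOps {
  mult : {linear (C ⊗ C)%type -> C};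
  unit1 : C;
  reassoc : {linear (C ⊗ (C ⊗ C))%type -> k^o};
  reassocV : {linear (C ⊗ (C ⊗ C))%type -> k^o}
}.

Section CoquasiAxioms.
Variables (k : fieldType) (C : coalgebra k) (ops : coquasi_ops C).

Local Notation "a ⋅ b" := (mult ops (a ⊗ b)).
Local Notation e := (unit1 ops).
Local Notation ω a b c := (reassoc ops (a ⊗ (b ⊗ c)) : k).
Local Notation ωV a b c := (reassocV ops (a ⊗ (b ⊗ c)) : k).

(* Iterated coproducts are nested sums, h1 ⊗ h2 ⊗ h3 coming from h1 ⊗ h' with  *)
(* h2 ⊗ h3 = Δ h'.  The four fields [mult_comul] to [unit_counit] say that the *)
(* multiplication and the unit are coalgebra maps.                             *)
Record coquasi_axioms : Prop := CoquasiAxioms {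
  mult_comul : forall a b,
    Δ (a ⋅ b) =
    \tsum_(a1, a2 <- Δ a) \tsum_(b1, b2 <- Δ b) (a1 ⋅ b1) ⊗ (a2 ⋅ b2);
  mult_counit : forall a b, ε (a ⋅ b) = ε a * ε b :> k;
  unit_comul : Δ e = e ⊗ e;
  unit_counit : ε e = 1 :> k;
  unit_multl : forall a, e ⋅ a = a;
  unit_multr : forall a, a ⋅ e = a;
  mult_assoc : forall a b c,
    \tsum_(a1, a2 <- Δ a) \tsum_(b1, b2 <- Δ b) \tsum_(c1, c2 <- Δ c)
      ω a2 b2 c2 *: (a1 ⋅ (b1 ⋅ c1)) =
    \tsum_(a1, a2 <- Δ a) \tsum_(b1, b2 <- Δ b) \tsum_(c1, c2 <- Δ c)
      ω a1 b1 c1 *: ((a2 ⋅ b2) ⋅ c2);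
  reassoc_unit : forall a b, ω a e b = ε a * ε b :> k;
  reassoc_cocycle : forall a b c d,
    \tsum_(a1, a2 <- Δ a) \tsum_(b1, b2 <- Δ b)
    \tsum_(c1, c2 <- Δ c) \tsum_(d1, d2 <- Δ d)
      ω a1 b1 (c1 ⋅ d1) * ω (a2 ⋅ b2) c2 d2 =
    \tsum_(a1, a2 <- Δ a)
    \tsum_(b1, b' <- Δ b) \tsum_(b2, b3 <- Δ b')
    \tsum_(c1, c' <- Δ c) \tsum_(c2, c3 <- Δ c')
    \tsum_(d1, d2 <- Δ d)
      ω b1 c1 d1 * ω a1 (b2 ⋅ c2) d2 * ω a2 b3 c3;
  reassocV_l : forall a b c,
    \tsum_(a1, a2 <- Δ a) \tsum_(b1, b2 <- Δ b) \tsum_(c1, c2 <- Δ c)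
      ωV a1 b1 c1 * ω a2 b2 c2 = ε a * ε b * ε c :> k;
  reassocV_r : forall a b c,
    \tsum_(a1, a2 <- Δ a) \tsum_(b1, b2 <- Δ b) \tsum_(c1, c2 <- Δ c)
      ω a1 b1 c1 * ωV a2 b2 c2 = ε a * ε b * ε c :> k
}.

End CoquasiAxioms.

Record coquasi_bialgebra (k : fieldType) := CoquasiBialgebra {
  cqb_coalg :> coalgebra k;
  cqb_ops : coquasi_ops cqb_coalg;
  cqb_axioms : coquasi_axioms cqb_ops
}.

Notation "a ⋅ b" := (mult (cqb_ops _) (a ⊗ b)) : sweedler_scope.
Notation "1_[ B ]" := (unit1 (cqb_ops B)) (format "1_[ B ]") : sweedler_scope.

Section Coquasi.
Variables (k : fieldType) (B : coquasi_bialgebra k).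
Implicit Types a b c h : B.

Definition omega a b c : k := reassoc (cqb_ops B) (a ⊗ (b ⊗ c)).
Definition omegaV a b c : k := reassocV (cqb_ops B) (a ⊗ (b ⊗ c)).

Record preantipode (S : {linear B -> B}) : Prop := Preantipode {
  preantipode_l : forall h,
    \tsum_(h1, h2 <- Δ h) \tsum_(x1, x2 <- Δ (S h1)) (x1 ⋅ h2) ⊗ x2 =
    1_[B] ⊗ S h;
  preantipode_r : forall h,
    \tsum_(h1, h2 <- Δ h) \tsum_(x1, x2 <- Δ (S h2)) x1 ⊗ (h1 ⋅ x2) =
    S h ⊗ 1_[B];
  preantipode_omega : forall h,
    \tsum_(h1, h' <- Δ h) \tsum_(h2, h3 <- Δ h') omega h1 (S h2) h3 = ε h
}.

Record coquasi_antipode (s : {linear B -> B}) (α β : {linear B -> k^o}) : Prop :=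
CoquasiAntipode {
  antipode_comul : forall h, Δ (s h) = \tsum_(h1, h2 <- Δ h) s h2 ⊗ s h1;
  antipode_counit : forall h, ε (s h) = ε h;
  antipode_beta : forall h,
    \tsum_(h1, h' <- Δ h) \tsum_(h2, h3 <- Δ h') (β h2 : k) *: (h1 ⋅ s h3) =
    (β h : k) *: 1_[B];
  antipode_alpha : forall h,
    \tsum_(h1, h' <- Δ h) \tsum_(h2, h3 <- Δ h') (α h2 : k) *: (s h1 ⋅ h3) =
    (α h : k) *: 1_[B];
  antipode_omega : forall h,
    \tsum_(h1, x <- Δ h) \tsum_(h2, y <- Δ x)
    \tsum_(h3, z <- Δ y) \tsum_(h4, h5 <- Δ z)
      omega h1 ((β h2 * α h4 : k) *: s h3) h5 = ε h;
  antipode_omegaV : forall h,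
    \tsum_(h1, x <- Δ h) \tsum_(h2, y <- Δ x)
    \tsum_(h3, z <- Δ y) \tsum_(h4, h5 <- Δ z)
      omegaV (s h1) ((α h2 * β h4 : k) *: h3) (s h5) = ε h
}.

End Coquasi.

Section SweedlerLemmas.
Variables (k : fieldType) (C : coalgebra k) (V : lmodType k) (r : coaction C V).

Lemma coact_tsumA (W : lmodType k) (F : C -> C -> V -> W) v :
  (forall c w, linear (fun x => F x c w)) ->
  (forall c w, linear (fun x => F c x w)) ->
  (forall c d, linear (F c d)) ->
  \tsum_(c, w <- coact r v) \tsum_(c1, c2 <- Δ c) F c1 c2 w =
  \tsum_(c, w <- coact r v) \tsum_(d, w0 <- coact r w) F c d w0.
Proof.
move=> h1 h2 h3.
pose G (t : C ⊗ (C ⊗ V)) := \tsum_(c, s <- t) \tsum_(d, w <- s) F c d w.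
have hG2 c : bilin (F c) by split=> ?; [exact: h2 | exact: h3].
have hG1 : bilin (fun c (s : C ⊗ V) => \tsum_(d, w <- s) F c d w).
  split=> [s|c] /=; first by apply: lin_sum_par => ? ?; apply: h1.
  exact: tsum_linear.
have hG : linear G by exact: tsum_linear.
have := congr1 G (coactA r v); rewrite !tsum_app //.
under eq_tsum => c w.
  rewrite tsum_app //; under eq_tsum => c1 c2 do rewrite /G tsum_pure // tsum_pure //.
  over.
move=> ->; apply: eq_tsum => c w.
by rewrite /G tsum_pure.
Qed.

End SweedlerLemmas.

Section Monoidal.
Variables (k : fieldType) (B : coquasi_bialgebra k).

Section TensorComodule.
Variables (V W : lmodType k) (rV : coaction B V) (rW : coaction B W).

Definition tens_coact (t : V ⊗ W) : B ⊗ (V ⊗ W) :=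
  \tsum_(v, w <- t) \tsum_(v1, v0 <- coact rV v) \tsum_(w1, w0 <- coact rW w)
    (v1 ⋅ w1) ⊗ (v0 ⊗ w0).

Lemma tens_coact_bilin : bilin (fun v w =>
  \tsum_(v1, v0 <- coact rV v) \tsum_(w1, w0 <- coact rW w)
    (v1 ⋅ w1) ⊗ (v0 ⊗ w0)).
Proof. lin. Qed.

Lemma tens_coact_is_linear : linear tens_coact.
Proof. exact: tsum_linear tens_coact_bilin. Qed.

HB.instance Definition _ :=
  GRing.isLinear.Build _ _ _ _ tens_coact tens_coact_is_linear.

Lemma tens_coact_pure v w : tens_coact (v ⊗ w) =
  \tsum_(v1, v0 <- coact rV v) \tsum_(w1, w0 <- coact rW w)
    (v1 ⋅ w1) ⊗ (v0 ⊗ w0).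
Proof. exact: tsum_pure tens_coact_bilin. Qed.

Lemma tens_coactA t :
  \tsum_(c, x <- tens_coact t) \tsum_(c1, c2 <- comul c) c1 ⊗ (c2 ⊗ x) =
  \tsum_(c, x <- tens_coact t) c ⊗ tens_coact x.
Proof.
move: t; apply: tens_ext; [lin | lin |] => v w.
rewrite tens_coact_pure.
pose G (t : B ⊗ (V ⊗ W)) :=
  \tsum_(c, x <- t) \tsum_(c1, c2 <- comul c) c1 ⊗ (c2 ⊗ x).
pose H (t : B ⊗ (V ⊗ W)) := \tsum_(c, x <- t) c ⊗ tens_coact x.
have hG : linear G by rewrite /G; lin.
have hH : linear H by rewrite /H; lin.
rewrite -/(G _) -/(H _) !tsum_app //.
pose Q a1 a2 v0 : B ⊗ (B ⊗ (V ⊗ W)) := 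
  \tsum_(w1, w0 <- coact rW w) \tsum_(b1, b2 <- Δ w1)
   (a1 ⋅ b1) ⊗ ((a2 ⋅ b2) ⊗ (v0 ⊗ w0)).
transitivity (\tsum_(v1, v0 <- coact rV v) \tsum_(a1, a2 <- Δ v1) Q a1 a2 v0).
  apply: eq_tsum => v1 v0.
  rewrite tsum_app // /Q tsum_exchange; apply: eq_tsum => w1 w0.
  rewrite /G tsum_pure; last by lin.
  rewrite (mult_comul (cqb_axioms B)).
  rewrite (tsum_app (L := tsum _)); last by lin.
  apply: eq_tsum => a1 a2.
  rewrite (tsum_app (L := tsum _)); last by lin.
  by apply: eq_tsum => b1 b2; rewrite tsum_pure //; lin.
rewrite coact_tsumA; try by rewrite /Q; lin.
apply: eq_tsum => v1 v0; rewrite tsum_app //.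
transitivity (\tsum_(d, v00 <- coact rV v0) \tsum_(w1, w0 <- coact rW w)
   \tsum_(b, w00 <- coact rW w0) (v1 ⋅ w1) ⊗ ((d ⋅ b) ⊗ (v00 ⊗ w00))).
  by apply: eq_tsum => d v00; rewrite /Q coact_tsumA //; lin.
rewrite tsum_exchange; apply: eq_tsum => w1 w0.
rewrite /H tsum_pure; last by lin.
rewrite tens_coact_pure tsum_app; last by lin.
by apply: eq_tsum => d v00; rewrite tsum_app //; lin.
Qed.

Lemma tens_coact1 t : \tsum_(c, x <- tens_coact t) ε (c : B) *: x = t.
Proof.
move: t; apply: tens_ext; [lin | lin |] => v w.
rewrite tens_coact_pure (tsum_app (L := tsum _)); last by lin.
rewrite -[in RHS](coact1 rV v) -[in RHS](coact1 rW w).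
rewrite (tsum_app (L := fun x => x ⊗ _)); last by lin.
apply: eq_tsum => v1 v0.
rewrite (tsum_app (L := tsum _)); last by lin.
rewrite (tsum_app (L := fun x => _ ⊗ x)); last by lin.
apply: eq_tsum => w1 w0; rewrite tsum_pure; last by lin.
by rewrite (mult_counit (cqb_axioms B)) pureZl pureZr scalerA.
Qed.

Definition tens_coaction : coaction B (V ⊗ W)%type :=
  Coaction tens_coactA tens_coact1.

End TensorComodule.

Definition unit_coact (a : k^o) : B ⊗ k^o := 1_[B] ⊗ a.

Lemma unit_coact_is_linear : linear unit_coact.
Proof. exact: (pure_bilin _ _).2. Qed.

HB.instance Definition _ :=
  GRing.isLinear.Build _ _ _ _ unit_coact unit_coact_is_linear.

Lemma unit_coactA a :
  \tsum_(c, x <- unit_coact a) \tsum_(c1, c2 <- comul c) c1 ⊗ (c2 ⊗ x) =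
  \tsum_(c, x <- unit_coact a) c ⊗ unit_coact x.
Proof.
rewrite /unit_coact !tsum_pure; try lin.
by rewrite (unit_comul (cqb_axioms B)) tsum_pure //; lin.
Qed.

Lemma unit_coact1 a : \tsum_(c, x <- unit_coact a) ε (c : B) *: x = a.
Proof.
rewrite /unit_coact tsum_pure; last by lin.
by rewrite (unit_counit (cqb_axioms B)) scale1r.
Qed.

Definition unit_coaction : coaction B k^o := Coaction unit_coactA unit_coact1.

Definition tensC (X Y : fdcomod B) : fdcomod B :=
  FdComod (tens_coaction (fdcomod_coact X) (fdcomod_coact Y)).

Definition unitC : fdcomod B := FdComod unit_coaction.

Section Associator.
Variables X Y Z : fdcomod B.

(* On pure tensors, (u ⊗ v) ⊗ w is sent to                                     *)
(* Σ ω^-1(u_{-1} ⊗ v_{-1} ⊗ w_{-1}) u_0 ⊗ (v_0 ⊗ w_0): see [assocC_pure].      *)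
Definition assocC (t : (X ⊗ Y) ⊗ Z) : X ⊗ (Y ⊗ Z) :=
  \tsum_(p, w <- t) \tsum_(u, v <- p)
  \tsum_(u1, u0 <- ρ X u) \tsum_(v1, v0 <- ρ Y v) \tsum_(w1, w0 <- ρ Z w)
    omegaV u1 v1 w1 *: (u0 ⊗ (v0 ⊗ w0)).

Definition assocVC (t : X ⊗ (Y ⊗ Z)) : (X ⊗ Y) ⊗ Z :=
  \tsum_(u, q <- t) \tsum_(v, w <- q)
  \tsum_(u1, u0 <- ρ X u) \tsum_(v1, v0 <- ρ Y v) \tsum_(w1, w0 <- ρ Z w)
    omega u1 v1 w1 *: ((u0 ⊗ v0) ⊗ w0).

Lemma assocC_is_linear : linear assocC.
Proof. rewrite /assocC /omegaV; lin. Qed.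

Lemma assocVC_is_linear : linear assocVC.
Proof. rewrite /assocVC /omega; lin. Qed.

HB.instance Definition _ := GRing.isLinear.Build _ _ _ _ assocC assocC_is_linear.
HB.instance Definition _ := GRing.isLinear.Build _ _ _ _ assocVC assocVC_is_linear.

Lemma assocC_pure u v w : assocC ((u ⊗ v) ⊗ w) =
  \tsum_(u1, u0 <- ρ X u) \tsum_(v1, v0 <- ρ Y v) \tsum_(w1, w0 <- ρ Z w)
    omegaV u1 v1 w1 *: (u0 ⊗ (v0 ⊗ w0)).
Proof. by rewrite /assocC /omegaV !tsum_pure //; lin. Qed.

Lemma assocVC_pure u v w : assocVC (u ⊗ (v ⊗ w)) =
  \tsum_(u1, u0 <- ρ X u) \tsum_(v1, v0 <- ρ Y v) \tsum_(w1, w0 <- ρ Z w)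
    omega u1 v1 w1 *: ((u0 ⊗ v0) ⊗ w0).
Proof. by rewrite /assocVC /omega !tsum_pure //; lin. Qed.

Lemma coact_tsumA3 (W : lmodType k) (f g : {linear (B ⊗ (B ⊗ B))%type -> k^o})
    (T : X -> Y -> Z -> W) u v w :
  (forall y z, linear (fun x => T x y z)) ->
  (forall x z, linear (fun y => T x y z)) ->
  (forall x y, linear (T x y)) ->
  (forall a b c,
    \tsum_(a1, a2 <- Δ a) \tsum_(b1, b2 <- Δ b) \tsum_(c1, c2 <- Δ c)
      (f (a1 ⊗ (b1 ⊗ c1)) : k) * g (a2 ⊗ (b2 ⊗ c2)) = ε a * ε b * ε c :> k) ->
  \tsum_(u1, u0 <- ρ X u) \tsum_(v1, v0 <- ρ Y v) \tsum_(w1, w0 <- ρ Z w)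
    (f (u1 ⊗ (v1 ⊗ w1)) : k) *:
  (\tsum_(u1', u0' <- ρ X u0) \tsum_(v1', v0' <- ρ Y v0) \tsum_(w1', w0' <- ρ Z w0)
     (g (u1' ⊗ (v1' ⊗ w1')) : k) *: T u0' v0' w0') = T u v w.
Proof.
move=> hT1 hT2 hT3 hfg.
pose Q6 a b c a' b' c' x y z : W :=
  (f (a ⊗ (b ⊗ c)) : k) *: ((g (a' ⊗ (b' ⊗ c')) : k) *: T x y z).
transitivity (\tsum_(u1, x <- ρ X u) \tsum_(u1', x' <- ρ X x)
  \tsum_(v1, y <- ρ Y v) \tsum_(v1', y' <- ρ Y y)
  \tsum_(w1, z <- ρ Z w) \tsum_(w1', z' <- ρ Z z)
    Q6 u1 v1 w1 u1' v1' w1' x' y' z').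
  apply: eq_tsum => u1 x.
  transitivity (\tsum_(v1, y <- ρ Y v) \tsum_(u1', x' <- ρ X x)
    \tsum_(w1, z <- ρ Z w) \tsum_(v1', y' <- ρ Y y) \tsum_(w1', z' <- ρ Z z)
      Q6 u1 v1 w1 u1' v1' w1' x' y' z').
    apply: eq_tsum => v1 y; rewrite [RHS]tsum_exchange; apply: eq_tsum => w1 z.
    rewrite tsum_app; last by lin.
    apply: eq_tsum => u1' x'; rewrite tsum_app; last by lin.
    by apply: eq_tsum => v1' y'; rewrite tsum_app //; lin.
  rewrite tsum_exchange; apply: eq_tsum => u1' x'; apply: eq_tsum => v1 y.
  exact: tsum_exchange.
rewrite -(@coact_tsumA _ _ _ (fdcomod_coact X) _ (fun u1 u1' x' =>
  \tsum_(v1, y <- ρ Y v) \tsum_(v1', y' <- ρ Y y)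
  \tsum_(w1, z <- ρ Z w) \tsum_(w1', z' <- ρ Z z)
    Q6 u1 v1 w1 u1' v1' w1' x' y' z')); try by rewrite /Q6; lin.
transitivity (\tsum_(u1, x <- ρ X u) \tsum_(a1, a2 <- Δ u1)
  \tsum_(v1, y <- ρ Y v) \tsum_(b1, b2 <- Δ v1)
  \tsum_(w1, z <- ρ Z w) \tsum_(c1, c2 <- Δ w1) Q6 a1 b1 c1 a2 b2 c2 x y z).
  apply: eq_tsum => u1 x; apply: eq_tsum => a1 a2.
  rewrite -(@coact_tsumA _ _ _ (fdcomod_coact Y) _ (fun v1 v1' y' =>
    \tsum_(w1, z <- ρ Z w) \tsum_(w1', z' <- ρ Z z)
      Q6 a1 v1 w1 a2 v1' w1' x y' z')); try by rewrite /Q6; lin.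
  apply: eq_tsum => v1 y; apply: eq_tsum => b1 b2.
  by rewrite -(@coact_tsumA _ _ _ (fdcomod_coact Z) _ (fun w1 w1' z' =>
      Q6 a1 b1 w1 a2 b2 w1' x y z')) //; rewrite /Q6; lin.
transitivity (\tsum_(u1, x <- ρ X u) \tsum_(v1, y <- ρ Y v)
  \tsum_(w1, z <- ρ Z w) (ε u1 * ε v1 * ε w1 : k) *: T x y z).
  apply: eq_tsum => u1 x; rewrite tsum_exchange; apply: eq_tsum => v1 y.
  transitivity (\tsum_(w1, z <- ρ Z w) \tsum_(a1, a2 <- Δ u1)
    \tsum_(b1, b2 <- Δ v1) \tsum_(c1, c2 <- Δ w1) Q6 a1 b1 c1 a2 b2 c2 x y z).
    rewrite [RHS]tsum_exchange; apply: eq_tsum => a1 a2; exact: tsum_exchange.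
  apply: eq_tsum => w1 z; rewrite -hfg.
  pose L (c : k^o) : W := c *: T x y z.
  have hL : linear L by rewrite /L; lin.
  rewrite -[RHS]/(L _) tsum_app //; apply: eq_tsum => a1 a2.
  rewrite tsum_app //; apply: eq_tsum => b1 b2.
  rewrite tsum_app //; apply: eq_tsum => c1 c2.
  by rewrite /L /Q6 scalerA.
rewrite -[in RHS](coact1 (fdcomod_coact X) u) -[in RHS](coact1 (fdcomod_coact Y) v).
rewrite -[in RHS](coact1 (fdcomod_coact Z) w).
rewrite (tsum_app (L := fun x => T x _ _)) //; apply: eq_tsum => u1 x.
rewrite (tsum_app (L := fun y => T _ y _)) //; apply: eq_tsum => v1 y.
rewrite (tsum_app (L := T _ _)) //; apply: eq_tsum => w1 z.
have sc (S : lmodType k) (S' : lmodType k) (L : S -> S') : linear L ->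
    forall c s, L (c *: s) = c *: L s.
  move=> hL c s; have h := hL 1 0 0; rewrite !scale1r addr0 in h.
  have h0 : L 0 = 0 by apply: (addIr (L 0)); rewrite add0r -h.
  by have := hL c s 0; rewrite h0 !addr0.
rewrite (sc _ _ (fun x => T x _ _)) // (sc _ _ (fun y => T _ y _)) //.
by rewrite (sc _ _ (T _ _)) // !scalerA.
Qed.

Lemma assocCK : cancel assocC assocVC.
Proof.
have hl : linear (assocVC \o assocC) by move=> a x y; exact: linearP.
apply: (tens_ext hl (@lin_id _ _)) => p w /=; move: p.
apply: tens_ext; try by lin.
move=> u v; rewrite assocC_pure.
rewrite tsum_app; last by lin.
rewrite -[RHS](coact_tsumA3 (T := fun x y z => (x ⊗ y) ⊗ z) u v w
  _ _ _ (reassocV_l (cqb_axioms B))); try by lin.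
apply: eq_tsum => u1 x; rewrite tsum_app; last by lin.
apply: eq_tsum => v1 y; rewrite tsum_app; last by lin.
apply: eq_tsum => w1 z; rewrite linearZ /= assocVC_pure.
by [].
Qed.

Lemma assocVCK : cancel assocVC assocC.
Proof.
have hl : linear (assocC \o assocVC) by move=> a x y; exact: linearP.
apply: (tens_ext hl (@lin_id _ _)) => u q /=; move: q.
apply: tens_ext; try by lin.
move=> v w; rewrite assocVC_pure.
rewrite tsum_app; last by lin.
rewrite -[RHS](coact_tsumA3 (T := fun x y z => x ⊗ (y ⊗ z)) u v w
  _ _ _ (reassocV_r (cqb_axioms B))); try by lin.
apply: eq_tsum => u1 x; rewrite tsum_app; last by lin.
apply: eq_tsum => v1 y; rewrite tsum_app; last by lin.
apply: eq_tsum => w1 z; rewrite linearZ /= assocC_pure.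
by [].
Qed.
End Associator.

Definition colinear (X Y : fdcomod B) (f : 'Hom(X, Y)) : Prop :=
  forall x, ρ Y (f x) = tmap idfun f (ρ X x).

End Monoidal.

(* Morphisms of comodules are 'Hom maps satisfying [colinear]; the equations   *)
(* of a right dual are evaluated on elements, with the unit constraints        *)
(* written out.                                                                *)
Section Duality.
Variables (k : fieldType) (B : coquasi_bialgebra k).

Section UnitConstraints.
Variable X : fdcomod B.
Definition lunitC (t : unitC B ⊗ X) : X := \tsum_(c, x <- t) (c : k^o) *: x.
Definition lunitVC (x : X) : unitC B ⊗ X := (1 : k^o) ⊗ x.
Definition runitC (t : X ⊗ unitC B) : X := \tsum_(x, c <- t) (c : k^o) *: x.
Definition runitVC (x : X) : X ⊗ unitC B := x ⊗ (1 : k^o).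
End UnitConstraints.

Record right_dual (X Y : fdcomod B)
    (ev : 'Hom(tensC X Y, unitC B)) (db : 'Hom(unitC B, tensC Y X)) : Prop :=
RightDual {
  ev_colinear : colinear ev;
  db_colinear : colinear db;
  right_dual_obj : forall x : X,
    lunitC (tmap ev idfun (assocVC (tmap idfun db (runitVC x)))) = x;
  right_dual_dual : forall y : Y,
    runitC (tmap idfun ev (assocC (tmap db idfun (lunitVC y)))) = y
}.

Definition right_rigid : Prop :=
  forall X : fdcomod B, exists (Y : fdcomod B)
    (ev : 'Hom(tensC X Y, unitC B)) (db : 'Hom(unitC B, tensC Y X)),
    right_dual ev db.

Definition dual_morphism (X X' Y Y' : fdcomod B)
    (evX : 'Hom(tensC X X', unitC B)) (evY : 'Hom(tensC Y Y', unitC B))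
    (f : 'Hom(X, Y)) (g : 'Hom(Y', X')) : Prop :=
  colinear g /\
  forall t : X ⊗ Y', evX (tmap idfun g t) = evY (tmap f idfun t).

Definition transpose (U V : vectType k) (f : 'Hom(U, V)) :
    'Hom('Hom(V, k^o), 'Hom(U, k^o)) :=
  linfun (fun φ : 'Hom(V, k^o) => (φ \o f)%VF).

Lemma transposeE (U V : vectType k) (f : 'Hom(U, V)) (φ : 'Hom(V, k^o)) u :
  transpose f φ u = φ (f u).
Proof.
have h : linear (fun φ : 'Hom(V, k^o) => (φ \o f)%VF).
  by move=> a x y; rewrite comp_lfunDl comp_lfunZl.
pose L : {linear _ -> _} := HB.pack (fun φ : 'Hom(V, k^o) => (φ \o f)%VF)
  (GRing.isLinear.Build _ _ _ _ _ h).
by rewrite /transpose -[X in linfun X]/(L : _ -> _) lfunE /= comp_lfunE.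
Qed.

(* Right duals carried by the linear duals, dual morphisms being transposes.   *)
Definition linear_right_duals : Prop :=
  exists (r : forall X : fdcomod B, coaction B 'Hom(X, k^o)),
  let D X := FdComod (r X) in
  exists (ev : forall X, 'Hom(tensC X (D X), unitC B))
         (db : forall X, 'Hom(unitC B, tensC (D X) X)),
    (forall X, right_dual (ev X) (db X)) /\
    (forall (X Y : fdcomod B) (f : 'Hom(X, Y)), colinear f ->
       dual_morphism (ev X) (ev Y) f (transpose f)).

End Duality.

Definition has_preantipode (k : fieldType) (B : coquasi_bialgebra k) : Prop :=
  exists S : {linear B -> B}, preantipode S.

Definition is_coquasi_Hopf (k : fieldType) (B : coquasi_bialgebra k) : Prop :=
  exists (s : {linear B -> B}) (α β : {linear B -> k^o}), coquasi_antipode s α β.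

(* Main.v *)
Require Import Defs.
From HB Require Import structures.
From mathcomp Require Import all_boot all_order all_algebra.
From mathcomp Require Import boolp classical_sets ring.

Set Implicit Arguments.
Unset Strict Implicit.
Unset Printing Implicit Defensive.
Import GRing.Theory.
Local Open Scope ring_scope.
Local Open Scope sweedler_scope.

(** The proof rests on matrix coefficients.  A finite-dimensional comodule with a
    chosen basis is a matrix A over B such that Δ A_ij = Σ A_il ⊗ A_lj and
    ε A_ij = δ_ij, here called a comatrix, and Sweedler sums over iterated
    coactions become finite sums over indices.  A right dual becomes a comatrix A'
    with two scalar matrices E (evaluation) and D (dual basis), subject to two
    invariance conditions and two snake identities ([matrix_dual], [right_dualP]).

    Two facts on coalgebras connect comatrices with linear maps defined on B.  The
    fundamental theorem of comodules ([finite_subcomodule]) puts every element of B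
    in the span of a comatrix, so that an identity between linear maps may be
    checked on the entries of comatrices ([comatrix_ext]).  Moreover B is the coend
    of its finite-dimensional comodules ([natural_factor]): a family of values on
    the entries of all comatrices comes from a linear map as soon as it respects
    comodule maps.

    Rigidity gives a preantipode: for a dual of A put
    S(A_im) = Σ D_jm E_il A'_jl ([dual_coef]).  The two coinvariance axioms of S are
    the colinearity of the dual basis and of the evaluation, and the axiom on ω is
    the snake identity of the comodule.  That these values respect comodule maps
    holds because every comodule map has a mate between the duals; the properties
    of mates ([mate_intertwines], [pairing_mate], [copairing_mate]) come from
    quasi-associativity and from the pentagon, in which invariance trivializes
    three of the five sides.

    Conversely, given S, the dual of A is the comodule generated by the functions
    i |-> S(A_im).  Its evaluation and dual basis are colinear by the coinvariance
    axioms, and one snake identity is the axiom on ω.  The other composite is an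
    endomorphism of the dual; by the results on mates it is colinear and compatible
    with evaluation, and such an endomorphism is the identity
    ([preantipode_matrix_rigid]).

    A coquasi-antipode (s, α, β) is the same as a choice, for each comatrix A, of the
    dual A'_ji = s(A_ij), E_ij = β(A_ij), D_ij = α(A_ij) ([coquasi_antipodeP]).  Such
    duals live on the linear dual spaces.  In the other direction, duals on the
    linear dual spaces, with transposes as dual morphisms, give natural values for s
    and β at once, and for α because a map between duals compatible with
    evaluations is compatible with dual bases too ([dual_map_db]); the universal
    property of B then produces s, β and α. *)

(** * Functionals and tensors *)

Section LinearMaps.
Variables (k : fieldType) (T U V W : lmodType k).

Lemma lin_eq0 (L : U -> V) : linear L -> L 0 = 0.
Proof.
move=> hL; have h := hL 1 0 0; rewrite !scale1r addr0 in h.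
by apply: (addIr (L 0)); rewrite add0r -h.
Qed.

Lemma lin_addE (L : U -> V) x y : linear L -> L (x + y) = L x + L y.
Proof. by move=> hL; have := hL 1 x y; rewrite !scale1r. Qed.

Lemma lin_scaleE (L : U -> V) c x : linear L -> L (c *: x) = c *: L x.
Proof. by move=> hL; have := hL c x 0; rewrite (lin_eq0 hL) !addr0. Qed.

Lemma lin_subE (L : U -> V) x y : linear L -> L (x - y) = L x - L y.
Proof. by move=> hL; rewrite addrC -scaleN1r hL scaleN1r addrC. Qed.

Lemma lin_sumE (I : finType) (L : U -> V) (F : I -> U) :
  linear L -> L (\sum_i F i) = \sum_i L (F i).
Proof.
move=> hL; elim/big_rec2: _ => [|i y x _ <-]; first exact: lin_eq0.
exact: lin_addE.
Qed.

Lemma lin_bigr (I : finType) (F : I -> T -> U) :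
  (forall i, linear (F i)) -> linear (fun x => \sum_i F i x).
Proof.
move=> hF a x y; rewrite scaler_sumr -big_split; apply: eq_bigr => i _.
exact: hF.
Qed.

Lemma lin_mull (E : T -> k^o) (c : k) :
  linear E -> linear (fun x => (E x : k) * c : k^o).
Proof. exact: (@lin_scalel k T k^o). Qed.

Lemma lin_mulr (E : T -> k^o) (c : k) :
  linear E -> linear (fun x => c * (E x : k) : k^o).
Proof. exact: (@lin_scaler k T k^o). Qed.

Lemma lin_comp (L : U -> V) (E : T -> U) :
  linear L -> linear E -> linear (fun x => L (E x)).
Proof. by move=> hL hE a x y; rewrite hE hL. Qed.

End LinearMaps.

Section Functionals.
Variables (k : fieldType).

Definition subspace (M : lmodType k) (P : M -> Prop) : Prop :=
  P 0 /\ forall a x y, P x -> P y -> P (a *: x + y).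

Lemma subspaceZ (M : lmodType k) (P : M -> Prop) a x :
  subspace P -> P x -> P (a *: x).
Proof. by move=> [P0 PD] Px; rewrite -[_ *: _]addr0; apply: PD. Qed.

Lemma subspaceD (M : lmodType k) (P : M -> Prop) x y :
  subspace P -> P x -> P y -> P (x + y).
Proof. by move=> [P0 PD] Px; rewrite -[x]scale1r; apply: PD. Qed.

Lemma subspaceB (M : lmodType k) (P : M -> Prop) x y :
  subspace P -> P x -> P y -> P (x - y).
Proof.
by move=> sP Px Py; apply: subspaceD => //; rewrite -scaleN1r; apply: subspaceZ.
Qed.

Lemma subspace_sum (M : lmodType k) (P : M -> Prop) (I : finType) (F : I -> M) :
  subspace P -> (forall i, P (F i)) -> P (\sum_i F i).
Proof.
move=> sP h; elim/big_rec: _ => [|i x _ Px]; first exact: sP.1.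
exact: subspaceD.
Qed.

(** A subspace which is maximal among those containing P and missing v is a
    complement of the line through v, and the functional wanted is the
    coordinate along that line. *)
Lemma separating_functional (M : lmodType k) (P : M -> Prop) (v : M) :
  subspace P -> ~ P v ->
  exists f : {linear M -> k^o}, f v = 1 /\ forall x, P x -> f x = 0.
Proof.
move=> sP nPv.
pose good (A : set M) := A = set0 \/
  [/\ subspace A, forall x, P x -> A x & ~ A v].
have [F Fgood Ftot|A [Agood Amax]] := @Zorn_bigcup M good.
  case: (pselect (exists2 X, F X & exists x, X x)) => [[X FX [x Xx]]|h]; last first.
    left; apply/seteqP; split=> // x [X FX Xx]; apply: h; exists X => //.
    by exists x.
  have ne (Y : set M) y : F Y -> Y y ->
      [/\ subspace Y, forall x, P x -> Y x & ~ Y v].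
    by move=> FY Yy; case: (Fgood Y FY) => // Y0; rewrite Y0 in Yy.
  have [sX PX nXv] := ne X x FX Xx.
  right; split=> [|y Py|[Y FY Yv]].
  - split=> [|a y z [Y FY Yy] [Z FZ Zz]]; first by exists X => //; case: sX.
    have [sY _ _] := ne Y y FY Yy; have [sZ _ _] := ne Z z FZ Zz.
    case: (Ftot Y Z FY FZ) => YZ.
      by exists Z => //; apply: sZ.2 => //; apply: YZ.
    by exists Y => //; apply: sY.2 => //; apply: YZ.
  - by exists X => //; apply: PX.
  - by case: (ne Y v FY Yv).
case: Agood => [A0|[sA PA nAv]].
  case: (Amax P); last by right; split.
  by rewrite A0 properEneq; split=> //; apply/eqP => h; have := sP.1; rewrite -h.
have coord x : exists c : k, A (x - c *: v).
  case: (pselect (A x)) => [Ax|nAx]; first by exists 0; rewrite scale0r subr0.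
  pose A' (y : M) := exists (c : k), A (y - c *: x).
  have sA' : subspace A'.
    split; first by exists 0; rewrite scale0r subr0; case: sA.
    move=> a y z [c hc] [d hd]; exists (a * c + d).
    have -> : a *: y + z - (a * c + d) *: x = a *: (y - c *: x) + (z - d *: x).
      by rewrite scalerBr scalerDl scalerA opprD addrACA.
    exact: sA.2.
  have AA' : forall y, A y -> A' y by move=> y Ay; exists 0; rewrite scale0r subr0.
  have A'v : A' v.
    apply: contrapT => nA'v; apply: (Amax A'); last first.
      by right; split=> // y Py; apply: AA'; apply: PA.
    rewrite properEneq; split=> //; apply/eqP => AeA'; apply: nAx.
    by rewrite AeA'; exists 1; rewrite scale1r subrr; case: sA.
  case: A'v => c hc.
  have c0 : c != 0 by apply/eqP => c0; move: hc; rewrite c0 scale0r subr0.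
  exists c^-1; have := subspaceZ (- c^-1) sA hc.
  by rewrite scalerBr scalerA mulNr mulVf // !scaleNr scale1r opprK addrC.
have uniq_coord x c d : A (x - c *: v) -> A (x - d *: v) -> c = d.
  move=> hc hd; apply: contrapT => /eqP; rewrite -subr_eq0 => cd; apply: nAv.
  have := subspaceZ (c - d)^-1 sA (subspaceB sA hd hc).
  have -> : x - d *: v - (x - c *: v) = (c - d) *: v.
    by rewrite opprB addrC addrA subrK -scalerBl.
  by rewrite scalerA mulVf // scale1r.
pose f x : k^o := projT1 (cid (coord x)).
have fP x : A (x - f x *: v) := projT2 (cid (coord x)).
have f_lin : linear f.
  move=> a x y; apply: (uniq_coord (a *: x + y)) => //.
  have -> : a *: x + y - (a *: f x + f y) *: v =
            a *: (x - f x *: v) + (y - f y *: v).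
    by rewrite scalerBr scalerDl scalerA opprD addrACA.
  exact: sA.2.
pose F : {linear M -> k^o} := HB.pack f (GRing.isLinear.Build _ _ _ _ f f_lin).
exists F; split; rewrite /F /=.
  by apply: (uniq_coord v) => //; rewrite scale1r subrr; case: sA.
move=> x Px; apply: (uniq_coord x) => //.
by rewrite scale0r subr0; apply: PA.
Qed.

Definition independent (M : lmodType k) (I : finType) (w : I -> M) : Prop :=
  forall c : I -> k, \sum_i c i *: w i = 0 -> forall i, c i = 0.

Definition spanned (M : lmodType k) (I : finType) (w : I -> M) (x : M) : Prop :=
  exists c : I -> k, x = \sum_i c i *: w i.

Lemma spanned_subspace (M : lmodType k) (I : finType) (w : I -> M) :
  subspace (spanned w).
Proof.
split; first by exists (fun=> 0); rewrite big1 // => i _; rewrite scale0r.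
move=> a x y [c ->] [d ->]; exists (fun i => a * c i + d i).
by rewrite scaler_sumr -big_split; apply: eq_bigr => i _; rewrite scalerDl scalerA.
Qed.

Lemma spanned_in (M : lmodType k) (I : finType) (w : I -> M) i : spanned w (w i).
Proof.
exists (fun j => (j == i)%:R); rewrite (bigD1 i) //= eqxx scale1r big1 ?addr0 //.
by move=> j /negPf ->; rewrite scale0r.
Qed.

Lemma dual_family (M : lmodType k) (I : finType) (w : I -> M) :
  independent w ->
  exists f : I -> {linear M -> k^o}, forall i j, f i (w j) = (i == j)%:R.
Proof.
move=> iw.
have h i : exists f : {linear M -> k^o}, forall j, f (w j) = (i == j)%:R.
  pose P x := exists c : I -> k, c i = 0 /\ x = \sum_j c j *: w j.
  have [||f [fi fP]] := @separating_functional M P (w i).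
  - split; first by exists (fun=> 0); split=> //; rewrite big1 // => j _; rewrite scale0r.
    move=> a x y [c [ci ->]] [d [di ->]]; exists (fun j => a * c j + d j).
    rewrite ci di mulr0 addr0; split=> //.
    by rewrite scaler_sumr -big_split; apply: eq_bigr => j _; rewrite scalerDl scalerA.
  - move=> [c [ci hc]].
    suff /iw/(_ i)/eqP : \sum_j ((j == i)%:R - c j) *: w j = 0.
      by rewrite eqxx ci subr0 oner_eq0.
    under eq_bigr do rewrite scalerBl.
    rewrite sumrB -hc (bigD1 i) //= eqxx scale1r big1 ?addr0 ?subrr //.
    by move=> j /negPf ->; rewrite scale0r.
  exists f => j; case: eqVneq => [<- //|ij]; apply: fP.
  exists (fun l => (l == j)%:R); rewrite (negPf ij); split=> //.
  rewrite (bigD1 j) //= eqxx scale1r big1 ?addr0 //.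
  by move=> l /negPf ->; rewrite scale0r.
by exists (fun i => projT1 (cid (h i))) => i; exact: projT2 (cid (h i)).
Qed.

Definition seq_span (M : lmodType k) (s : seq M) (x : M) : Prop :=
  exists c : nat -> k, x = \sum_(i < size s) c i *: s`_i.

Lemma seq_span_subspace (M : lmodType k) (s : seq M) : subspace (seq_span s).
Proof.
split; first by exists (fun=> 0); rewrite big1 // => i _; rewrite scale0r.
move=> a x y [c ->] [d ->]; exists (fun i => a * c i + d i).
by rewrite scaler_sumr -big_split; apply: eq_bigr => i _; rewrite scalerDl scalerA.
Qed.

Lemma seq_span_in (M : lmodType k) (s : seq M) x : x \in s -> seq_span s x.
Proof.
move=> xs; have lt_x : (index x s < size s)%N by rewrite index_mem.
exists (fun i => (i == index x s)%:R); rewrite (bigD1 (Ordinal lt_x)) //=.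
rewrite eqxx scale1r nth_index // big1 ?addr0 // => i /negPf.
by rewrite -val_eqE /= => ->; rewrite scale0r.
Qed.

(** By induction on the list: either P meets the span of the whole list only in
    the span of its tail, or one element of P outside the span of the tail
    completes a basis of the part of P inside it. *)
Lemma subspace_basis (M : lmodType k) (P : M -> Prop) (s : seq M) :
  subspace P ->
  (forall x, P x -> seq_span s x) ->
  exists (I : finType) (w : I -> M),
    [/\ independent w, forall i, P (w i) & forall x, P x -> spanned w x].
Proof.
elim: s P => [|x0 s ih] P sP hs.
  exists void, (fun v : void => match v with end); split=> [c _ []|[]|x /hs].
  by move=> [c ->]; rewrite big_ord0; exists (fun=> 0); rewrite big1.
pose inS := seq_span s; have sS : subspace inS := seq_span_subspace s.
have [||I [w [iw Pw spw]]] := ih (fun x => P x /\ inS x).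
- split; first by split; [case: sP | case: sS].
  by move=> a x y [Px Sx] [Py Sy]; split; [apply: sP.2 | apply: sS.2].
- by move=> x [].
case: (pselect (exists z, P z /\ ~ inS z)) => [[z [Pz nSz]]|h]; last first.
  exists I, w; split=> // [i|x Px]; first by case: (Pw i).
  by apply: spw; split=> //; apply: contrapT => nSx; apply: h; exists x.
have head x : P x -> exists c : k, inS (x - c *: x0).
  move=> /hs [c ->]; exists (c 0%N), (fun i => c i.+1).
  by rewrite big_ord_recl /= addrC addrA addNr add0r.
have [a ha] := head z Pz.
have a0 : a != 0 by apply/eqP => a0; move: ha; rewrite a0 scale0r subr0.
exists (unit + I)%type.
pose w' (u : unit + I) := match u with inl _ => z | inr i => w i end.
have big_w' (c : unit + I -> k) :
    \sum_u c u *: w' u = c (inl tt) *: z + \sum_i c (inr i) *: w i.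
  rewrite big_sumType /=; congr (_ + _).
  by rewrite (bigD1 tt) //= big1 ?addr0 // => -[].
exists w'; split=> [c|[u|i]|x Px] //=.
- rewrite big_w' => h.
  have c0 : c (inl tt) = 0.
    apply: contrapT => /eqP c0; apply: nSz.
    have -> : z = (- (c (inl tt))^-1) *: \sum_i c (inr i) *: w i.
      have := congr1 (fun x => (c (inl tt))^-1 *: x) h.
      rewrite scalerDr scalerA mulVf // scale1r scaler0 => /eqP.
      by rewrite addr_eq0 scaleNr => /eqP.
    apply: subspaceZ => //; apply: subspace_sum => // i.
    by apply: subspaceZ => //; case: (Pw i).
  move: h; rewrite c0 scale0r add0r => /iw h [[]|i] //; exact: h.
- by case: (Pw i).
have [b hb] := head x Px.
have [|d hd] := spw (x - (b / a) *: z).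
  split; first by apply: subspaceB => //; apply: subspaceZ.
  have -> : x - (b / a) *: z = (x - b *: x0) - (b / a) *: (z - a *: x0).
    by rewrite scalerBr scalerA divfK // opprB addrA subrK.
  by apply: subspaceB => //; apply: subspaceZ.
exists (fun u => match u with inl _ => b / a | inr i => d i end).
by rewrite big_w' /= -hd addrC subrK.
Qed.

End Functionals.

Section TensorSeparation.
Variables (k : fieldType) (U V : lmodType k).

Definition slicel (f : U -> k^o) (t : U ⊗ V) : V := \tsum_(u, v <- t) (f u : k) *: v.
Definition slicer (f : V -> k^o) (t : U ⊗ V) : U := \tsum_(u, v <- t) (f v : k) *: u.

Lemma slicel_linear (f : {linear U -> k^o}) : linear (slicel f).
Proof. by rewrite /slicel; lin. Qed.
Lemma slicer_linear (f : {linear V -> k^o}) : linear (slicer f).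
Proof. by rewrite /slicer; lin. Qed.
Lemma slicel_pure (f : {linear U -> k^o}) u v : slicel f (u ⊗ v) = (f u : k) *: v.
Proof. by rewrite /slicel tsum_pure //; lin. Qed.
Lemma slicer_pure (f : {linear V -> k^o}) u v : slicer f (u ⊗ v) = (f v : k) *: u.
Proof. by rewrite /slicer tsum_pure //; lin. Qed.

(** By induction on the number of terms: if the first left leg is in the span of
    the others, it is absorbed into them; otherwise a functional that vanishes on
    the others isolates its right leg, which is therefore zero. *)
Lemma slicel_eq0 (t : U ⊗ V) :
  (forall f : {linear U -> k^o}, slicel f t = 0) -> t = 0.
Proof.
suff min n : forall (a : 'I_n -> U) (m : 'I_n -> V),
    (forall f : {linear U -> k^o}, \sum_i (f (a i) : k) *: m i = 0) ->
    \sum_i a i ⊗ m i = 0.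
  rewrite [t]tsum_repr (big_nth (0, 0)) big_mkord => ht; apply: min => f.
  rewrite -[RHS](ht f) (lin_sumE _ (slicel_linear f)).
  by apply: eq_bigr => i _; rewrite slicel_pure.
elim: n => [|n ih] a m hf; first by rewrite big_ord0.
pose a' i := a (lift ord0 i); pose m' i := m (lift ord0 i).
rewrite big_ord_recl -/a'.
have {}hf (f : {linear U -> k^o}) : (f (a ord0) : k) *: m ord0 + \sum_i (f (a' i) : k) *: m' i = 0.
  by rewrite -[RHS](hf f) big_ord_recl.
case: (pselect (spanned a' (a ord0))) => [[c hc]|nsp].
  have -> : a ord0 ⊗ m ord0 = \sum_i a' i ⊗ (c i *: m ord0).
    rewrite {1}hc (lin_sumE (L := fun x => x ⊗ m ord0)); last by lin.
    by apply: eq_bigr => i _; rewrite pureZl pureZr.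
  rewrite -big_split /= -[RHS](ih a' (fun i => c i *: m ord0 + m' i)) => [|f].
    by apply: eq_bigr => i _; rewrite pureDr.
  rewrite -[RHS](hf f) hc linear_sum scaler_suml -big_split; apply: eq_bigr => i _.
  by rewrite linearZ scalerDr scalerA [_ * c i]mulrC.
have [|f [f1 f0]] := @separating_functional _ _ _ (a ord0) _ nsp.
  exact: spanned_subspace.
have m0 : m ord0 = 0.
  have := hf f; rewrite f1 scale1r big1 ?addr0 // => i _.
  by rewrite f0 ?scale0r //; apply: spanned_in.
rewrite m0 pure0r add0r; apply: ih => g.
by have := hf g; rewrite m0 scaler0 add0r.
Qed.

Lemma slicel_inj (s t : U ⊗ V) :
  (forall f : {linear U -> k^o}, slicel f s = slicel f t) -> s = t.
Proof.
move=> h; apply/eqP; rewrite -subr_eq0; apply/eqP; apply: slicel_eq0 => f.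
by rewrite (lin_subE _ _ (slicel_linear f)) h subrr.
Qed.

Lemma independent_tensor (I : finType) (w : I -> V) (x : I -> U) :
  independent w -> \sum_i x i ⊗ w i = 0 -> forall i, x i = 0.
Proof.
move=> /dual_family [f hf] h i.
have := congr1 (slicer (f i)) h.
rewrite (lin_sumE _ (slicer_linear _)) (lin_eq0 (slicer_linear _)) => <-.
rewrite (bigD1 i) //= slicer_pure hf eqxx scale1r big1 ?addr0 // => j ij.
by rewrite slicer_pure hf eq_sym (negPf ij) scale0r.
Qed.

Lemma independent_tensor_inj (I : finType) (w : I -> V) (x y : I -> U) :
  independent w -> \sum_i x i ⊗ w i = \sum_i y i ⊗ w i -> x =1 y.
Proof.
move=> iw h i; apply/eqP; rewrite -subr_eq0; apply/eqP.
apply: (independent_tensor (x := fun i => x i - y i) iw).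
rewrite -[RHS](subrr (\sum_i y i ⊗ w i)) -{1}h -sumrB; apply: eq_bigr => j _.
by rewrite (lin_subE (L := fun z => z ⊗ w j)) //; lin.
Qed.

(** Choose functionals dual to w; the slices of t determine it, and they are
    unchanged by the projection onto the span of w. *)
Lemma tensor_in_span (I : finType) (w : I -> V) (t : U ⊗ V) :
  independent w ->
  (forall f : {linear U -> k^o}, spanned w (slicel f t)) ->
  exists c : I -> U, t = \sum_i c i ⊗ w i.
Proof.
move=> /dual_family [g hg] ht; exists (fun i => slicer (g i) t).
apply: slicel_inj => f; rewrite (lin_sumE _ (slicel_linear f)).
have swap i : f (slicer (g i) t) = g i (slicel f t).
  rewrite /slicer /slicel !tsum_app; try by lin.
  by apply: eq_tsum => u v; rewrite !linearZ; exact: mulrC.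
have [c hc] := ht f; rewrite {1}hc; apply: eq_bigr => i _.
rewrite slicel_pure swap hc linear_sum (bigD1 i) //= big1 => [|j /negPf ij].
  by rewrite addr0 linearZ hg eqxx; congr (_ *: _); rewrite -[LHS]mulr1.
by rewrite linearZ hg eq_sym ij; exact: mulr0.
Qed.

End TensorSeparation.

(** * Comatrices *)

(* [lin] with two more rules: finite sums, and products of scalars. *)
Ltac slin := lazymatch goal with
  | |- bilinear_for _ _ _ => split=> ?; slin
  | |- forall _, _ => intro; slin
  | |- _ => solve [slin1]
  end
with slin1 := first
  [ assumption | match goal with H : forall _, _ |- _ => exact: H end
  | exact: lin_id
  | apply: lin_purel; slin1 | apply: lin_purer; slin1
  | apply: lin_scalel; slin1 | apply: lin_scaler; slin1
  | apply: lin_mull; slin1 | apply: lin_mulr; slin1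
  | apply: lin_app; slin1
  | apply: lin_bigr => ?; slin1
  | apply: lin_sum; slin | apply: lin_sum_par => ? ?; slin1].

Section Comatrix.
Variables (k : fieldType) (C : coalgebra k).

(** The coefficients of a comodule in a basis indexed by I. *)
Definition comatrix (I : finType) (A : I -> I -> C) : Prop :=
  (forall i j, Δ (A i j) = \sum_l A i l ⊗ A l j) /\
  (forall i j, ε (A i j) = (i == j)%:R).

Lemma tsum_sum (I : finType) (U V W : lmodType k) (F : U -> V -> W)
    (x : I -> U) (y : I -> V) : bilin F ->
  tsum F (\sum_i x i ⊗ y i) = \sum_i F (x i) (y i).
Proof.
move=> hF; rewrite (lin_sumE _ (tsum_linear hF)).
by apply: eq_bigr => i _; rewrite tsum_pure.
Qed.

Lemma tsum_comatrix (I : finType) (A : I -> I -> C) (W : lmodType k)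
    (F : C -> C -> W) i j : comatrix A -> bilin F ->
  \tsum_(x, y <- Δ (A i j)) F x y = \sum_l F (A i l) (A l j).
Proof. by move=> [hA _] hF; rewrite hA tsum_sum. Qed.

Section Coaction.
Variables (M : lmodType k) (r : coaction C M) (I : finType) (w : I -> M).

Definition coefficients (A : I -> I -> C) : Prop :=
  forall i, r (w i) = \sum_j A i j ⊗ w j.

Lemma tsum_coefficients A (W : lmodType k) (F : C -> M -> W) i :
  coefficients A -> bilin F ->
  \tsum_(x, y <- r (w i)) F x y = \sum_j F (A i j) (w j).
Proof. by move=> hA hF; rewrite hA tsum_sum. Qed.

(** Independence of w turns the coassociativity and the counit law of the coaction
    into identities between coefficients. *)
Lemma coefficients_comatrix A :
  independent w -> coefficients A -> comatrix A.
Proof.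
move=> iw hA; split=> i j.
  pose L (t : C ⊗ (C ⊗ M)) := \tsum_(a, s <- t) \tsum_(b, x <- s) (a ⊗ b) ⊗ x.
  have hL : linear L by rewrite /L; lin.
  have := congr1 L (coactA r (w i)).
  rewrite (tsum_coefficients _ hA); last by lin.
  rewrite (tsum_coefficients _ hA); last by lin.
  rewrite !(lin_sumE _ hL).
  have L1 c x : L (\tsum_(c1, c2 <- comul c) c1 ⊗ (c2 ⊗ x)) = Δ c ⊗ x.
    rewrite -{2}[comul c]tsum_id tsum_app // (tsum_app (L := fun t => t ⊗ x)); last by lin.
    by apply: eq_tsum => a b; rewrite /L !tsum_pure //; lin.
  under eq_bigr do rewrite L1.
  have L2 l : L (A i l ⊗ r (w l)) = \sum_m (A i l ⊗ A l m) ⊗ w m.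
    by rewrite /L tsum_pure ?(tsum_coefficients _ hA) //; lin.
  under [in RHS]eq_bigr do rewrite L2.
  rewrite exchange_big /= => h.
  have := @independent_tensor_inj _ (C ⊗ C)%type _ _ w (fun l => Δ (A i l))
    (fun m => \sum_l A i l ⊗ A l m) iw _ j; apply.
  rewrite h; apply: eq_bigr => m _.
  by rewrite (lin_sumE (L := fun t => t ⊗ w m)) //; lin.
have := coact1 r (w i); rewrite (tsum_coefficients _ hA); last by lin.
move=> h; apply/eqP; rewrite -subr_eq0; apply/eqP.
apply: (iw (fun j => ε (A i j) - (i == j)%:R)).
under eq_bigr do rewrite scalerBl.
rewrite sumrB h (bigD1 i) //= eqxx scale1r big1 ?addr0 ?subrr // => l.
by rewrite eq_sym => /negPf ->; rewrite scale0r.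
Qed.

End Coaction.

(** The fundamental theorem of comodules: the vectors obtained from the m i by
    slicing their coactions span a finite-dimensional subcomodule.  That the
    basis w consists of slices is recorded because properties of the m i are
    inherited through it. *)
Lemma finite_subcomodule (M : lmodType k) (r : coaction C M) (I : finType)
    (m : I -> M) :
  exists (J : finType) (w : J -> M) (A : J -> J -> C),
    [/\ independent w, coefficients r w A, forall i, spanned w (m i) &
      forall j, exists f : I -> {linear C -> k^o},
        w j = \sum_i slicel (f i) (r (m i))].
Proof.
pose P x := exists f : I -> {linear C -> k^o}, x = \sum_i slicel (f i) (r (m i)).
have sP : subspace P.
  split.
    exists (fun=> \0); rewrite big1 // => i _; rewrite /slicel /tsum /formal_eval.
    by rewrite big1 // => p _; rewrite scale0r.
  move=> a x y [f ->] [g ->]; exists (fun i => (a \*: f i \+ g i)).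
  rewrite scaler_sumr -big_split; apply: eq_bigr => i _ /=.
  rewrite /slicel /tsum /formal_eval scaler_sumr -big_split; apply: eq_bigr => p _ /=.
  by rewrite scalerDl scalerA.
pose s := [seq p.2 | i <- enum I, p <- repr (r (m i))].
have Ps x : P x -> seq_span s x.
  move=> [f ->]; apply: subspace_sum => [|i]; first exact: seq_span_subspace.
  rewrite /slicel /tsum /formal_eval big_seq.
  elim/big_rec: _ => [|p y ps sy]; first by case: (seq_span_subspace s).
  apply: (seq_span_subspace s).2 => //; apply: seq_span_in.
  by apply/allpairsPdep; exists i, p; rewrite mem_enum.
have [J [w [iw Pw spw]]] := subspace_basis sP Ps.
have Pm i : P (m i).
  exists (fun j => if j == i then counit else \0).
  rewrite (bigD1 i) //= eqxx big1 => [|j /negPf ->]; last first.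
    by rewrite /slicel /tsum /formal_eval big1 // => p _; rewrite scale0r.
  by rewrite addr0 /slicel coact1.
(* P is stable under slicing: slicing twice amounts to slicing once, by a convolution product *)
have Pr x (g : {linear C -> k^o}) : P x -> P (slicel g (r x)).
  move=> [f ->].
  pose conv i c : k^o := \tsum_(c1, c2 <- Δ c) (f i c1 : k) * (g c2 : k).
  have conv_lin i : linear (conv i) by rewrite /conv; slin.
  exists (fun i => HB.pack (conv i)
    (GRing.isLinear.Build _ _ _ _ (conv i) (conv_lin i)) : {linear _ -> _}).
  rewrite linear_sum (lin_sumE _ (slicel_linear g)); apply: eq_bigr => i _ /=.
  have sl : linear (fun t : C ⊗ M => slicel g (r (slicel (f i) t))).
    by rewrite /slicel; lin.
  transitivity (\tsum_(c, x <- r (m i)) \tsum_(d, y <- r x) ((f i c : k) * (g d : k)) *: y).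
    rewrite -{1}[r (m i)]tsum_id (tsum_app (L := fun t => slicel g (r (slicel (f i) t)))) //.
    apply: eq_tsum => c x0; rewrite slicel_pure linearZ.
    rewrite (lin_scaleE _ _ (slicel_linear g)) /slicel.
    rewrite tsum_app; last by lin.
    by apply: eq_tsum => d y; rewrite scalerA.
  rewrite -(@coact_tsumA _ _ _ r _ (fun c d y => ((f i c : k) * (g d : k)) *: y)); try by slin.
  rewrite /slicel; apply: eq_tsum => c x0.
  by rewrite /conv (tsum_app (L := fun a : k^o => (a : k) *: x0)) //; lin.
have /choice [A hA] : forall j, exists c : J -> C, r (w j) = \sum_l c l ⊗ w l.
  by move=> j; apply: tensor_in_span => // f; apply/spw/Pr.
by exists J, w, A; split=> // i; apply: spw.
Qed.

Definition regular_coaction : coaction C C :=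
  @Coaction k C C comul (@comulA k C) (@comul1l k C).

(** The fundamental theorem, for the coalgebra coacting on itself: h is recovered
    from the subcomodule that it generates by means of the counit. *)
Lemma comatrix_entry (h : C) :
  exists (I : finType) (A : I -> I -> C) (x y : I -> k),
    comatrix A /\ h = \sum_i \sum_j (x i * y j) *: A i j.
Proof.
have [J [w [A [iw hA sp _]]]] := @finite_subcomodule C regular_coaction unit (fun=> h).
have [d hd] := sp tt.
exists J, A, d, (fun j => ε (w j)); split; first exact: coefficients_comatrix hA.
rewrite hd; apply: eq_bigr => i _.
rewrite -[in LHS](comul1r (w i)) (_ : Δ (w i) = \sum_j A i j ⊗ w j); last exact: hA.
rewrite tsum_sum; last by lin.
by rewrite scaler_sumr; apply: eq_bigr => j _; rewrite scalerA.
Qed.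

Lemma comatrix_ext (W : lmodType k) (f g : C -> W) : linear f -> linear g ->
  (forall (I : finType) (A : I -> I -> C), comatrix A ->
     forall i j, f (A i j) = g (A i j)) -> f =1 g.
Proof.
move=> hf hg h c; have [I [A [x [y [hA ->]]]]] := comatrix_entry c.
rewrite !lin_sumE //; apply: eq_bigr => i _; rewrite !lin_sumE //.
by apply: eq_bigr => j _; rewrite !lin_scaleE // (h _ _ hA).
Qed.

End Comatrix.

Lemma sum_delta (k : fieldType) (V : lmodType k) (I : finType) (F : I -> V) i :
  \sum_j ((j == i)%:R : k) *: F j = F i.
Proof.
rewrite (bigD1 i) //= eqxx scale1r big1 ?addr0 // => j /negPf ->.
by rewrite scale0r.
Qed.

Lemma sum_deltaC (k : fieldType) (V : lmodType k) (I : finType) (F : I -> V) i :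
  \sum_j ((i == j)%:R : k) *: F j = F i.
Proof. by under eq_bigr do rewrite eq_sym; exact: sum_delta. Qed.

(** * Comodules in a basis *)

Section Bases.
Variables (k : fieldType) (V : lmodType k) (I : finType).

Definition is_basis (b : I -> V) (b' : I -> {linear V -> k^o}) : Prop :=
  (forall v, v = \sum_i (b' i v : k) *: b i) /\
  (forall i j, b' i (b j) = (i == j)%:R).

Lemma is_basis_independent b b' : is_basis b b' -> independent b.
Proof.
move=> [_ hb] c hc i; have := congr1 (b' i) hc; rewrite linear_sum linear0 => <-.
rewrite (bigD1 i) //= linearZ hb eqxx big1 => [|j /negPf ij].
  by rewrite addr0 -[LHS]mulr1.
by rewrite linearZ hb eq_sym ij; exact: mulr0.
Qed.

Variables (b : I -> V) (b' : I -> {linear V -> k^o}) (hb : is_basis b b').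
Variables (C : coalgebra k) (A : I -> I -> C) (hA : comatrix A).

Definition matrix_coact (v : V) : C ⊗ V :=
  \sum_i (b' i v : k) *: \sum_j A i j ⊗ b j.

Lemma matrix_coact_linear : linear matrix_coact.
Proof. by rewrite /matrix_coact; slin. Qed.
HB.instance Definition _ :=
  GRing.isLinear.Build _ _ _ _ matrix_coact matrix_coact_linear.

Lemma matrix_coact_basis i : matrix_coact (b i) = \sum_j A i j ⊗ b j.
Proof. by rewrite /matrix_coact; under eq_bigr do rewrite hb.2; exact: sum_delta. Qed.

Lemma basis_ext (W : lmodType k) (f g : V -> W) : linear f -> linear g ->
  (forall i, f (b i) = g (b i)) -> f =1 g.
Proof.
move=> hf hg h v; rewrite (hb.1 v) !lin_sumE //.
by apply: eq_bigr => i _; rewrite !lin_scaleE // h.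
Qed.

Lemma matrix_coactA v :
  \tsum_(c, w <- matrix_coact v) \tsum_(c1, c2 <- comul c) c1 ⊗ (c2 ⊗ w) =
  \tsum_(c, w <- matrix_coact v) c ⊗ matrix_coact w.
Proof.
move: v; apply: basis_ext; [slin | slin | move=> i].
rewrite matrix_coact_basis !tsum_sum; try by lin.
under eq_bigr => j _.
  rewrite (tsum_comatrix _ _ hA); last by lin.
  over.
rewrite exchange_big; apply: eq_bigr => j _ /=.
rewrite matrix_coact_basis (lin_sumE (L := fun x => A i j ⊗ x)) //; last by lin.
Qed.

Lemma matrix_coact1 v : \tsum_(c, w <- matrix_coact v) ε (c : C) *: w = v.
Proof.
move: v; apply: basis_ext; [slin | slin | move=> i].
rewrite matrix_coact_basis !tsum_sum; last by lin.
by under eq_bigr do rewrite hA.2; exact: sum_deltaC.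
Qed.

Definition matrix_coaction : coaction C V :=
  Coaction matrix_coactA matrix_coact1.

Lemma matrix_coactionP : coefficients matrix_coaction b A.
Proof. exact: matrix_coact_basis. Qed.

End Bases.

Section StandardBasis.
Variables (k : fieldType) (I : finType).

Definition std_basis (i : I) : {ffun I -> k^o} := [ffun j => (i == j)%:R].

Lemma std_coord_linear i : linear (fun x : {ffun I -> k^o} => x i).
Proof. by move=> a x y; rewrite !ffunE. Qed.

Definition std_coord (i : I) : {linear {ffun I -> k^o} -> k^o} :=
  HB.pack (fun x : {ffun I -> k^o} => x i)
    (GRing.isLinear.Build _ _ _ _ _ (std_coord_linear i)).

Lemma std_basisP : is_basis std_basis std_coord.
Proof.
split=> [v|i j] /=; last by rewrite ffunE eq_sym.
apply/ffunP => j; rewrite sum_ffunE (bigD1 j) //= big1 => [|i /negPf ij].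
  by rewrite !ffunE eqxx addr0 -[LHS]mulr1.
by rewrite !ffunE ij; exact: mulr0.
Qed.

End StandardBasis.

(** * Linear maps out of a coalgebra, from their values on comatrices *)

Section Coend.
Variables (k : fieldType) (C : coalgebra k).

(** When A and B are the coefficients of two comodules, G is the matrix of a
    comodule map from the first to the second. *)
Definition intertwines (I J : finType) (A : I -> I -> C) (B : J -> J -> C)
    (G : I -> J -> k) : Prop :=
  forall i j, \sum_i' G i' j *: A i i' = \sum_j' G i j' *: B j' j.

(** The family T of values on the entries of comatrices respects comodule maps. *)
Definition natural (W : lmodType k)
    (T : forall I : finType, (I -> I -> C) -> I -> I -> W) : Prop :=
  forall (I J : finType) (A : I -> I -> C) (B : J -> J -> C) (G : I -> J -> k),
    comatrix A -> comatrix B -> intertwines A B G ->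
    forall i j, \sum_i' G i' j *: T I A i i' = \sum_j' G i j' *: T J B j' j.

(** For comatrices this is the direct sum of comodules. *)
Definition block_sum (T : nmodType) (I J : finType) (A : I -> I -> T) (B : J -> J -> T)
    (u v : I + J) : T :=
  match u, v with
  | inl i, inl j => A i j
  | inr i, inr j => B i j
  | _, _ => 0
  end.

Lemma block_sum_comatrix (I J : finType) (A : I -> I -> C) (B : J -> J -> C) :
  comatrix A -> comatrix B -> comatrix (block_sum A B).
Proof.
move=> [hA eA] [hB eB].
have z (T : finType) (F : T -> C ⊗ C) : (forall t, F t = 0) -> \sum_t F t = 0.
  by move=> h; apply: big1.
split=> [] [i|i] [j|j]; rewrite /= ?linear0 //.
- by rewrite hA big_sumType /= [X in _ = _ + X]z ?addr0 // => l; rewrite pure0l.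
- by rewrite big_sumType /= !z ?addr0 // => l; rewrite ?(pure0l, pure0r).
- by rewrite big_sumType /= !z ?addr0 // => l; rewrite ?(pure0l, pure0r).
- by rewrite hB big_sumType /= [X in _ = X + _]z ?add0r // => l; rewrite pure0l.
Qed.

Section Universal.
Variables (W : lmodType k) (T : forall I : finType, (I -> I -> C) -> I -> I -> W).
Hypothesis natT : natural T.

(** Naturality for the two inclusions in the direct sum. *)
Lemma natural_block_sum (I J : finType) (A : I -> I -> C) (B : J -> J -> C) u v :
  comatrix A -> comatrix B ->
  T (block_sum A B) u v = block_sum (T A) (T B) u v.
Proof.
move=> hA hB; have hAB := block_sum_comatrix hA hB.
have hl : intertwines A (block_sum A B) (fun i u => (inl i == u)%:R).
  move=> i [j|j]; rewrite sum_deltaC /=; last by rewrite big1 // => *; rewrite scale0r.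
  exact: (sum_delta (fun l => A i l)).
have hr : intertwines B (block_sum A B) (fun i u => (inr i == u)%:R).
  move=> i [j|j]; rewrite sum_deltaC /=; first by rewrite big1 // => *; rewrite scale0r.
  exact: (sum_delta (fun l => B i l)).
case: u => i.
  have := natT hA hAB hl i v; rewrite sum_deltaC => <-; case: v => j /=.
    exact: (sum_delta (fun l => T A i l)).
  by rewrite big1 // => *; rewrite scale0r.
have := natT hB hAB hr i v; rewrite sum_deltaC => <-; case: v => j /=.
  by rewrite big1 // => *; rewrite scale0r.
exact: (sum_delta (fun l => T B i l)).
Qed.

(** The coefficient y(v_0) v_{-1} of the functional y and of the vector v with
    coordinates x, when A is a comatrix. *)
Definition coef (V : lmodType k) (I : finType) (A : I -> I -> V) (x y : I -> k) : V :=
  \sum_i \sum_j (x i * y j) *: A i j.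

Definition sum_fun (I J : finType) (x : I -> k) (x' : J -> k) (u : I + J) : k :=
  match u with inl i => x i | inr j => x' j end.

Lemma coef_block_sum (V : lmodType k) (I J : finType) (A : I -> I -> V)
    (B : J -> J -> V) x y x' y' :
  coef (block_sum A B) (sum_fun x x') (sum_fun y y') = coef A x y + coef B x' y'.
Proof.
have z (K : finType) (F : K -> V) : (forall t, F t = 0) -> \sum_t F t = 0.
  by move=> h; apply: big1.
rewrite /coef big_sumType /=; congr (_ + _); apply: eq_bigr => i _;
  rewrite big_sumType /=.
- by rewrite [X in _ + X]z ?addr0 // => l; rewrite scaler0.
- by rewrite [X in X + _]z ?add0r // => l; rewrite scaler0.
Qed.

(** A vanishing coefficient of x and y means that y is zero on the subcomodule
    generated by x, and naturality moves the value of T to that subcomodule. *)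
Lemma natural_coef_eq0 (I : finType) (A : I -> I -> C) (x y : I -> k) :
  comatrix A -> coef A x y = 0 -> coef (T A) x y = 0.
Proof.
move=> hA hxy.
pose r := matrix_coaction (std_basisP k I) hA.
have hr : coefficients r (@std_basis k I) A := matrix_coactionP _ _.
pose X : {ffun I -> k^o} := [ffun i => x i].
have rX (v : {ffun I -> k^o}) : r v = \sum_i (v i : k) *: \sum_j A i j ⊗ std_basis k j.
  by [].
have [J [w [B [iw hB spX gen]]]] := finite_subcomodule r (fun _ : unit => X).
have hBc := coefficients_comatrix iw hB.
have hG : intertwines B A (fun j i => w j i).
  move=> j i; have := congr1 (slicer (std_coord k i)) (hB j).
  rewrite rX !(lin_sumE _ (slicer_linear _)).
  have sl c l : slicer (std_coord k i) (c ⊗ std_basis k l) = (l == i)%:R *: c :> C.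
    by rewrite slicer_pure /= ffunE.
  under eq_bigr => l _.
    rewrite (lin_scaleE _ _ (slicer_linear _)) (lin_sumE _ (slicer_linear _)).
    under eq_bigr do rewrite sl.
    rewrite sum_delta; over.
  by under [in RHS]eq_bigr do rewrite slicer_pure; move=> ->.
have [d hd] := spX tt.
have w_y j : \sum_i (w j i : k) * y i = 0.
  have [f ->] := gen j.
  rewrite (bigD1 tt) //= [X in _ + X]big1 ?addr0 => [|[] //].
  pose Y (v : {ffun I -> k^o}) : k^o := \sum_i (v i : k) * y i.
  have hY : linear Y.
    by apply: lin_bigr => i; apply: lin_mull; exact: std_coord_linear.
  rewrite -/(Y _) -[RHS](linear0 (f tt)) -hxy.
  have sl : linear (fun t => Y (slicel (f tt) t)).
    by apply: lin_comp => //; exact: slicel_linear.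
  rewrite rX (lin_sumE _ sl) /coef linear_sum; apply: eq_bigr => i _.
  rewrite (lin_scaleE _ _ sl) (lin_sumE _ sl) scaler_sumr linear_sum.
  apply: eq_bigr => j' _; rewrite slicel_pure (lin_scaleE _ _ hY) [in RHS]linearZ ffunE.
  have -> : Y (std_basis k j') = y j'.
    by rewrite /Y; under eq_bigr do rewrite ffunE; exact: (@sum_deltaC k k^o).
  by rewrite scalerA; exact: mulrAC.
rewrite /coef.
have xw i : x i = \sum_j d j * (w j i : k).
  have := congr1 (fun v : {ffun I -> k^o} => v i) hd; rewrite ffunE => ->.
  by rewrite sum_ffunE; apply: eq_bigr => j _; rewrite ffunE.
transitivity (\sum_i' y i' *: \sum_j d j *: \sum_i (w j i : k) *: T A i i').
  rewrite exchange_big; apply: eq_bigr => i' _ /=.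
  under [in RHS]eq_bigr do rewrite scaler_sumr.
  rewrite [in RHS]exchange_big scaler_sumr; apply: eq_bigr => i _ /=.
  rewrite xw mulrC -scalerA scaler_suml; congr (_ *: _).
  by apply: eq_bigr => j _; rewrite scalerA.
under eq_bigr => i' _.
  under eq_bigr => j _ do rewrite -(natT hBc hA hG) scaler_sumr.
  rewrite exchange_big scaler_sumr; over.
rewrite exchange_big big1 // => j' _; rewrite /=.
under eq_bigr => i' _ do under eq_bigr => j _ do rewrite scalerA mulrC -scalerA.
under eq_bigr do rewrite -scaler_sumr scalerA mulrC.
by rewrite -scaler_suml w_y scale0r.
Qed.

(** The relation that is to be the graph of the linear map induced by T: every
    presentation of h as a coefficient provides a value. *)
Definition is_value (h : C) (w : W) : Prop :=
  exists (I : finType) (A : I -> I -> C) (x y : I -> k),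
    [/\ comatrix A, h = coef A x y & w = coef (T A) x y].

Lemma coefZ (V : lmodType k) (I : finType) (A : I -> I -> V) a x y :
  coef A (fun i => a * x i) y = a *: coef A x y.
Proof.
rewrite /coef scaler_sumr; apply: eq_bigr => i _; rewrite scaler_sumr.
by apply: eq_bigr => j _; rewrite scalerA mulrA.
Qed.

Lemma is_value_linear a h w h' w' :
  is_value h w -> is_value h' w' -> is_value (a *: h + h') (a *: w + w').
Proof.
move=> [I [A [x [y [hA -> ->]]]]] [J [B [x' [y' [hB -> ->]]]]].
exists (I + J)%type, (block_sum A B), (sum_fun (fun i => a * x i) x'), (sum_fun y y').
split; first exact: block_sum_comatrix.
  by rewrite coef_block_sum coefZ.
rewrite -coefZ -coef_block_sum; apply: eq_bigr => u _; apply: eq_bigr => v _.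
by rewrite natural_block_sum.
Qed.

Lemma is_value0 w : is_value 0 w -> w = 0.
Proof.
by move=> [I [A [x [y [hA h ->]]]]]; apply: natural_coef_eq0 => //; rewrite -h.
Qed.

Lemma is_value_inj h w w' : is_value h w -> is_value h w' -> w = w'.
Proof.
move=> h1 h2; have := is_value_linear (-1) h2 h1.
rewrite !scaleN1r addNr => /is_value0 /eqP.
by rewrite addrC subr_eq0 => /eqP.
Qed.

(** A coalgebra is the universal target of the coefficients of its comodules:
    its elements are coefficients, and the relations among these all come from
    comodule maps. *)
Lemma natural_factor :
  exists t : {linear C -> W}, forall (I : finType) (A : I -> I -> C),
    comatrix A -> forall i j, t (A i j) = T A i j.
Proof.
have /choice [t ht] : forall h, exists w, is_value h w.
  move=> h; have [I [A [x [y [hA hh]]]]] := comatrix_entry h.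
  by exists (coef (T A) x y), I, A, x, y.
have t_lin : linear t.
  by move=> a g h; apply: is_value_inj (ht _) _; apply: is_value_linear.
exists (HB.pack t (GRing.isLinear.Build _ _ _ _ t t_lin) : {linear _ -> _}).
move=> I A hA i j /=; apply: is_value_inj (ht _) _.
have delta (V : lmodType k) (F : I -> I -> V) :
    F i j = coef F (fun l => (l == i)%:R) (fun l => (l == j)%:R).
  rewrite /coef; under eq_bigr => l _.
    under eq_bigr do rewrite -scalerA.
    rewrite -scaler_sumr sum_delta; over.
  by rewrite sum_delta.
by exists I, A, (fun l => (l == i)%:R), (fun l => (l == j)%:R); split; rewrite -?delta.
Qed.

End Universal.
End Coend.

(** * The reassociator on comatrices *)

Section Reassociator.
Variables (k : fieldType) (B : coquasi_bialgebra k).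

Lemma omega_lin1 (b c : B) : linear (fun a => omega a b c : k^o).
Proof. by rewrite /omega; lin. Qed.
Lemma omega_lin2 (a c : B) : linear (fun b => omega a b c : k^o).
Proof. by rewrite /omega; lin. Qed.
Lemma omega_lin3 (a b : B) : linear (fun c => omega a b c : k^o).
Proof. by rewrite /omega; lin. Qed.
Lemma mult_linl (b : B) : linear (fun a => a ⋅ b).
Proof. by lin. Qed.
Lemma mult_linr (a : B) : linear (fun b => a ⋅ b).
Proof. by lin. Qed.

Lemma counit_one : ε 1_[B] = 1 :> k. Proof. exact: unit_counit (cqb_axioms B). Qed.
Lemma counit_mult (a b : B) : ε (a ⋅ b) = ε a * ε b :> k.
Proof. exact: (mult_counit (cqb_axioms B)). Qed.
Lemma omega_one_mid (a b : B) : omega a 1_[B] b = ε a * ε b :> k.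
Proof. exact: (reassoc_unit (cqb_axioms B)). Qed.

Lemma sum3 (V : nmodType) (I J K : finType) (F : I -> J -> K -> V) :
  \sum_i \sum_j \sum_k F i j k = \sum_(p : I * J * K) F p.1.1 p.1.2 p.2.
Proof. by rewrite pair_bigA pair_bigA. Qed.

Lemma sum4 (V : nmodType) (I J K L : finType) (F : I -> J -> K -> L -> V) :
  \sum_i \sum_j \sum_k \sum_l F i j k l =
  \sum_(p : I * J * K * L) F p.1.1.1 p.1.1.2 p.1.2 p.2.
Proof. by rewrite pair_bigA pair_bigA pair_bigA. Qed.

Section Act.
Variables (I J K : finType) (A1 : I -> I -> B) (A2 : J -> J -> B) (A3 : K -> K -> B).

(** The action of a trilinear form on the functions on the bases of three
    comodules; for omega and omegaV these are the inverse of the associator and the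
    associator. *)
Definition act (W : lmodType k) (f : B -> B -> B -> k) (G : I -> J -> K -> W) i j l : W :=
  \sum_i' \sum_j' \sum_l' f (A1 i i') (A2 j j') (A3 l l') *: G i' j' l'.

Lemma eq_act (W : lmodType k) f (G H : I -> J -> K -> W) i j l :
  (forall i j l, G i j l = H i j l) -> act f G i j l = act f H i j l.
Proof.
by move=> h; do 3 (apply: eq_bigr => ? _); rewrite h.
Qed.

Lemma act_linear (W W' : lmodType k) f (G : I -> J -> K -> W) (L : W -> W') i j l :
  linear L -> L (act f G i j l) = act f (fun i j l => L (G i j l)) i j l.
Proof.
move=> hL; rewrite /act lin_sumE //; apply: eq_bigr => i' _.
rewrite lin_sumE //; apply: eq_bigr => j' _; rewrite lin_sumE //.
by apply: eq_bigr => l' _; rewrite lin_scaleE.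
Qed.

Lemma act_sum (W : lmodType k) f (M : finType) (G : M -> I -> J -> K -> W) i j l :
  act f (fun i j l => \sum_m G m i j l) i j l = \sum_m act f (G m) i j l.
Proof.
rewrite /act [RHS]exchange_big; apply: eq_bigr => i' _.
rewrite [RHS]exchange_big; apply: eq_bigr => j' _.
by rewrite [RHS]exchange_big; apply: eq_bigr => l' _; rewrite scaler_sumr.
Qed.

Hypotheses (h1 : comatrix A1) (h2 : comatrix A2) (h3 : comatrix A3).

Lemma tsum_comatrix3 (W : lmodType k) (F : B -> B -> B -> B -> B -> B -> W) i j l i' j' l' :
  (forall b c x y z, linear (fun a => F a b c x y z)) ->
  (forall a c x y z, linear (fun b => F a b c x y z)) ->
  (forall a b x y z, linear (fun c => F a b c x y z)) ->
  (forall a b c y z, linear (fun x => F a b c x y z)) ->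
  (forall a b c x z, linear (fun y => F a b c x y z)) ->
  (forall a b c x y, linear (fun z => F a b c x y z)) ->
  \tsum_(a, x <- Δ (A1 i i')) \tsum_(b, y <- Δ (A2 j j')) \tsum_(c, z <- Δ (A3 l l'))
    F a b c x y z =
  \sum_i1 \sum_j1 \sum_l1
    F (A1 i i1) (A2 j j1) (A3 l l1) (A1 i1 i') (A2 j1 j') (A3 l1 l').
Proof.
move=> ? ? ? ? ? ?.
rewrite (tsum_comatrix _ _ h1); last by slin.
apply: eq_bigr => i1 _; rewrite (tsum_comatrix _ _ h2); last by slin.
apply: eq_bigr => j1 _; by rewrite (tsum_comatrix _ _ h3) //; slin.
Qed.

Lemma act_inverse (f g : {linear (B ⊗ (B ⊗ B))%type -> k^o}) (W : lmodType k)
    (G : I -> J -> K -> W) i j l :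
  (forall a b c : B,
    \tsum_(a1, a2 <- Δ a) \tsum_(b1, b2 <- Δ b) \tsum_(c1, c2 <- Δ c)
      (f (a1 ⊗ (b1 ⊗ c1)) : k) * g (a2 ⊗ (b2 ⊗ c2)) = ε a * ε b * ε c :> k) ->
  act (fun a b c => f (a ⊗ (b ⊗ c)))
    (act (fun a b c => g (a ⊗ (b ⊗ c))) G) i j l = G i j l.
Proof.
move=> hfg.
transitivity (\sum_i' \sum_j' \sum_l' (\sum_i1 \sum_j1 \sum_l1
    (f (A1 i i1 ⊗ (A2 j j1 ⊗ A3 l l1)) : k) *
    g (A1 i1 i' ⊗ (A2 j1 j' ⊗ A3 l1 l'))) *: G i' j' l').
  rewrite /act !sum3.
  under eq_bigr do rewrite sum3 scaler_sumr.
  rewrite exchange_big; apply: eq_bigr => p _ /=.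
  by rewrite sum3 scaler_suml; apply: eq_bigr => q _; rewrite scalerA.
transitivity (\sum_i' \sum_j' \sum_l'
    ((i == i')%:R : k) *: (((j == j')%:R : k) *: (((l == l')%:R : k) *: G i' j' l'))).
  apply: eq_bigr => i' _; apply: eq_bigr => j' _; apply: eq_bigr => l' _.
  rewrite !scalerA; congr (_ *: _).
  rewrite -(h1.2 i i') -(h2.2 j j') -(h3.2 l l') -hfg.
  by rewrite (@tsum_comatrix3 k^o (fun a b c x y z =>
    (f (a ⊗ (b ⊗ c)) : k) * g (x ⊗ (y ⊗ z)))) //; slin.
under eq_bigr => i' _.
  under eq_bigr => j' _ do rewrite -!scaler_sumr sum_deltaC.
  rewrite -scaler_sumr sum_deltaC; over.
exact: sum_deltaC.
Qed.

Lemma act_omegaVK (W : lmodType k) (G : I -> J -> K -> W) i j l :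
  act (@omegaV k B) (act (@omega k B) G) i j l = G i j l.
Proof. exact: act_inverse (reassocV_l (cqb_axioms B)). Qed.

Lemma act_omegaK (W : lmodType k) (G : I -> J -> K -> W) i j l :
  act (@omega k B) (act (@omegaV k B) G) i j l = G i j l.
Proof. exact: act_inverse (reassocV_r (cqb_axioms B)). Qed.

(** Quasi-associativity, multiplied on both sides by the inverse of the
    reassociator: this is what makes the associator colinear. *)
Lemma act_mult_assoc (G : I -> J -> K -> k) i j l :
  act (@omegaV k B) (fun i j l => \sum_i' \sum_j' \sum_l'
    G i' j' l' *: (A1 i i' ⋅ (A2 j j' ⋅ A3 l l'))) i j l =
  \sum_i' \sum_j' \sum_l' (act (@omegaV k B) (G : I -> J -> K -> k^o) i' j' l' : k) *:
    ((A1 i i' ⋅ A2 j j') ⋅ A3 l l').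
Proof.
pose T' (H : I -> J -> K -> k) i j l := \sum_i' \sum_j' \sum_l'
  H i' j' l' *: ((A1 i i' ⋅ A2 j j') ⋅ A3 l l').
pose T (H : I -> J -> K -> k) i j l := \sum_i' \sum_j' \sum_l'
  H i' j' l' *: (A1 i i' ⋅ (A2 j j' ⋅ A3 l l')).
have TT' (H : I -> J -> K -> k^o) i0 j0 l0 :
    T (act (@omega k B) H) i0 j0 l0 = act (@omega k B) (T' H) i0 j0 l0.
  transitivity (\sum_i' \sum_j' \sum_l' H i' j' l' *:
    \sum_i1 \sum_j1 \sum_l1 omega (A1 i1 i') (A2 j1 j') (A3 l1 l') *:
      (A1 i0 i1 ⋅ (A2 j0 j1 ⋅ A3 l0 l1))).
    rewrite /T /act !sum3; under eq_bigr do rewrite sum3 scaler_suml.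
    rewrite exchange_big; apply: eq_bigr => p _ /=.
    rewrite sum3 scaler_sumr; apply: eq_bigr => q _.
    by rewrite scalerA mulrC.
  transitivity (\sum_i' \sum_j' \sum_l' H i' j' l' *:
    \sum_i1 \sum_j1 \sum_l1 omega (A1 i0 i1) (A2 j0 j1) (A3 l0 l1) *:
      ((A1 i1 i' ⋅ A2 j1 j') ⋅ A3 l1 l')).
    apply: eq_bigr => i2 _; apply: eq_bigr => j2 _; apply: eq_bigr => l2 _.
    congr (_ *: _).
    have := mult_assoc (cqb_axioms B) (A1 i0 i2) (A2 j0 j2) (A3 l0 l2).
    rewrite (@tsum_comatrix3 _ (fun a b c x y z => (omega x y z : k) *: (a ⋅ (b ⋅ c))));
      try by rewrite /omega; slin.
    by rewrite (@tsum_comatrix3 _ (fun a b c x y z => (omega a b c : k) *: ((x ⋅ y) ⋅ z)));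
      try by rewrite /omega; slin.
  rewrite /T' /act !sum3; under [RHS]eq_bigr do rewrite sum3 scaler_sumr.
  rewrite [RHS]exchange_big; apply: eq_bigr => p _ /=.
  rewrite sum3 scaler_sumr; apply: eq_bigr => q _.
  by rewrite !scalerA mulrC.
rewrite -/(T' _ i j l).
rewrite -[RHS](act_omegaVK (T' _)).
apply: eq_act => i0 j0 l0; rewrite -TT' /T.
by do 3 (apply: eq_bigr => ? _); rewrite act_omegaK.
Qed.

End Act.

Section Cocycle.
Variables (I J K L : finType).
Variables (A1 : I -> I -> B) (A2 : J -> J -> B) (A3 : K -> K -> B) (A4 : L -> L -> B).
Hypotheses (h1 : comatrix A1) (h2 : comatrix A2) (h3 : comatrix A3) (h4 : comatrix A4).

Lemma cocycle_comatrix i j x l i2 j2 x2 l2 :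
  \sum_i1 \sum_j1 \sum_x1 \sum_l1
    omega (A1 i i1) (A2 j j1) (A3 x x1 ⋅ A4 l l1) *
    omega (A1 i1 i2 ⋅ A2 j1 j2) (A3 x1 x2) (A4 l1 l2) =
  \sum_i1 \sum_j1 \sum_j' \sum_x1 \sum_x' \sum_l1
    omega (A2 j j1) (A3 x x1) (A4 l l1) *
    omega (A1 i i1) (A2 j1 j' ⋅ A3 x1 x') (A4 l1 l2) *
    omega (A1 i1 i2) (A2 j' j2) (A3 x' x2).
Proof.
have := reassoc_cocycle (cqb_axioms B) (A1 i i2) (A2 j j2) (A3 x x2) (A4 l l2).
rewrite (@tsum_comatrix _ _ _ _ k^o _ _ _ h1); last by rewrite /omega; slin.
rewrite (@tsum_comatrix _ _ _ _ k^o _ _ _ h1); last by rewrite /omega; slin.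
move=> h; transitivity (\sum_i1 \tsum_(b1, b2 <- Δ (A2 j j2))
    \tsum_(c1, c2 <- Δ (A3 x x2)) \tsum_(d1, d2 <- Δ (A4 l l2))
    (omega (A1 i i1) b1 (c1 ⋅ d1) * omega (A1 i1 i2 ⋅ b2) c2 d2 : k^o)).
  apply: eq_bigr => i1 _; rewrite (@tsum_comatrix3 _ _ _ A2 A3 A4 h2 h3 h4 k^o
    (fun b c d b' c' d' => omega (A1 i i1) b (c ⋅ d) * omega (A1 i1 i2 ⋅ b') c' d')) //;
    by rewrite /omega; slin.
rewrite [LHS]h; apply: eq_bigr => i1 _.
rewrite (@tsum_comatrix _ _ _ _ k^o _ _ _ h2); last by rewrite /omega; slin.
apply: eq_bigr => j1 _.
rewrite (@tsum_comatrix _ _ _ _ k^o _ _ _ h2); last by rewrite /omega; slin.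
apply: eq_bigr => j' _.
rewrite (@tsum_comatrix _ _ _ _ k^o _ _ _ h3); last by rewrite /omega; slin.
apply: eq_bigr => x1 _.
rewrite (@tsum_comatrix _ _ _ _ k^o _ _ _ h3); last by rewrite /omega; slin.
apply: eq_bigr => x' _.
by rewrite (@tsum_comatrix _ _ _ _ k^o _ _ _ h4) //; rewrite /omega; slin.
Qed.
End Cocycle.
End Reassociator.

Section Pentagon.
Variables (k : fieldType) (B : coquasi_bialgebra k).

Section Four.
Variables (I J K L : finType).
Variables (A1 : I -> I -> B) (A2 : J -> J -> B) (A3 : K -> K -> B) (A4 : L -> L -> B).
Hypotheses (h1 : comatrix A1) (h2 : comatrix A2) (h3 : comatrix A3) (h4 : comatrix A4).

(** The cocycle condition as an equality between operators on the functions on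
    four bases: this is the pentagon. *)
Lemma pentagon (W : lmodType k) (G : I -> J -> K -> L -> W) i j x l :
  \sum_i1 \sum_j1 \sum_x1 \sum_l1
    omega (A1 i i1) (A2 j j1) (A3 x x1 ⋅ A4 l l1) *:
    (\sum_i2 \sum_j2 \sum_x2 \sum_l2
      omega (A1 i1 i2 ⋅ A2 j1 j2) (A3 x1 x2) (A4 l1 l2) *: G i2 j2 x2 l2) =
  act A2 A3 A4 (@omega k B) (fun j1 x1 l1 =>
    \sum_i1 \sum_j' \sum_x' \sum_l2
      omega (A1 i i1) (A2 j1 j' ⋅ A3 x1 x') (A4 l1 l2) *:
      act A1 A2 A3 (@omega k B) (fun i2 j2 x2 => G i2 j2 x2 l2) i1 j' x') j x l.
Proof.
transitivity (\sum_(t : I * J * K * L)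
    (\sum_i1 \sum_j1 \sum_x1 \sum_l1
      omega (A1 i i1) (A2 j j1) (A3 x x1 ⋅ A4 l l1) *
      omega (A1 i1 t.1.1.1 ⋅ A2 j1 t.1.1.2) (A3 x1 t.1.2) (A4 l1 t.2)) *:
    G t.1.1.1 t.1.1.2 t.1.2 t.2).
  rewrite sum4; under eq_bigr do rewrite sum4 scaler_sumr.
  rewrite exchange_big; apply: eq_bigr => t _ /=.
  by rewrite sum4 scaler_suml; apply: eq_bigr => p _; rewrite scalerA.
under eq_bigr do rewrite cocycle_comatrix //.
transitivity (\sum_(t : I * J * K * L) \sum_(s : I * J * J * K * K * L)
    (omega (A2 j s.1.1.1.1.2) (A3 x s.1.1.2) (A4 l s.2) *
     omega (A1 i s.1.1.1.1.1) (A2 s.1.1.1.1.2 s.1.1.1.2 ⋅ A3 s.1.1.2 s.1.2) (A4 s.2 t.2) *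
     omega (A1 s.1.1.1.1.1 t.1.1.1) (A2 s.1.1.1.2 t.1.1.2) (A3 s.1.2 t.1.2)) *:
    G t.1.1.1 t.1.1.2 t.1.2 t.2).
  apply: eq_bigr => t _; rewrite !pair_bigA /= scaler_suml.
  by [].
transitivity (\sum_(p : J * K * L) \sum_(q : I * J * K * L) \sum_(r : I * J * K)
    (omega (A2 j p.1.1) (A3 x p.1.2) (A4 l p.2) *
     omega (A1 i q.1.1.1) (A2 p.1.1 q.1.1.2 ⋅ A3 p.1.2 q.1.2) (A4 p.2 q.2) *
     omega (A1 q.1.1.1 r.1.1) (A2 q.1.1.2 r.1.2) (A3 q.1.2 r.2)) *:
    G r.1.1 r.1.2 r.2 q.2); last first.
  rewrite /act [RHS]sum3; apply: eq_bigr => p _.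
  rewrite [in RHS]sum4 scaler_sumr; apply: eq_bigr => q _.
  rewrite [in RHS]sum3 !scaler_sumr; apply: eq_bigr => r _.
  by rewrite !scalerA.
(* both sides are now single sums over ten indices, which h reorders *)
rewrite !pair_bigA /=.
pose h (u : (J * K * L) * (I * J * K * L) * (I * J * K)) :
    (I * J * K * L) * (I * J * J * K * K * L) :=
  let: ((j1, x1, l1), (i1, j', x', l2), (i2, j2, x2)) := u in
  ((i2, j2, x2, l2), (i1, j1, j', x1, x', l1)).
pose h' (u : (I * J * K * L) * (I * J * J * K * K * L)) :
    (J * K * L) * (I * J * K * L) * (I * J * K) :=
  let: ((i2, j2, x2, l2), (i1, j1, j', x1, x', l1)) := u in
  ((j1, x1, l1), (i1, j', x', l2), (i2, j2, x2)).
rewrite (reindex h) /=; last first.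
  exists h' => [[[[[j1 x1] l1] [[[i1 j'] x'] l2]] [[i2 j2] x2]] _ //|].
  by move=> [[[[i2 j2] x2] l2] [[[[[i1 j1] j'] x1] x'] l1]] _.
by apply: eq_bigr => [[[[[j1 x1] l1] [[[i1 j'] x'] l2]] [[i2 j2] x2]] _].
Qed.

End Four.

(** The coefficients of the unit object. *)
Definition one_comatrix (_ _ : 'I_1) : B := 1_[B].

Lemma one_comatrixP : comatrix one_comatrix.
Proof.
split=> i j; last by rewrite !ord1 /one_comatrix counit_one.
by rewrite big_ord1 /one_comatrix (unit_comul (cqb_axioms B)).
Qed.

Section Unital.
Variables (I J : finType) (A : I -> I -> B) (A' : J -> J -> B).
Hypotheses (hA : comatrix A) (hA' : comatrix A').

Let mult1l (a : B) : 1_[B] ⋅ a = a := unit_multl (cqb_axioms B) a.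
Let mult1r (a : B) : a ⋅ 1_[B] = a := unit_multr (cqb_axioms B) a.

Lemma sum_delta2 (W : lmodType k) (F : I -> J -> W) i j :
  \sum_i' \sum_j' ((i == i')%:R * (j == j')%:R : k) *: F i' j' = F i j.
Proof.
under eq_bigr => i' _.
  under eq_bigr do rewrite -scalerA.
  rewrite -scaler_sumr sum_deltaC; over.
exact: sum_deltaC.
Qed.

(** The cocycle condition makes the form omega(1, -, -) idempotent, and an
    invertible idempotent is trivial. *)
Lemma omega_one_left i j i' j' :
  omega 1_[B] (A i i') (A' j j') = (i == i')%:R * (j == j')%:R :> k.
Proof.
pose G (_ : 'I_1) (i0 : I) (j0 : J) : k^o := (i0 == i')%:R * (j0 == j')%:R.
have h (F : 'I_1 -> I -> J -> k^o) u i0 j0 :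
    act one_comatrix A A' (@omega k B) F u i0 j0 =
    \sum_i1 \sum_j1 omega 1_[B] (A i0 i1) (A' j0 j1) *: F ord0 i1 j1.
  by rewrite /act big_ord1.
have hG i0 j0 : act one_comatrix A A' (@omega k B) G ord0 i0 j0 =
    omega 1_[B] (A i0 i') (A' j0 j').
  rewrite h -[RHS](sum_delta2 (W := k^o) (fun a b => omega 1_[B] (A i0 a) (A' j0 b))).
  apply: eq_bigr => a _; apply: eq_bigr => b _.
  by rewrite /G [a == _]eq_sym [b == _]eq_sym; exact: mulrC.
have idem u i0 j0 : act one_comatrix A A' (@omega k B) G u i0 j0 =
    act one_comatrix A A' (@omega k B) (act one_comatrix A A' (@omega k B) G) u i0 j0.
  rewrite ord1 hG h; under [RHS]eq_bigr do under eq_bigr do rewrite hG.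
  have := cocycle_comatrix one_comatrixP one_comatrixP hA hA' ord0 ord0 i0 j0 ord0 ord0 i' j'.
  rewrite !big_ord1 /one_comatrix => c.
  transitivity (\sum_i1 \sum_j1 omega 1_[B] 1_[B] (A i0 i1 ⋅ A' j0 j1) *
      omega (1_[B] ⋅ 1_[B]) (A i1 i') (A' j1 j')).
    rewrite -[LHS](sum_delta2 (W := k^o) (fun a b => omega 1_[B] (A a i') (A' b j'))).
    apply: eq_bigr => a _; apply: eq_bigr => b _.
    by rewrite omega_one_mid counit_one counit_mult hA.2 hA'.2 mult1l mul1r.
  rewrite c; apply: eq_bigr => a _; rewrite exchange_big; apply: eq_bigr => b _ /=.
  rewrite (bigD1 i') //= big1 => [|a' /negPf na'].
    by rewrite omega_one_mid counit_one mult1l hA.2 eqxx !mulr1 addr0.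
  by rewrite omega_one_mid hA.2 na' !mulr0.
rewrite -hG -[LHS](act_omegaVK one_comatrixP hA hA').
transitivity (act one_comatrix A A' (@omegaV k B)
    (act one_comatrix A A' (@omega k B) G) ord0 i j).
  by apply: (@eq_act _ _ _ _ _ _ _ _ k^o) => u x y; rewrite -idem.
exact: (act_omegaVK (W := k^o) one_comatrixP hA hA' G).
Qed.

(** The same for omega(-, -, 1). *)
Lemma omega_one_right i j i' j' :
  omega (A i i') (A' j j') 1_[B] = (i == i')%:R * (j == j')%:R :> k.
Proof.
pose G (i0 : I) (j0 : J) (_ : 'I_1) : k^o := (i0 == i')%:R * (j0 == j')%:R.
have h (F : I -> J -> 'I_1 -> k^o) i0 j0 u :
    act A A' one_comatrix (@omega k B) F i0 j0 u =
    \sum_i1 \sum_j1 omega (A i0 i1) (A' j0 j1) 1_[B] *: F i1 j1 ord0.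
  by rewrite /act; do 2 (apply: eq_bigr => ? _); rewrite big_ord1.
have hG i0 j0 : act A A' one_comatrix (@omega k B) G i0 j0 ord0 =
    omega (A i0 i') (A' j0 j') 1_[B].
  rewrite h -[RHS](sum_delta2 (W := k^o) (fun a b => omega (A i0 a) (A' j0 b) 1_[B])).
  apply: eq_bigr => a _; apply: eq_bigr => b _.
  by rewrite /G [a == _]eq_sym [b == _]eq_sym; exact: mulrC.
have idem i0 j0 u : act A A' one_comatrix (@omega k B) G i0 j0 u =
    act A A' one_comatrix (@omega k B) (act A A' one_comatrix (@omega k B) G) i0 j0 u.
  rewrite ord1 hG h; under [RHS]eq_bigr do under eq_bigr do rewrite hG.
  have c : \sum_i1 \sum_j1 omega (A i0 i1) (A' j0 j1) (1_[B] ⋅ 1_[B]) *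
      omega (A i1 i' ⋅ A' j1 j') 1_[B] 1_[B] =
      \sum_i1 \sum_j1 \sum_j2 omega (A' j0 j1) 1_[B] 1_[B] *
      omega (A i0 i1) (A' j1 j2 ⋅ 1_[B]) 1_[B] * omega (A i1 i') (A' j2 j') 1_[B].
    have := cocycle_comatrix hA hA' one_comatrixP one_comatrixP i0 j0 ord0 ord0 i' j' ord0 ord0.
    under eq_bigr => i1 _ do under eq_bigr => j1 _ do rewrite !big_ord1.
    move=> ->; apply: eq_bigr => i1 _; apply: eq_bigr => j1 _; apply: eq_bigr => j2 _.
    by rewrite !big_ord1.
  transitivity (\sum_i1 \sum_j1 omega (A i0 i1) (A' j0 j1) (1_[B] ⋅ 1_[B]) *
      omega (A i1 i' ⋅ A' j1 j') 1_[B] 1_[B]).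
    rewrite -[LHS](sum_delta2 (W := k^o) (fun a b => omega (A i0 a) (A' j0 b) 1_[B])
      i' j').
    apply: eq_bigr => a _; apply: eq_bigr => b _.
    rewrite omega_one_mid counit_one counit_mult hA.2 hA'.2 mult1l mulr1.
    by rewrite [i' == _]eq_sym [j' == _]eq_sym; exact: mulrC.
  rewrite c; apply: eq_bigr => a _.
  rewrite (bigD1 j0) //= [X in _ + X]big1 ?addr0 => [|b /negPf nb]; last first.
    by rewrite big1 // => b' _; rewrite omega_one_mid hA'.2 eq_sym nb !mul0r.
  apply: eq_bigr => b _.
  by rewrite omega_one_mid counit_one mult1r hA'.2 eqxx !mul1r.
rewrite -hG -[LHS](act_omegaVK hA hA' one_comatrixP).
transitivity (act A A' one_comatrix (@omegaV k B)
    (act A A' one_comatrix (@omega k B) G) i j ord0).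
  by apply: (@eq_act _ _ _ _ _ _ _ _ k^o) => u x y; rewrite -idem.
exact: (act_omegaVK (W := k^o) hA hA' one_comatrixP G).
Qed.

End Unital.
End Pentagon.

(** * Mates *)

Section Invariants.
Variables (k : fieldType) (B : coquasi_bialgebra k).

(** A bilinear form on a tensor product of two comodules, given by its matrix in
    bases, that is a comodule map to the unit object; and, dually, a coinvariant
    element of the tensor product. *)
Definition invariant_pairing (I J : finType) (A : I -> I -> B) (A' : J -> J -> B)
    (E : I -> J -> k) : Prop :=
  forall i j, \sum_i' \sum_j' E i' j' *: (A i i' ⋅ A' j j') = E i j *: 1_[B].

Definition invariant_copairing (I J : finType) (A : I -> I -> B) (A' : J -> J -> B)
    (p : I -> J -> k) : Prop :=
  forall i' j', \sum_i \sum_j p i j *: (A i i' ⋅ A' j j') = p i' j' *: 1_[B].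

(** Inside a linear expression, an invariant pairing replaces the product of the
    coefficients that it meets by the unit; likewise for a coinvariant. *)
Lemma pairing_collapse (I J : finType) (A : I -> I -> B) (A' : J -> J -> B) E
    (W : lmodType k) (f : B -> W) i j :
  invariant_pairing A A' E -> linear f ->
  \sum_i' \sum_j' E i' j' *: f (A i i' ⋅ A' j j') = E i j *: f 1_[B].
Proof.
move=> hE hf; rewrite -(lin_scaleE _ _ hf) -hE (lin_sumE _ hf).
apply: eq_bigr => i' _; rewrite (lin_sumE _ hf).
by apply: eq_bigr => j' _; rewrite (lin_scaleE _ _ hf).
Qed.

Lemma copairing_collapse (I J : finType) (A : I -> I -> B) (A' : J -> J -> B) p
    (W : lmodType k) (f : B -> W) i' j' :
  invariant_copairing A A' p -> linear f ->
  \sum_i \sum_j p i j *: f (A i i' ⋅ A' j j') = p i' j' *: f 1_[B].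
Proof.
move=> hp hf; rewrite -(lin_scaleE _ _ hf) -hp (lin_sumE _ hf).
apply: eq_bigr => i _; rewrite (lin_sumE _ hf).
by apply: eq_bigr => j _; rewrite (lin_scaleE _ _ hf).
Qed.

Lemma exchange_pairs (V : nmodType) (I J K L : finType) (F : I -> J -> K -> L -> V) :
  \sum_i \sum_j \sum_x \sum_l F i j x l = \sum_x \sum_l \sum_i \sum_j F i j x l.
Proof.
rewrite pair_bigA /=; under eq_bigr do rewrite pair_bigA.
rewrite exchange_big /= [RHS]pair_bigA; apply: eq_bigr => q _ /=.
by rewrite pair_bigA.
Qed.

Lemma exchange_middle (V : nmodType) (I J K L : finType) (F : I -> J -> K -> L -> V) :
  \sum_i \sum_j \sum_x \sum_l F i j x l = \sum_j \sum_x \sum_i \sum_l F i j x l.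
Proof.
by rewrite exchange_big; apply: eq_bigr => j _; rewrite exchange_big.
Qed.

(* The next two lemmas are the two collapses in the form in which they meet the
   pentagon: f is a value of omega, in which the product fills one argument and
   the two remaining comodules fill the others. *)
Section Collapse.
Variables (I J K L : finType) (A : I -> I -> B) (A' : J -> J -> B).
Variables (f : B -> K -> L -> k) (x : K) (l : L).
Hypothesis f_lin : forall x' l', linear (fun a => f a x' l' : k^o).
Hypothesis f_one : forall x' l', f 1_[B] x' l' = (x == x')%:R * (l == l')%:R.

Lemma pairing_collapse4 E (G : K -> L -> k) i j : invariant_pairing A A' E ->
  \sum_i' \sum_j' \sum_x' \sum_l'
    f (A i i' ⋅ A' j j') x' l' *: (E i' j' * G x' l' : k^o) = E i j * G x l.
Proof.
move=> hE; rewrite exchange_pairs.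
rewrite -(sum_delta2 (fun x' l' => E i j * G x' l' : k^o)).
apply: eq_bigr => x' _; apply: eq_bigr => l' _.
transitivity (E i j *: (f 1_[B] x' l' * G x' l' : k^o)).
  rewrite -(pairing_collapse (f := fun a => f a x' l' * G x' l' : k^o) _ _ hE).
    by apply: eq_bigr => i' _; apply: eq_bigr => j' _; exact: mulrCA.
  exact: lin_mull.
by rewrite f_one; exact: mulrCA.
Qed.

Lemma copairing_collapse4 p (F : I -> J -> K -> L -> k^o) : invariant_copairing A A' p ->
  \sum_i \sum_j p i j *: (\sum_i' \sum_j' \sum_x' \sum_l'
    f (A i i' ⋅ A' j j') x' l' *: F i' j' x' l') = \sum_i \sum_j p i j *: F i j x l.
Proof.
move=> hp; transitivity (\sum_i' \sum_j' p i' j' *: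
    \sum_x' \sum_l' f 1_[B] x' l' *: F i' j' x' l').
  rewrite pair_bigA /=; under eq_bigr do rewrite pair_bigA /= scaler_sumr.
  rewrite exchange_big [RHS]pair_bigA; apply: eq_bigr => q _ /=.
  have lin_f : linear (fun a => \sum_x' \sum_l' f a x' l' *: F q.1 q.2 x' l').
    by apply: lin_bigr => x'; apply: lin_bigr => l'; apply: lin_scalel.
  by rewrite -(copairing_collapse _ _ hp lin_f) pair_bigA.
apply: eq_bigr => i _; apply: eq_bigr => j _; congr (_ *: _).
by under eq_bigr do under eq_bigr do rewrite f_one; exact: sum_delta2.
Qed.

End Collapse.

(** The mate of a coinvariant p of Y ⊗ X and an invariant pairing Q on X ⊗ Z is the
    map Z -> (Y ⊗ X) ⊗ Z -> Y ⊗ (X ⊗ Z) -> Y; the mate on the other side is the map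
    X -> X ⊗ (Y ⊗ Z) -> (X ⊗ Y) ⊗ Z -> Z of a pairing on X ⊗ Y and a coinvariant of
    Y ⊗ Z. *)
Definition mate (I J K : finType) (A1 : I -> I -> B) (A2 : J -> J -> B) (A3 : K -> K -> B)
    (p : I -> J -> k) (Q : J -> K -> k) (l : K) (m : I) : k :=
  \sum_i \sum_j p i j *: act A1 A2 A3 (@omegaV k B)
    (fun i' j' l' => (i' == m)%:R * Q j' l' : k^o) i j l.

Definition comate (I J K : finType) (A1 : I -> I -> B) (A2 : J -> J -> B) (A3 : K -> K -> B)
    (E : I -> J -> k) (p : J -> K -> k) (i : I) (m : K) : k :=
  \sum_j \sum_l p j l *: act A1 A2 A3 (@omega k B)
    (fun i' j' l' => E i' j' * (l' == m)%:R : k^o) i j l.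

(** The mate is a composite of colinear maps; in terms of coefficients, the
    quasi-associativity of the product of the three comatrices is evaluated between
    p and Q, each of which collapses one product. *)
Lemma mate_intertwines (I J K : finType) (A1 : I -> I -> B) (A2 : J -> J -> B)
    (A3 : K -> K -> B) p Q :
  comatrix A1 -> comatrix A2 -> comatrix A3 ->
  invariant_copairing A1 A2 p -> invariant_pairing A2 A3 Q ->
  intertwines A3 A1 (mate A1 A2 A3 p Q).
Proof.
move=> h1 h2 h3 hp hQ l m.
pose G i' j' l' : k^o := (i' == m)%:R * Q j' l'.
pose H := act A1 A2 A3 (@omegaV k B) G.
transitivity (\sum_i \sum_j p i j *: \sum_i' \sum_j' \sum_l'
    (H i' j' l' : k) *: ((A1 i i' ⋅ A2 j j') ⋅ A3 l l')).
  transitivity (\sum_i' \sum_j' \sum_l' (H i' j' l' : k) *: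
      \sum_i \sum_j p i j *: ((A1 i i' ⋅ A2 j j') ⋅ A3 l l')); last first.
    rewrite [LHS]sum3 [RHS]pair_bigA; under [RHS]eq_bigr do rewrite sum3 scaler_sumr.
    rewrite [RHS]exchange_big; apply: eq_bigr => q _ /=.
    rewrite pair_bigA scaler_sumr; apply: eq_bigr => r _ /=.
    by rewrite !scalerA mulrC.
  transitivity (\sum_l' \sum_i \sum_j (p i j * H i j l') *: A3 l l').
    apply: eq_bigr => l' _; rewrite scaler_suml; apply: eq_bigr => i _.
    by rewrite scaler_suml.
  rewrite [LHS]exchange_big; apply: eq_bigr => i _ /=.
  rewrite [LHS]exchange_big; apply: eq_bigr => j _ /=; apply: eq_bigr => l' _.
  rewrite (copairing_collapse (f := fun a => a ⋅ A3 l l') _ _ hp); last exact: mult_linl.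
  by rewrite (unit_multl (cqb_axioms B)) scalerA mulrC.
have QA i j l0 : \sum_i' \sum_j' \sum_l' G i' j' l' *: (A1 i i' ⋅ (A2 j j' ⋅ A3 l0 l')) =
    Q j l0 *: A1 i m.
  transitivity (\sum_i' ((i' == m)%:R : k) *: (Q j l0 *: A1 i i')); last exact: sum_delta.
  apply: eq_bigr => i' _.
  rewrite -[in RHS](unit_multr (cqb_axioms B) (A1 i i')).
  rewrite -(pairing_collapse (f := fun a => A1 i i' ⋅ a) _ _ hQ); last exact: mult_linr.
  rewrite scaler_sumr; apply: eq_bigr => j' _; rewrite scaler_sumr.
  by apply: eq_bigr => l' _; rewrite scalerA.
transitivity (\sum_i \sum_j p i j *:
    act A1 A2 A3 (@omegaV k B) (fun i j l => Q j l *: A1 i m) i j l).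
  apply: eq_bigr => i _; apply: eq_bigr => j _; congr (_ *: _).
  by rewrite -[LHS](act_mult_assoc h1 h2 h3); apply: eq_act.
transitivity (\sum_m' \sum_i \sum_j (p i j *
    act A1 A2 A3 (@omegaV k B) (fun i' j' l' => (i' == m')%:R * Q j' l' : k^o) i j l) *:
    A1 m' m); last first.
  apply: eq_bigr => m' _; rewrite scaler_suml; apply: eq_bigr => i _.
  by rewrite scaler_suml.
rewrite [RHS]exchange_big; apply: eq_bigr => i _.
rewrite [RHS]exchange_big; apply: eq_bigr => j _ /=.
under [RHS]eq_bigr do rewrite -scalerA.
rewrite -scaler_sumr; congr (_ *: _).
have sc (m' : I) : linear (fun c : k^o => (c : k) *: A1 m' m) by lin.
under [RHS]eq_bigr => m' _ do rewrite (act_linear _ _ _ _ _ _ _ _ (sc m')).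
rewrite -act_sum; apply: eq_act => i' j' l' /=.
under [RHS]eq_bigr => m' _ do rewrite -scalerA.
by rewrite sum_deltaC.
Qed.

Lemma eq_scale (c x y : k) : x = y -> c *: (x : k^o) = c *: (y : k^o).
Proof. by move=> ->. Qed.

Lemma sum_mate (I J K : finType) (A1 : I -> I -> B) (A2 : J -> J -> B)
    (A3 : K -> K -> B) p Q (c : I -> k) l :
  \sum_m c m * mate A1 A2 A3 p Q l m =
  \sum_i \sum_j p i j *: act A1 A2 A3 (@omegaV k B) (fun i j l => c i * Q j l : k^o) i j l.
Proof.
under eq_bigr do rewrite mulr_sumr; rewrite exchange_big; apply: eq_bigr => i _ /=.
under eq_bigr do rewrite mulr_sumr; rewrite exchange_big; apply: eq_bigr => j _ /=.
transitivity (\sum_m p i j *: (c m *: act A1 A2 A3 (@omegaV k B)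
    (fun i' j' l' => (i' == m)%:R * Q j' l' : k^o) i j l)).
  by apply: eq_bigr => m _; exact: mulrCA.
rewrite -scaler_sumr; apply: eq_scale.
under eq_bigr => m _ do rewrite (act_linear _ _ _ _ _ _ _ _
  (@lin_scaler k k^o k^o _ (c m) (@lin_id k k^o))).
rewrite -act_sum; apply: (@eq_act _ _ _ _ _ _ _ _ k^o) => i' j' l'.
rewrite -[RHS](sum_deltaC (V := k^o) (fun m => c m * Q j' l') i').
by apply: eq_bigr => m _; exact: mulrCA.
Qed.

Lemma sum_comate (I J K : finType) (A1 : I -> I -> B) (A2 : J -> J -> B)
    (A3 : K -> K -> B) E p (c : K -> k) i :
  \sum_m comate A1 A2 A3 E p i m * c m =
  \sum_j \sum_l p j l *: act A1 A2 A3 (@omega k B) (fun i j l => E i j * c l : k^o) i j l.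
Proof.
under eq_bigr do rewrite mulr_suml; rewrite exchange_big; apply: eq_bigr => j _ /=.
under eq_bigr do rewrite mulr_suml; rewrite exchange_big; apply: eq_bigr => l _ /=.
transitivity (\sum_m p j l *: (c m *: act A1 A2 A3 (@omega k B)
    (fun i' j' l' => E i' j' * (l' == m)%:R : k^o) i j l)).
  by apply: eq_bigr => m _; rewrite mulrC; exact: mulrCA.
rewrite -scaler_sumr; apply: eq_scale.
under eq_bigr => m _ do rewrite (act_linear _ _ _ _ _ _ _ _
  (@lin_scaler k k^o k^o _ (c m) (@lin_id k k^o))).
rewrite -act_sum; apply: (@eq_act _ _ _ _ _ _ _ _ k^o) => i' j' l'.
rewrite -[RHS](sum_deltaC (V := k^o) (fun m => E i' j' * c m) l').
apply: eq_bigr => m _; rewrite -[LHS]/(c m * (E i' j' * _)) -[RHS]/(_ * (E i' j' * c m)).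
by rewrite mulrC mulrAC mulrC.
Qed.

Section Snake.
Variables (I J K L : finType).
Variables (A1 : I -> I -> B) (A2 : J -> J -> B) (A3 : K -> K -> B) (A4 : L -> L -> B).
Hypotheses (h1 : comatrix A1) (h2 : comatrix A2) (h3 : comatrix A3) (h4 : comatrix A4).

(** Apply the pentagon to E ⊗ Q: invariance of E and of Q trivializes two of its
    five sides, and coinvariance of p a third one. *)
Lemma pairing_mate E p Q i l :
  invariant_pairing A1 A2 E -> invariant_copairing A2 A3 p -> invariant_pairing A3 A4 Q ->
  \sum_j E i j * mate A2 A3 A4 p Q l j = \sum_x comate A1 A2 A3 E p i x * Q x l.
Proof.
move=> hE hp hQ.
pose G i j x l : k^o := E i j * Q x l.
pose F i j x l := act A1 A2 A3 (@omega k B) (fun i j x => G i j x l) i j x.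
pose M4F j x l := \sum_i1 \sum_j' \sum_x' \sum_l2
  omega (A1 i i1) (A2 j j' ⋅ A3 x x') (A4 l l2) *: F i1 j' x' l2.
have fixG j x l0 : act A2 A3 A4 (@omega k B) M4F j x l0 = G i j x l0.
  rewrite -(pentagon h1 h2 h3 h4 G).
  transitivity (\sum_i1 \sum_j1 \sum_x1 \sum_l1
      omega (A1 i i1) (A2 j j1) (A3 x x1 ⋅ A4 l0 l1) *: (Q x1 l1 * E i1 j1 : k^o)).
    do 4 (apply: eq_bigr => ? _); apply: eq_scale; rewrite [RHS]mulrC.
    apply: (pairing_collapse4
      (f := fun a x' l' => omega a (A3 _ x') (A4 _ l'))) => // x' l'.
      exact: omega_lin1.
    exact: omega_one_left.
  rewrite exchange_pairs [RHS]mulrC.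
  apply: (pairing_collapse4
    (f := fun a i' j' => omega (A1 i i') (A2 j j') a)) => // i' j'.
    exact: omega_lin3.
  exact: omega_one_right.
transitivity (\sum_j \sum_x p j x *: M4F j x l).
  rewrite sum_mate; apply: eq_bigr => j _; apply: eq_bigr => x _; apply: eq_scale.
  rewrite -(act_omegaVK h2 h3 h4 M4F).
  by apply: (@eq_act _ _ _ _ _ _ _ _ k^o) => j' x' l'; rewrite fixG.
rewrite sum_comate /M4F.
under eq_bigr do under eq_bigr do rewrite exchange_middle.
apply: (@copairing_collapse4 _ _ _ _ A2 A3
  (fun a i' l' => omega (A1 i i') a (A4 l l')) i l _ _ p
  (fun j x i l => F i j x l) hp) => i' l'; first exact: omega_lin2.
by rewrite omega_one_mid h1.2 h4.2.
Qed.

(** The same argument with p ⊗ p' in place of E ⊗ Q, and Q in place of p. *)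
Lemma copairing_mate p Q p' m u :
  invariant_copairing A1 A2 p -> invariant_pairing A2 A3 Q -> invariant_copairing A3 A4 p' ->
  \sum_x p' x u * mate A1 A2 A3 p Q x m = \sum_j p m j * comate A2 A3 A4 Q p' j u.
Proof.
move=> hp hQ hp'.
pose P (G : I -> J -> K -> L -> k^o) : k^o :=
  \sum_i \sum_j p i j *: \sum_x \sum_l p' x l *: G i j x l.
have eqP_ G H : (forall i j x l, G i j x l = H i j x l) -> P G = P H.
  by move=> h; do 2 (apply: eq_bigr => ? _); apply: eq_scale;
    do 2 (apply: eq_bigr => ? _); rewrite h.
have P12 G : P (fun i j x l => \sum_i' \sum_j' \sum_x' \sum_l'
    omega (A1 i i' ⋅ A2 j j') (A3 x x') (A4 l l') *: G i' j' x' l') = P G.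
  have swap H : P H = \sum_x \sum_l p' x l *: \sum_i \sum_j p i j *: H i j x l.
    rewrite /P [LHS]pair_bigA [RHS]pair_bigA /=.
    under eq_bigr do rewrite pair_bigA scaler_sumr.
    rewrite exchange_big; apply: eq_bigr => q _; rewrite pair_bigA scaler_sumr.
    by apply: eq_bigr => r _; rewrite !scalerA mulrC.
  rewrite !swap; apply: eq_bigr => x _; apply: eq_bigr => l _; apply: eq_scale.
  apply: (@copairing_collapse4 _ _ _ _ A1 A2
    (fun a x' l' => omega a (A3 x x') (A4 l l')) x l _ _ p G hp) => x' l'.
    exact: omega_lin1.
  exact: omega_one_left.
have P34 G : P (fun i j x l => \sum_i' \sum_j' \sum_x' \sum_l'
    omega (A1 i i') (A2 j j') (A3 x x' ⋅ A4 l l') *: G i' j' x' l') = P G.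
  apply: eq_bigr => i _; apply: eq_bigr => j _; apply: eq_scale.
  under eq_bigr do under eq_bigr do rewrite exchange_pairs.
  apply: (@copairing_collapse4 _ _ _ _ A3 A4
    (fun a i' j' => omega (A1 i i') (A2 j j') a) i j _ _ p'
    (fun x l i j => G i j x l) hp') => i' j'; first exact: omega_lin3.
  exact: omega_one_right.
(* G is chosen so that omega on the first three comodules turns it into G0, in
   which Q occurs as a factor *)
pose G0 i j x l : k^o := Q j x * ((i == m)%:R * (l == u)%:R).
pose G i j x l := act A1 A2 A3 (@omegaV k B) (fun i j x => G0 i j x l) i j x.
have PG : P G = P (fun i j x l => act A2 A3 A4 (@omega k B) (G0 i) j x l).
  rewrite -[LHS]P12 -[LHS]P34; apply: eqP_ => i j x l.
  rewrite (pentagon h1 h2 h3 h4 G).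
  apply: (@eq_act _ _ _ _ _ _ _ _ k^o) => j1 x1 l1.
  transitivity (\sum_i1 \sum_j' \sum_x' \sum_l2
      omega (A1 i i1) (A2 j1 j' ⋅ A3 x1 x') (A4 l1 l2) *: G0 i1 j' x' l2).
    do 4 (apply: eq_bigr => ? _); apply: eq_scale.
    exact: (act_omegaK (W := k^o) h1 h2 h3).
  rewrite exchange_middle.
  apply: (@pairing_collapse4 _ _ _ _ A2 A3
    (fun a i' l' => omega (A1 i i') a (A4 l1 l')) i l1 _ _ Q
    (fun i l => (i == m)%:R * (l == u)%:R) j1 x1 hQ) => i' l'; first exact: omega_lin2.
  by rewrite omega_one_mid h1.2 h4.2.
transitivity (P G).
  pose g i j x := act A1 A2 A3 (@omegaV k B)
    (fun i' j' x' => (i' == m)%:R * Q j' x' : k^o) i j x.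
  have Gg i j x l : G i j x l = (l == u)%:R *: g i j x.
    rewrite (act_linear _ _ _ _ _ _ _ _ (@lin_scaler k k^o k^o _ _ (@lin_id k k^o))).
    apply: (@eq_act _ _ _ _ _ _ _ _ k^o) => i' j' x'.
    by rewrite -[RHS]/(_ * (_ * _)) /G0 mulrA mulrC [Q _ _ * _]mulrC.
  rewrite (eqP_ _ _ Gg) /P [RHS]pair_bigA /=.
  transitivity (\sum_x \sum_(q : I * J) p' x u * (p q.1 q.2 * g q.1 q.2 x)).
    by apply: eq_bigr => x _; rewrite /mate pair_bigA mulr_sumr.
  rewrite exchange_big; apply: eq_bigr => q _ /=.
  rewrite scaler_sumr; apply: eq_bigr => x _.
  transitivity (p q.1 q.2 *: (p' x u *: g q.1 q.2 x)); first exact: mulrCA.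
  apply: eq_scale; rewrite -[LHS](sum_delta (V := k^o) (fun l => p' x l *: g q.1 q.2 x)).
  by apply: eq_bigr => l _; exact: mulrCA.
rewrite PG.
pose g j x l := act A2 A3 A4 (@omega k B) (fun j' x' l' => Q j' x' * (l' == u)%:R : k^o) j x l.
have Gg i j x l : act A2 A3 A4 (@omega k B) (G0 i) j x l = (i == m)%:R *: g j x l.
  rewrite (act_linear _ _ _ _ _ _ _ _ (@lin_scaler k k^o k^o _ _ (@lin_id k k^o))).
  by apply: (@eq_act _ _ _ _ _ _ _ _ k^o) => j' x' l'; exact: mulrCA.
rewrite (eqP_ _ _ Gg) /P.
rewrite -[RHS](sum_delta (V := k^o) (fun i => \sum_j p i j * comate A2 A3 A4 Q p' j u)).
apply: eq_bigr => i _; rewrite scaler_sumr; apply: eq_bigr => j _.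
transitivity (p i j *: ((i == m)%:R *: (comate A2 A3 A4 Q p' j u : k^o)));
  last exact: mulrCA.
apply: eq_scale; rewrite /comate scaler_sumr; apply: eq_bigr => x _.
by rewrite scaler_sumr; apply: eq_bigr => l _; exact: mulrCA.
Qed.

End Snake.
End Invariants.

(** * Dual comatrices and preantipodes *)

Section MatrixDuals.
Variables (k : fieldType) (B : coquasi_bialgebra k).

(** A right dual in bases: A and A' are the coefficients of the comodule and of its
    dual, E and D the matrices of the evaluation and of the dual basis map. *)
Record matrix_dual (I J : finType) (A : I -> I -> B) (A' : J -> J -> B)
    (E : I -> J -> k) (D : J -> I -> k) : Prop := MatrixDual {
  dual_comatrix : comatrix A';
  dual_ev : invariant_pairing A A' E;
  dual_db : invariant_copairing A' A D;
  dual_obj : forall i m, comate A A' A E D i m = (i == m)%:R;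
  dual_dual : forall l m, mate A' A A' D E l m = (l == m)%:R
}.

(** The associator is natural; here, in its second and third arguments. *)
Lemma act_intertwine2 (I J J' K : finType) (A1 : I -> I -> B) (A2 : J -> J -> B)
    (A2' : J' -> J' -> B) (A3 : K -> K -> B) (G : J -> J' -> k) (W : lmodType k)
    (f : B -> B -> B -> k) (H : I -> J' -> K -> W) i j x :
  (forall a c, linear (fun b => f a b c : k^o)) -> intertwines A2 A2' G ->
  \sum_j' G j j' *: act A1 A2' A3 f H i j' x =
  act A1 A2 A3 f (fun i j x => \sum_j' G j j' *: H i j' x) i j x.
Proof.
move=> hf hG; rewrite /act.
transitivity (\sum_i' \sum_j1 \sum_x' \sum_j'
    (G j j' * f (A1 i i') (A2' j' j1) (A3 x x')) *: H i' j1 x').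
  rewrite sum3 exchange_big; apply: eq_bigr => j' _.
  by rewrite sum3 scaler_sumr; apply: eq_bigr => q _; rewrite scalerA.
apply: eq_bigr => i' _; rewrite exchange_big [RHS]exchange_big.
apply: eq_bigr => x' _ /=.
transitivity (\sum_j1 \sum_j' (G j' j1 * f (A1 i i') (A2 j j') (A3 x x')) *: H i' j1 x').
  apply: eq_bigr => j1 _; rewrite -!scaler_suml; congr (_ *: _).
  pose L b : k^o := f (A1 i i') b (A3 x x').
  have hL : linear L by exact: hf.
  transitivity (L (\sum_j' G j j' *: A2' j' j1)).
    by rewrite (lin_sumE _ hL); apply: eq_bigr => j' _; rewrite (lin_scaleE _ _ hL).
  rewrite -hG (lin_sumE _ hL).
  by apply: eq_bigr => j' _; rewrite (lin_scaleE _ _ hL).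
rewrite exchange_big; apply: eq_bigr => j' _; rewrite scaler_sumr.
by apply: eq_bigr => j1 _; rewrite scalerA mulrC.
Qed.

Lemma act_intertwine3 (I J K K' : finType) (A1 : I -> I -> B) (A2 : J -> J -> B)
    (A3 : K -> K -> B) (A3' : K' -> K' -> B) (G : K -> K' -> k) (W : lmodType k)
    (f : B -> B -> B -> k) (H : I -> J -> K' -> W) i j x :
  (forall a b, linear (fun c => f a b c : k^o)) -> intertwines A3 A3' G ->
  \sum_x' G x x' *: act A1 A2 A3' f H i j x' =
  act A1 A2 A3 f (fun i j x => \sum_x' G x x' *: H i j x') i j x.
Proof.
move=> hf hG; rewrite /act.
transitivity (\sum_i' \sum_j' \sum_x1 \sum_x'
    (G x x' * f (A1 i i') (A2 j j') (A3' x' x1)) *: H i' j' x1).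
  rewrite sum3 exchange_big; apply: eq_bigr => x' _.
  by rewrite sum3 scaler_sumr; apply: eq_bigr => q _; rewrite scalerA.
apply: eq_bigr => i' _; apply: eq_bigr => j' _ /=.
transitivity (\sum_x1 \sum_x' (G x' x1 * f (A1 i i') (A2 j j') (A3 x x')) *: H i' j' x1).
  apply: eq_bigr => x1 _; rewrite -!scaler_suml; congr (_ *: _).
  pose L c : k^o := f (A1 i i') (A2 j j') c.
  have hL : linear L by exact: hf.
  transitivity (L (\sum_x' G x x' *: A3' x' x1)).
    by rewrite (lin_sumE _ hL); apply: eq_bigr => x' _; rewrite (lin_scaleE _ _ hL).
  rewrite -hG (lin_sumE _ hL).
  by apply: eq_bigr => x' _; rewrite (lin_scaleE _ _ hL).
rewrite exchange_big; apply: eq_bigr => x' _; rewrite scaler_sumr.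
by apply: eq_bigr => x1 _; rewrite scalerA mulrC.
Qed.

Section Transport.
Variables (I J K : finType) (A : I -> I -> B) (A' : J -> J -> B) (C : K -> K -> B).
Variables (E : I -> J -> k) (D : J -> I -> k) (G : I -> K -> k).
Hypotheses (hD : invariant_copairing A' A D) (hG : intertwines A C G).

(** The image of the dual basis of A under the comodule map G. *)
Definition push (j : J) (x : K) : k := \sum_i D j i * G i x.

Lemma push_copairing : invariant_copairing A' C push.
Proof.
move=> j' x'.
transitivity (\sum_j \sum_i D j i *: (A' j j' ⋅ \sum_x G i x *: C x x')).
  apply: eq_bigr => j _.
  under eq_bigr do rewrite scaler_suml; rewrite exchange_big; apply: eq_bigr => i _ /=.
  rewrite (lin_sumE _ (mult_linr _)) scaler_sumr; apply: eq_bigr => x _.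
  by rewrite (lin_scaleE _ _ (mult_linr _)) scalerA.
under eq_bigr do under eq_bigr do rewrite -hG.
transitivity (\sum_i' G i' x' *: \sum_j \sum_i D j i *: (A' j j' ⋅ A i i')).
  under [RHS]eq_bigr do rewrite pair_bigA scaler_sumr.
  rewrite pair_bigA exchange_big; apply: eq_bigr => q _ /=.
  rewrite (lin_sumE _ (mult_linr _)) scaler_sumr; apply: eq_bigr => i' _.
  by rewrite (lin_scaleE _ _ (mult_linr _)) !scalerA mulrC.
rewrite /push scaler_suml; apply: eq_bigr => i' _.
by rewrite hD scalerA mulrC.
Qed.

(** The snake identity of A, followed by G. *)
Lemma comate_push i x : (forall i m, comate A A' A E D i m = (i == m)%:R) ->
  comate A A' C E push i x = G i x.
Proof.
move=> hobj; rewrite -[RHS](sum_deltaC (V := k^o) (fun m => G m x) i).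
transitivity (\sum_m comate A A' A E D i m * G m x); last first.
  by apply: eq_bigr => m _; rewrite hobj.
rewrite sum_comate; apply: eq_bigr => j _.
transitivity (\sum_m D j m *: (\sum_y G m y *: act A A' C (@omega k B)
    (fun i j l => E i j * (l == x)%:R : k^o) i j y)).
  under [RHS]eq_bigr do rewrite scaler_sumr.
  rewrite [RHS]exchange_big; apply: eq_bigr => y _ /=.
  by rewrite /push scaler_suml; apply: eq_bigr => m _; rewrite scalerA.
apply: eq_bigr => m _; apply: eq_scale.
rewrite (act_intertwine3 _ _ _ _ _ _ (@omega_lin3 k B) hG).
apply: (@eq_act _ _ _ _ _ _ _ _ k^o) => i' j' m'.
rewrite -[RHS](sum_delta (V := k^o) (fun y => E i' j' * G m' y) x).
by apply: eq_bigr => y _; rewrite -[LHS]/(_ * (_ * _)) mulrA mulrC [G _ _ * _]mulrC.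
Qed.

End Transport.
End MatrixDuals.

Section MateFormulas.
Variables (k : fieldType) (B : coquasi_bialgebra k).
Variables (I J K : finType) (A1 : I -> I -> B) (A2 : J -> J -> B) (A3 : K -> K -> B).

Lemma mateE (p : I -> J -> k) (Q : J -> K -> k) l m :
  mate A1 A2 A3 p Q l m = \sum_i \sum_j \sum_j' \sum_l'
    p i j * Q j' l' * omegaV (A1 i m) (A2 j j') (A3 l l').
Proof.
apply: eq_bigr => i _; apply: eq_bigr => j _.
rewrite -[RHS](sum_delta (V := k^o) (fun i' => \sum_j' \sum_l'
  p i j * Q j' l' * omegaV (A1 i i') (A2 j j') (A3 l l'))).
rewrite scaler_sumr; apply: eq_bigr => i' _; rewrite !scaler_sumr.
apply: eq_bigr => j' _; rewrite !scaler_sumr; apply: eq_bigr => l' _.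
rewrite -[LHS]/(_ * (_ * (_ * _))) -[RHS]/(_ * (_ * _ * _)).
by ring.
Qed.

Lemma comateE (E : I -> J -> k) (p : J -> K -> k) i m :
  comate A1 A2 A3 E p i m = \sum_j \sum_x \sum_i' \sum_j'
    p j x * E i' j' * omega (A1 i i') (A2 j j') (A3 x m).
Proof.
apply: eq_bigr => j _; apply: eq_bigr => x _; rewrite scaler_sumr.
apply: eq_bigr => i' _; rewrite scaler_sumr; apply: eq_bigr => j' _.
rewrite -[RHS](sum_delta (V := k^o) (fun x' =>
  p j x * E i' j' * omega (A1 i i') (A2 j j') (A3 x x'))) scaler_sumr.
apply: eq_bigr => x' _.
rewrite -[LHS]/(_ * (_ * (_ * _))) -[RHS]/(_ * (_ * _ * _)).
by ring.
Qed.

End MateFormulas.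

Lemma exchange_last (V : nmodType) (I J K : finType) (F : I -> J -> K -> V) :
  \sum_i \sum_j \sum_l F i j l = \sum_l \sum_i \sum_j F i j l.
Proof. by rewrite [RHS]exchange_big; apply: eq_bigr => i _; rewrite exchange_big. Qed.

Section PreantipodeOfDuals.
Variables (k : fieldType) (B : coquasi_bialgebra k).

Definition matrix_rigid : Prop :=
  forall (I : finType) (A : I -> I -> B), comatrix A ->
  exists (J : finType) (A' : J -> J -> B) E D, matrix_dual A A' E D.

(** The value at A i m of the preantipode, for a given dual of A. *)
Definition dual_coef (I J : finType) (A' : J -> J -> B) (E : I -> J -> k)
    (D : J -> I -> k) (i m : I) : B := coef A' (fun j => D j m) (E i).

(** The dual of a comodule map G, which is the mate of G, carries one side to the
    other: it commutes with the coactions, and with the evaluations and the dual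
    bases up to G. *)
Lemma dual_coef_natural (I J K L : finType) (A : I -> I -> B) (A' : J -> J -> B)
    (C : K -> K -> B) (C' : L -> L -> B) E D E2 D2 (G : I -> K -> k) i x :
  comatrix A -> comatrix C -> matrix_dual A A' E D -> matrix_dual C C' E2 D2 ->
  intertwines A C G ->
  \sum_i' G i' x *: dual_coef A' E D i i' = \sum_y G i y *: dual_coef C' E2 D2 y x.
Proof.
move=> hA hC dA dC hG.
have [hA' hC'] := (dual_comatrix dA, dual_comatrix dC).
pose p := push D G; have hp : invariant_copairing A' C p := push_copairing (dual_db dA) hG.
pose H := mate A' C C' p E2.
have intH : intertwines C' A' H := mate_intertwines hA' hC hC' hp (dual_ev dC).
have evH y l : \sum_j E y j * H l j = \sum_z G y z * E2 z l.
  rewrite (pairing_mate hA hA' hC hC' _ _ (dual_ev dA) hp (dual_ev dC)).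
  by apply: eq_bigr => z _; rewrite (comate_push hG) //; exact: dual_obj dA.
have dbH j z : \sum_l D2 l z * H l j = p j z.
  rewrite (copairing_mate hA' hC hC' hC _ _ hp (dual_ev dC) (dual_db dC)).
  rewrite -[RHS](sum_delta (V := k^o) (fun y => p j y) z).
  by apply: eq_bigr => y _; rewrite (dual_obj dC) mulrC.
transitivity (\sum_j \sum_l (p j x * E i l) *: A' j l).
  rewrite /dual_coef /coef; under eq_bigr do rewrite scaler_sumr.
  rewrite exchange_big; apply: eq_bigr => j _ /=.
  under eq_bigr do rewrite scaler_sumr.
  rewrite exchange_big; apply: eq_bigr => l _ /=.
  rewrite /p /push mulr_suml scaler_suml; apply: eq_bigr => i' _.
  by rewrite scalerA mulrA [G _ _ * _]mulrC.
transitivity (\sum_l D2 l x *: \sum_j E i j *: \sum_j' H l j' *: A' j' j).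
  under [RHS]eq_bigr => l _.
    rewrite scaler_sumr; under eq_bigr do rewrite scalerA scaler_sumr.
    rewrite exchange_big /=; over.
  rewrite [RHS]exchange_big; apply: eq_bigr => j _ /=.
  rewrite exchange_big; apply: eq_bigr => j' _ /=.
  rewrite -dbH mulr_suml scaler_suml; apply: eq_bigr => l _.
  by rewrite scalerA mulrAC.
under eq_bigr do under eq_bigr do rewrite -intH.
rewrite /dual_coef /coef.
under [RHS]eq_bigr do rewrite scaler_sumr.
rewrite [RHS]exchange_big; apply: eq_bigr => l _ /=.
under eq_bigr do rewrite scaler_sumr.
rewrite exchange_big scaler_sumr.
under [RHS]eq_bigr do rewrite scaler_sumr.
rewrite [RHS]exchange_big; apply: eq_bigr => l' _ /=.
under eq_bigr do rewrite scalerA.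
rewrite -scaler_suml evH scalerA mulr_sumr scaler_suml; apply: eq_bigr => y _.
by rewrite scalerA mulrCA.
Qed.

Lemma tsum_coef (J : finType) (A' : J -> J -> B) (x y : J -> k) (W : lmodType k)
    (F : B -> B -> W) : comatrix A' -> bilin F ->
  tsum F (Δ (coef A' x y)) =
  \sum_j \sum_l x j *: (\sum_m y m *: F (A' j l) (A' l m)).
Proof.
move=> hA' hF.
have hL : linear (fun h : B => tsum F (Δ h)) by apply: lin_sum => //; exact: linearP.
rewrite /coef (lin_sumE _ hL); apply: eq_bigr => j _.
rewrite (lin_sumE _ hL) -scaler_sumr exchange_big scaler_sumr; apply: eq_bigr => m _.
by rewrite (lin_scaleE _ _ hL) tsum_comatrix // -scalerA scaler_sumr.
Qed.

(** The preantipode sends the coefficient f(v_0) v_{-1} to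
    ev(v ⊗ d_0) f(e) d_{-1}, where d ⊗ e is the value of the dual basis map.  Its
    axioms are checked on comatrices: they are the colinearity of the dual basis
    map, the colinearity of the evaluation, and the snake identity of A. *)
Lemma matrix_rigid_preantipode : matrix_rigid -> has_preantipode B.
Proof.
move=> rig.
(* choose a dual for every comatrix, and extend the resulting values by zero *)
have rig' (I : finType) (A : I -> I -> B) : exists T : I -> I -> B, comatrix A ->
    exists (J : finType) (A' : J -> J -> B) E D,
      matrix_dual A A' E D /\ T = dual_coef A' E D.
  case: (pselect (comatrix A)) => [hA|nA]; last by exists (fun _ _ => 0) => /nA.
  have [J [A' [E [D d]]]] := rig I A hA.
  by exists (dual_coef A' E D) => _; exists J, A', E, D.
pose T (I : finType) A := projT1 (cid (rig' I A)).
have TP (I : finType) A : comatrix A -> exists (J : finType) (A' : J -> J -> B) E D,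
    matrix_dual A A' E D /\ T I A = dual_coef A' E D := projT2 (cid (rig' I A)).
have natT : natural T.
  move=> I J A C G hA hC hG i j.
  have [? [? [? [? [dA ->]]]]] := TP _ _ hA; have [? [? [? [? [dC ->]]]]] := TP _ _ hC.
  exact: (dual_coef_natural i j hA hC dA dC hG).
have [S hS] := natural_factor natT.
exists S; split.
- apply: comatrix_ext; [by lin | by lin |] => I A hA i m.
  have [J [A' [E [D [d TA]]]]] := TP _ _ hA; have hA' := dual_comatrix d.
  have SA i0 m0 : S (A i0 m0) = coef A' (fun j => D j m0) (E i0) by rewrite hS // TA.
  rewrite (tsum_comatrix _ _ hA); last by lin.
  under eq_bigr => i' _.
    rewrite SA (tsum_coef _ _ hA'); last by lin.
    over.
  rewrite SA (lin_sumE (L := fun x => 1_[B] ⊗ x)); last by lin.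
  rewrite exchange_last; apply: eq_bigr => l _ /=.
  rewrite (lin_sumE (L := fun x => 1_[B] ⊗ x)); last by lin.
  transitivity (\sum_m0 E i m0 *: \sum_i' \sum_j
      D j i' *: ((A' j l ⋅ A i' m) ⊗ A' l m0)).
    under [RHS]eq_bigr do rewrite pair_bigA scaler_sumr.
    rewrite [RHS]exchange_big [LHS]pair_bigA; apply: eq_bigr => q _ /=.
    rewrite scaler_sumr; apply: eq_bigr => m0 _.
    by rewrite !scalerA mulrC.
  apply: eq_bigr => m0 _; rewrite exchange_big.
  rewrite (copairing_collapse (f := fun a => a ⊗ A' l m0) _ _ (dual_db d)); last by lin.
  by rewrite scalerA pureZr mulrC.
- apply: comatrix_ext; [by lin | by lin |] => I A hA i m.
  have [J [A' [E [D [d TA]]]]] := TP _ _ hA; have hA' := dual_comatrix d.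
  have SA i0 m0 : S (A i0 m0) = coef A' (fun j => D j m0) (E i0) by rewrite hS // TA.
  rewrite (tsum_comatrix _ _ hA); last by lin.
  under eq_bigr => i' _.
    rewrite SA (tsum_coef _ _ hA'); last by lin.
    over.
  rewrite SA (lin_sumE (L := fun x => x ⊗ 1_[B])); last by lin.
  rewrite exchange_big; apply: eq_bigr => j _ /=.
  rewrite (lin_sumE (L := fun x => x ⊗ 1_[B])); last by lin.
  rewrite exchange_big; apply: eq_bigr => l _ /=; rewrite -scaler_sumr.
  rewrite (pairing_collapse (f := fun a => A' j l ⊗ a) _ _ (dual_ev d)); last by lin.
  by rewrite scalerA pureZl.
- apply: (@comatrix_ext _ _ k^o); [by rewrite /omega; lin | by lin |] => I A hA i m.
  have [J [A' [E [D [d TA]]]]] := TP _ _ hA; have hA' := dual_comatrix d.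
  have SA i0 m0 : S (A i0 m0) = coef A' (fun j => D j m0) (E i0) by rewrite hS // TA.
  rewrite hA.2 -(dual_obj d) comateE.
  rewrite (@tsum_comatrix _ _ _ _ k^o _ _ _ hA); last by rewrite /omega; lin.
  transitivity (\sum_i' \sum_x \sum_j \sum_j'
      D j x * E i' j' * omega (A i i') (A' j j') (A x m)).
    apply: eq_bigr => i' _.
    rewrite (@tsum_comatrix _ _ _ _ k^o _ _ _ hA); last by rewrite /omega; lin.
    apply: eq_bigr => x _; rewrite SA.
    have hL : linear (fun b => omega (A i i') b (A x m) : k^o) by exact: omega_lin2.
    rewrite /coef (lin_sumE _ hL); apply: eq_bigr => j _.
    by rewrite (lin_sumE _ hL); apply: eq_bigr => j' _; rewrite (lin_scaleE _ _ hL).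
  rewrite [RHS]exchange_big [LHS]exchange_big; apply: eq_bigr => x _ /=.
  by rewrite exchange_big.
Qed.

End PreantipodeOfDuals.

Section FunctionComodule.
Variables (k : fieldType) (C : coalgebra k) (I : finType).

Local Notation M := {ffun I -> C}.

Definition ffun_single (i : I) (c : C) : M := [ffun j => ((j == i)%:R : k) *: c].

Lemma ffun_single_linear i : linear (ffun_single i).
Proof.
move=> a x y; apply/ffunP => j; rewrite !ffunE scalerDr !scalerA.
by congr (_ + _); rewrite mulrC.
Qed.
HB.instance Definition _ i :=
  GRing.isLinear.Build _ _ _ _ (ffun_single i) (ffun_single_linear i).

Lemma ffun_singleE (x : M) : x = \sum_i ffun_single i (x i).
Proof.
apply/ffunP => j; rewrite sum_ffunE.
by under eq_bigr do rewrite ffunE; rewrite (sum_deltaC (fun i => x i)).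
Qed.

Lemma ffun_app_linear i : linear (fun x : M => x i).
Proof. by move=> a x y; rewrite !ffunE. Qed.

(** A power of the regular comodule. *)
Definition ffun_coact (x : M) : C ⊗ M :=
  \sum_i \tsum_(c, d <- Δ (x i)) c ⊗ ffun_single i d.

Lemma ffun_coact_linear : linear ffun_coact.
Proof.
apply: lin_bigr => i; apply: lin_sum; first by lin.
by apply: lin_app; exact: ffun_app_linear.
Qed.
HB.instance Definition _ :=
  GRing.isLinear.Build _ _ _ _ ffun_coact ffun_coact_linear.

Lemma ffun_coact_single i c :
  ffun_coact (ffun_single i c) = \tsum_(d, e <- Δ c) d ⊗ ffun_single i e.
Proof.
rewrite -[RHS](sum_delta (fun j => \tsum_(d, e <- Δ c) d ⊗ ffun_single j e) i).
apply: eq_bigr => j _; rewrite ffunE.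
have hL : linear (fun x : C => \tsum_(d, e <- Δ x) d ⊗ ffun_single j e) by lin.
by rewrite (lin_scaleE _ _ hL).
Qed.

Lemma ffun_coactA x :
  \tsum_(c, w <- ffun_coact x) \tsum_(c1, c2 <- comul c) c1 ⊗ (c2 ⊗ w) =
  \tsum_(c, w <- ffun_coact x) c ⊗ ffun_coact w.
Proof.
have hL : linear (fun t : C ⊗ M => \tsum_(c, w <- t) \tsum_(c1, c2 <- comul c)
    c1 ⊗ (c2 ⊗ w)) by lin.
have hR : linear (fun t : C ⊗ M => \tsum_(c, w <- t) c ⊗ ffun_coact w) by lin.
rewrite (lin_sumE _ hL) (lin_sumE _ hR); apply: eq_bigr => i _.
rewrite (tsum_app _ _ hL) (tsum_app _ _ hR).
transitivity (\tsum_(c, d <- Δ (x i)) \tsum_(c1, c2 <- Δ c)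
    c1 ⊗ (c2 ⊗ ffun_single i d)).
  by apply: eq_tsum => c d; rewrite tsum_pure //; lin.
rewrite (@coact_tsumA _ _ _ (regular_coaction C) _
  (fun c1 c2 d => c1 ⊗ (c2 ⊗ ffun_single i d))); try by lin.
apply: eq_tsum => c d; rewrite tsum_pure ?ffun_coact_single; last by lin.
by rewrite (tsum_app (L := fun t => c ⊗ t)) //; lin.
Qed.

Lemma ffun_coact1 x : \tsum_(c, w <- ffun_coact x) ε (c : C) *: w = x.
Proof.
have hL : linear (fun t : C ⊗ M => \tsum_(c, w <- t) ε (c : C) *: w) by lin.
rewrite (lin_sumE _ hL) [RHS]ffun_singleE; apply: eq_bigr => i _.
rewrite (tsum_app _ _ hL) -[in RHS](comul1l (x i)).
rewrite (tsum_app (L := ffun_single i)); last exact: ffun_single_linear.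
by apply: eq_tsum => c d; rewrite tsum_pure ?linearZ //; lin.
Qed.

Definition ffun_coaction : coaction C M := Coaction ffun_coactA ffun_coact1.

Definition ffun_proj (i : I) (t : C ⊗ M) : C ⊗ C :=
  tsum (fun (c : C) (x : M) => c ⊗ (x i : C)) t.

Lemma ffun_proj_bilin i : bilin (fun (c : C) (x : M) => c ⊗ (x i : C)).
Proof.
split=> [x|c]; first by lin.
by apply: lin_purer; exact: ffun_app_linear.
Qed.

Lemma ffun_proj_linear i : linear (ffun_proj i).
Proof. exact: tsum_linear (ffun_proj_bilin i). Qed.

Lemma ffun_proj_pure i (c : C) (x : M) : ffun_proj i (c ⊗ x) = c ⊗ (x i : C).
Proof. exact: tsum_pure (ffun_proj_bilin i). Qed.

Lemma ffun_proj_coact i x : ffun_proj i (ffun_coaction x) = Δ (x i).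
Proof.
rewrite (lin_sumE _ (ffun_proj_linear i)).
rewrite -[RHS](sum_deltaC (fun j => Δ (x j)) i); apply: eq_bigr => j _.
rewrite (tsum_app _ _ (ffun_proj_linear i)) -[in RHS](tsum_id (Δ (x j))).
rewrite (tsum_app (L := fun t => _ *: t)); last by lin.
by apply: eq_tsum => c d; rewrite ffun_proj_pure ffunE pureZr.
Qed.

Lemma ffun_proj_inj (s t : C ⊗ M) : (forall i, ffun_proj i s = ffun_proj i t) -> s = t.
Proof.
suff rec (u : C ⊗ M) : u = \sum_i tmap idfun (ffun_single i) (ffun_proj i u).
  by move=> h; rewrite [s]rec [t]rec; apply: eq_bigr => i _; rewrite h.
move: u; apply: tens_ext => [//||c x].
  apply: lin_bigr => i; apply: lin_app; exact: ffun_proj_linear.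
rewrite {1}[x]ffun_singleE (lin_sumE (L := fun y => c ⊗ y)); last by lin.
by apply: eq_bigr => i _; rewrite ffun_proj_pure tmap_pure.
Qed.

Lemma slicel_ffun_proj (f : {linear C -> k^o}) t i :
  (slicel f t : M) i = slicel f (ffun_proj i t).
Proof.
move: t; apply: tens_ext => [||c x].
- by apply: (lin_comp (L := fun x : M => x i));
    [exact: ffun_app_linear | exact: slicel_linear].
- by apply: lin_comp; [exact: slicel_linear | exact: ffun_proj_linear].
by rewrite ffun_proj_pure !slicel_pure ffunE.
Qed.

End FunctionComodule.

Section DualsOfPreantipode.
Variables (k : fieldType) (B : coquasi_bialgebra k) (S : {linear B -> B}).
Hypothesis hS : preantipode S.

(** The dual of the comodule with coefficients A is generated by the functions
    i |-> S (A i m) on the basis, that is by the maps v |-> f(v_0) S(v_{-1}) to B;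
    a function is evaluated at a vector by the counit of its value there.  The snake
    identity of the comodule is the axiom on omega.  For that of the dual, the
    composite H is colinear and compatible with evaluation, and a function is
    recovered from its coaction and the evaluation. *)
Lemma preantipode_matrix_rigid : matrix_rigid B.
Proof.
move=> I A hA.
pose Sf m : {ffun I -> B} := [ffun i => S (A i m)].
have [J [w [A' [iw hw sp gen]]]] := finite_subcomodule (ffun_coaction B I) Sf.
have hA' : comatrix A' := coefficients_comatrix iw hw.
have /choice [D' hD'] := sp; pose D j m := D' m j.
pose R i j : B := w j i.
pose E i j : k := ε (R i j).
have comulR i j : Δ (R i j) = \sum_l A' j l ⊗ R i l.
  rewrite -ffun_proj_coact hw (lin_sumE _ (ffun_proj_linear i)).
  by apply: eq_bigr => l _; rewrite ffun_proj_pure.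
have RE i j : R i j = \sum_l E i l *: A' j l.
  by rewrite -[LHS]comul1r comulR tsum_sum //; lin.
have DR i m : \sum_j D j m *: R i j = S (A i m).
  have := congr1 (fun x : {ffun I -> B} => x i) (hD' m); rewrite ffunE => ->.
  by rewrite sum_ffunE; apply: eq_bigr => j _; rewrite ffunE.
(* the functions generated by the S (A - m) inherit this from the second axiom,
   since they are slices of their coactions *)
have coinv i j : \sum_i' A i i' ⋅ R i' j = E i j *: 1_[B].
  have [f hf] := gen j.
  have h : \sum_i' A i i' ⋅ R i' j = (\sum_m f m (S (A i m)) : k) *: 1_[B].
    transitivity (\sum_m \sum_i' A i i' ⋅ slicel (f m) (Δ (S (A i' m)))).
      rewrite exchange_big; apply: eq_bigr => i' _ /=.
      rewrite -(lin_sumE _ (mult_linr (A i i'))); congr (_ ⋅ _).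
      rewrite /R hf sum_ffunE; apply: eq_bigr => m _.
      by rewrite slicel_ffun_proj ffun_proj_coact ffunE.
    rewrite scaler_suml; apply: eq_bigr => m _.
    have := congr1 (slicel (f m)) (preantipode_r hS (A i m)).
    rewrite slicel_pure (tsum_comatrix _ _ hA); last by lin.
    rewrite (lin_sumE _ (slicel_linear _)) => <-; apply: eq_bigr => i' _.
    rewrite (tsum_app _ _ (slicel_linear _)) /slicel.
    rewrite (tsum_app (L := fun b => A i i' ⋅ b)); last by lin.
    apply: eq_tsum => x1 x2; rewrite tsum_pure; last by lin.
    by rewrite (lin_scaleE _ _ (mult_linr _)).
  rewrite h; congr (_ *: _); have := congr1 (fun b : B => ε b : k^o) h.
  rewrite linear_sum linearZ /= counit_one -[_ *: _]/(_ * _) mulr1 => <-.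
  rewrite -[RHS](sum_deltaC (V := k^o) (fun i' => E i' j) i).
  by apply: eq_bigr => i' _; rewrite counit_mult hA.2.
have ev : invariant_pairing A A' E.
  move=> i j; rewrite -coinv; apply: eq_bigr => i' _.
  rewrite RE (lin_sumE _ (mult_linr _)); apply: eq_bigr => j' _.
  by rewrite (lin_scaleE _ _ (mult_linr _)).
(* compare the coefficients of the independent functions w, then evaluate: what is
   left is the first axiom *)
have db : invariant_copairing A' A D.
  move=> j' i'.
  apply: (@independent_tensor_inj _ B _ _ w
    (fun j' => \sum_j \sum_i D j i *: (A' j j' ⋅ A i i'))
    (fun j' => D j' i' *: 1_[B]) iw _ j').
  transitivity (1_[B] ⊗ Sf i'); last first.
    rewrite hD' (lin_sumE (L := fun x => 1_[B] ⊗ x)); last by lin.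
    by apply: eq_bigr => l _; rewrite pureZl pureZr.
  apply: ffun_proj_inj => i; rewrite ffun_proj_pure ffunE -(preantipode_l hS).
  rewrite (tsum_comatrix _ _ hA); last by lin.
  rewrite (lin_sumE _ (ffun_proj_linear i)).
  transitivity (\sum_l \sum_j \sum_m D j m *: ((A' j l ⋅ A m i') ⊗ R i l)).
    apply: eq_bigr => l _; rewrite ffun_proj_pure.
    rewrite (lin_sumE (L := fun x => x ⊗ w l i)); last by lin.
    apply: eq_bigr => j _.
    rewrite (lin_sumE (L := fun x => x ⊗ w l i)); last by lin.
    by apply: eq_bigr => m _; rewrite pureZl.
  rewrite exchange_last; apply: eq_bigr => m _; rewrite exchange_big.
  rewrite -DR (lin_sumE (L := fun h => \tsum_(x1, x2 <- Δ h) (x1 ⋅ A m i') ⊗ x2));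
    last by lin.
  apply: eq_bigr => j _.
  rewrite (lin_scaleE (L := fun h => \tsum_(x1, x2 <- Δ h) (x1 ⋅ A m i') ⊗ x2));
    last by lin.
  by rewrite comulR tsum_sum ?scaler_sumr //; lin.
have obj i m : comate A A' A E D i m = (i == m)%:R.
  have := preantipode_omega hS (A i m); rewrite hA.2 => <-.
  rewrite comateE (@tsum_comatrix _ _ _ _ k^o _ _ _ hA); last by rewrite /omega; lin.
  transitivity (\sum_i' \sum_x omega (A i i') (S (A i' x)) (A x m)); last first.
    apply: eq_bigr => i' _.
    by rewrite (@tsum_comatrix _ _ _ _ k^o _ _ _ hA) //; rewrite /omega; lin.
  transitivity (\sum_i' \sum_x \sum_j \sum_j'
      D j x * E i' j' * omega (A i i') (A' j j') (A x m)).
    rewrite [RHS]exchange_big [LHS]exchange_big; apply: eq_bigr => x _ /=.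
    by rewrite exchange_big.
  apply: eq_bigr => i' _; apply: eq_bigr => x _; rewrite -DR.
  have hL : linear (fun b => omega (A i i') b (A x m) : k^o) by exact: omega_lin2.
  rewrite (lin_sumE _ hL); apply: eq_bigr => j _; rewrite (lin_scaleE _ _ hL) RE.
  rewrite (lin_sumE _ hL) scaler_sumr; apply: eq_bigr => j' _.
  by rewrite (lin_scaleE _ _ hL); exact: esym (mulrA _ _ _).
exists J, A', E, D; split=> // l m.
pose H := mate A' A A' D E.
have intH : intertwines A' A' H := mate_intertwines hA' hA hA' db ev.
have evH i l0 : \sum_j E i j * H l0 j = E i l0.
  rewrite (pairing_mate hA hA' hA hA' _ _ ev db ev).
  rewrite -[RHS](sum_deltaC (V := k^o) (fun x => E x l0) i).
  by apply: eq_bigr => x _; rewrite obj.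
have Hw : \sum_j H l j *: w j = w l.
  apply/ffunP => i; rewrite sum_ffunE.
  transitivity (\sum_j H l j *: R i j); first by apply: eq_bigr => j _; rewrite ffunE.
  transitivity (\sum_l' E i l' *: \sum_j H l j *: A' j l').
    under eq_bigr do rewrite RE scaler_sumr.
    rewrite exchange_big; apply: eq_bigr => l' _ /=; rewrite scaler_sumr.
    by apply: eq_bigr => j _; rewrite !scalerA mulrC.
  under eq_bigr do rewrite -intH scaler_sumr.
  rewrite exchange_big -[RHS]/(R i l) RE; apply: eq_bigr => j' _ /=.
  rewrite -evH scaler_suml; apply: eq_bigr => l' _.
  by rewrite scalerA.
apply/eqP; rewrite -subr_eq0; apply/eqP.
apply: (iw (fun j => H l j - (l == j)%:R)).
by under eq_bigr do rewrite scalerBl; rewrite sumrB Hw sum_deltaC subrr.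
Qed.

End DualsOfPreantipode.

(** * Coquasi-antipodes *)

Section CoquasiAntipode.
Variables (k : fieldType) (B : coquasi_bialgebra k).

(** A map between duals which is compatible with evaluations is determined by this,
    because of the snake identity for its target; hence it is a mate, and it is
    compatible with the dual bases as well. *)
Lemma dual_map_db (I J K L : finType) (A : I -> I -> B) (A' : J -> J -> B)
    (C : K -> K -> B) (C' : L -> L -> B) E D E2 D2 (G : I -> K -> k) (H : L -> J -> k) :
  comatrix A -> comatrix C -> matrix_dual A A' E D -> matrix_dual C C' E2 D2 ->
  intertwines A C G -> intertwines C' A' H ->
  (forall i l, \sum_j E i j * H l j = \sum_z G i z * E2 z l) ->
  forall j z, \sum_l D2 l z * H l j = \sum_i D j i * G i z.
Proof.
move=> hA hC dA dC hG hH hE.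
have [hA' hC'] := (dual_comatrix dA, dual_comatrix dC).
pose p := push D G; have hp : invariant_copairing A' C p := push_copairing (dual_db dA) hG.
have omegaV_lin2 (a c : B) : linear (fun b => omegaV a b c : k^o).
  by rewrite /omegaV; lin.
have omegaV_lin3 (a b : B) : linear (fun c => omegaV a b c : k^o).
  by rewrite /omegaV; lin.
(* expand H by the snake identity of the dual of A, and move G and H through the associator *)
have HE l m : mate A' C C' p E2 l m = H l m.
  rewrite -[RHS](sum_delta (V := k^o) (fun j => H l j) m).
  transitivity (\sum_j H l j * mate A' A A' D E j m); last first.
    by apply: eq_bigr => j _; rewrite (dual_dual dA) mulrC.
  transitivity (\sum_i \sum_x D i x *: act A' A C' (@omegaV k B)
      (fun i' x' l' => (i' == m)%:R * \sum_y G x' y * E2 y l' : k^o) i x l).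
    apply: eq_bigr => i _.
    transitivity (\sum_x D i x *: \sum_y G x y *: act A' C C' (@omegaV k B)
        (fun i' j' l' => (i' == m)%:R * E2 j' l' : k^o) i y l).
      under [RHS]eq_bigr do rewrite scaler_sumr.
      rewrite [RHS]exchange_big; apply: eq_bigr => y _ /=.
      by rewrite /p /push scaler_suml; apply: eq_bigr => x _; rewrite scalerA.
    apply: eq_bigr => x _; apply: eq_scale.
    rewrite (act_intertwine2 _ _ _ _ _ _ omegaV_lin2 hG).
    apply: (@eq_act _ _ _ _ _ _ _ _ k^o) => i' x' l'.
    by rewrite mulr_sumr; apply: eq_bigr => y _; exact: mulrCA.
  under [RHS]eq_bigr do rewrite mulr_sumr.
  rewrite [RHS]exchange_big; apply: eq_bigr => i _ /=.
  under [RHS]eq_bigr do rewrite mulr_sumr.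
  rewrite [RHS]exchange_big; apply: eq_bigr => x _ /=.
  transitivity (D i x *: \sum_j H l j *: act A' A A' (@omegaV k B)
      (fun i' j' l' => (i' == m)%:R * E j' l' : k^o) i x j); last first.
    by rewrite scaler_sumr; apply: eq_bigr => j _; exact: mulrCA.
  apply: eq_scale; rewrite (act_intertwine3 _ _ _ _ _ _ omegaV_lin3 hH).
  apply: (@eq_act _ _ _ _ _ _ _ _ k^o) => i' x' l'.
  by rewrite -hE mulr_sumr; apply: eq_bigr => j _; rewrite -[RHS]/(_ * (_ * _)); ring.
move=> j z; under eq_bigr do rewrite -HE.
rewrite (copairing_mate hA' hC hC' hC _ _ hp (dual_ev dC) (dual_db dC)).
rewrite -[RHS](sum_delta (V := k^o) (fun y => p j y) z).
by apply: eq_bigr => y _; rewrite (dual_obj dC) mulrC.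
Qed.

Section Formulas.
Variables (s : {linear B -> B}) (α β : {linear B -> k^o}).
Variables (I : finType) (A : I -> I -> B) (hA : comatrix A).

Let A' (j i : I) : B := s (A i j).
Let E i j : k := β (A i j).
Let D i j : k := α (A i j).

Lemma antipode_comul_comatrix i j :
  \tsum_(h1, h2 <- Δ (A i j)) s h2 ⊗ s h1 = \sum_l A' j l ⊗ A' l i.
Proof. by rewrite (tsum_comatrix _ _ hA) //; lin. Qed.

Lemma antipode_beta_comatrix i j :
  \tsum_(h1, h' <- Δ (A i j)) \tsum_(h2, h3 <- Δ h') (β h2 : k) *: (h1 ⋅ s h3) =
  \sum_i' \sum_j' E i' j' *: (A i i' ⋅ A' j j').
Proof.
rewrite (tsum_comatrix _ _ hA); last by lin.
by apply: eq_bigr => i' _; rewrite (tsum_comatrix _ _ hA) //; lin.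
Qed.

Lemma antipode_alpha_comatrix i j :
  \tsum_(h1, h' <- Δ (A i j)) \tsum_(h2, h3 <- Δ h') (α h2 : k) *: (s h1 ⋅ h3) =
  \sum_i' \sum_j' D i' j' *: (A' i' i ⋅ A j' j).
Proof.
rewrite (tsum_comatrix _ _ hA); last by lin.
by apply: eq_bigr => i' _; rewrite (tsum_comatrix _ _ hA) //; lin.
Qed.

Lemma antipode_omega_comatrix i j :
  \tsum_(h1, x <- Δ (A i j)) \tsum_(h2, y <- Δ x)
  \tsum_(h3, z <- Δ y) \tsum_(h4, h5 <- Δ z)
    omega h1 ((β h2 * α h4 : k) *: s h3) h5 = comate A A' A E D i j.
Proof.
rewrite (@tsum_comatrix _ _ _ _ k^o _ _ _ hA); last by rewrite /omega; slin.
rewrite comateE exchange_pairs; apply: eq_bigr => a _.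
rewrite (@tsum_comatrix _ _ _ _ k^o _ _ _ hA); last by rewrite /omega; slin.
apply: eq_bigr => b _.
rewrite (@tsum_comatrix _ _ _ _ k^o _ _ _ hA); last by rewrite /omega; slin.
apply: eq_bigr => c _.
rewrite (@tsum_comatrix _ _ _ _ k^o _ _ _ hA); last by rewrite /omega; slin.
apply: eq_bigr => d _.
by rewrite (lin_scaleE _ _ (omega_lin2 _ _)) [D c d * _]mulrC.
Qed.

Lemma antipode_omegaV_comatrix i j :
  \tsum_(h1, x <- Δ (A i j)) \tsum_(h2, y <- Δ x)
  \tsum_(h3, z <- Δ y) \tsum_(h4, h5 <- Δ z)
    omegaV (s h1) ((α h2 * β h4 : k) *: h3) (s h5) = mate A' A A' D E j i.
Proof.
rewrite (@tsum_comatrix _ _ _ _ k^o _ _ _ hA); last by rewrite /omegaV; slin.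
rewrite mateE; apply: eq_bigr => a _.
rewrite (@tsum_comatrix _ _ _ _ k^o _ _ _ hA); last by rewrite /omegaV; slin.
apply: eq_bigr => b _.
rewrite (@tsum_comatrix _ _ _ _ k^o _ _ _ hA); last by rewrite /omegaV; slin.
apply: eq_bigr => c _.
rewrite (@tsum_comatrix _ _ _ _ k^o _ _ _ hA); last by rewrite /omegaV; slin.
apply: eq_bigr => d _.
have hL : linear (fun b => omegaV (s (A i a)) b (s (A d j)) : k^o).
  by rewrite /omegaV; lin.
by rewrite (lin_scaleE _ _ hL).
Qed.

End Formulas.

Lemma coquasi_antipodeP (s : {linear B -> B}) (α β : {linear B -> k^o}) :
  coquasi_antipode s α β <->
  forall (I : finType) (A : I -> I -> B), comatrix A ->
    matrix_dual A (fun j i => s (A i j)) (fun i j => β (A i j)) (fun i j => α (A i j)).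
Proof.
split=> [h I A hA|h].
  split.
  - split=> i j; last by rewrite (antipode_counit h) hA.2 eq_sym.
    by rewrite (antipode_comul h) (antipode_comul_comatrix s hA).
  - by move=> i j; rewrite -(antipode_beta_comatrix s β hA) (antipode_beta h).
  - by move=> i j; rewrite -(antipode_alpha_comatrix s α hA) (antipode_alpha h).
  - by move=> i j; rewrite -(antipode_omega_comatrix s α β hA) (antipode_omega h) hA.2.
  - move=> i j; rewrite -(antipode_omegaV_comatrix s α β hA) (antipode_omegaV h) hA.2.
    by rewrite eq_sym.
split.
- apply: comatrix_ext; [by lin | by lin |] => I A hA i j.
  rewrite (antipode_comul_comatrix s hA).
  exact: (dual_comatrix (h _ _ hA)).1.
- apply: (@comatrix_ext _ _ k^o); [by lin | by lin |] => I A hA i j.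
  by rewrite hA.2 eq_sym; exact: (dual_comatrix (h _ _ hA)).2.
- apply: comatrix_ext; [by lin | by lin |] => I A hA i j.
  by rewrite (antipode_beta_comatrix s β hA) (dual_ev (h _ _ hA)).
- apply: comatrix_ext; [by lin | by lin |] => I A hA i j.
  by rewrite (antipode_alpha_comatrix s α hA) (dual_db (h _ _ hA)).
- apply: (@comatrix_ext _ _ k^o); [by rewrite /omega; slin | by lin |] => I A hA i j.
  by rewrite (antipode_omega_comatrix s α β hA) (dual_obj (h _ _ hA)) hA.2.
- apply: (@comatrix_ext _ _ k^o); [by rewrite /omegaV; slin | by lin |] => I A hA i j.
  by rewrite (antipode_omegaV_comatrix s α β hA) (dual_dual (h _ _ hA)) hA.2 eq_sym.
Qed.

(** The values db are natural too, by [dual_map_db] applied to the transpose of a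
    comodule map; so the three families define linear maps on B. *)
Lemma natural_duals_coquasi_Hopf
    (s : forall I : finType, (I -> I -> B) -> I -> I -> B)
    (ev db : forall I : finType, (I -> I -> B) -> I -> I -> k) :
  (forall (I : finType) (A : I -> I -> B), comatrix A ->
    matrix_dual A (fun j i => s I A i j) (ev I A) (db I A)) ->
  natural s -> natural (ev : forall I : finType, (I -> I -> B) -> I -> I -> k^o) ->
  is_coquasi_Hopf B.
Proof.
move=> dual nat_s nat_ev.
have nat_db : natural (db : forall I : finType, (I -> I -> B) -> I -> I -> k^o).
  move=> I J A C G hA hC hG i j.
  have intH : intertwines (fun j i => s J C i j) (fun j i => s I A i j) (fun l j => G j l).
    by move=> l m; have := nat_s _ _ _ _ _ hA hC hG m l => /esym.
  have := dual_map_db hA hC (dual _ _ hA) (dual _ _ hC) hG intH _ i j.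
  move=> h; rewrite /= in h.
  transitivity (\sum_i' db I A i i' * G i' j).
    by apply: eq_bigr => i' _; exact: mulrC.
  rewrite -h; first by apply: eq_bigr => i' _; exact: mulrC.
  move=> i0 l; rewrite -[RHS](nat_ev _ _ _ _ _ hA hC hG i0 l).
  by apply: eq_bigr => i' _; exact: mulrC.
have [s' hs'] := natural_factor nat_s.
have [β hβ] := natural_factor nat_ev.
have [α hα] := natural_factor nat_db.
exists s', α, β; apply/coquasi_antipodeP => I A hA.
have := dual _ _ hA.
have -> : s I A = fun i j => s' (A i j) by apply/funext => i; apply/funext => j; rewrite hs'.
have -> : ev I A = fun i j => β (A i j) by apply/funext => i; apply/funext => j; rewrite hβ.
have -> : db I A = fun i j => α (A i j) by apply/funext => i; apply/funext => j; rewrite hα.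
by [].
Qed.

End CoquasiAntipode.

(** * Duals of comodules in bases *)

Section VectorBases.
Import VectorInternalTheory.
Variables (k : fieldType) (V : vectType k).

Definition vect_basis (i : 'I_(dim V)) : V := r2v (delta_mx 0 i).

Definition vect_coord_fun (i : 'I_(dim V)) (v : V) : k^o := v2r v 0 i.

Lemma vect_coord_linear i : linear (vect_coord_fun i).
Proof. by move=> a x y; rewrite /vect_coord_fun linearP !mxE. Qed.

Definition vect_coord (i : 'I_(dim V)) : {linear V -> k^o} :=
  HB.pack (vect_coord_fun i)
    (GRing.isLinear.Build _ _ _ _ (vect_coord_fun i) (vect_coord_linear i)).

Lemma vect_basisP : is_basis vect_basis vect_coord.
Proof.
split=> [v|i j]; last by rewrite /= /vect_coord_fun r2vK !mxE eqxx.
rewrite -{1}[v]v2rK (row_sum_delta (v2r v)) linear_sum.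
by apply: eq_bigr => i _; rewrite linearZ.
Qed.

Variables (I : finType) (b : I -> V) (b' : I -> {linear V -> k^o}).
Hypothesis hb : is_basis b b'.

Definition dual_basis (i : I) : 'Hom(V, k^o) := linfun (b' i).

Lemma dual_coord_linear i : linear (fun φ : 'Hom(V, k^o) => φ (b i)).
Proof. by move=> a x y; rewrite add_lfunE scale_lfunE. Qed.

Definition dual_coord (i : I) : {linear 'Hom(V, k^o) -> k^o} :=
  HB.pack (fun φ : 'Hom(V, k^o) => φ (b i))
    (GRing.isLinear.Build _ _ _ _ _ (dual_coord_linear i)).

Lemma dual_basisP : is_basis dual_basis dual_coord.
Proof.
split=> [φ|i j] /=; last by rewrite lfunE /= hb.2 eq_sym.
apply/lfunP => v; rewrite sum_lfunE {1}(hb.1 v) linear_sum.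
by apply: eq_bigr => i _; rewrite scale_lfunE lfunE linearZ; exact: mulrC.
Qed.

End VectorBases.

Section TensorBases.
Variables (k : fieldType) (U V : lmodType k) (I J : finType).
Variables (b : I -> U) (b' : I -> {linear U -> k^o}) (c : J -> V) (c' : J -> {linear V -> k^o}).
Hypotheses (hb : is_basis b b') (hc : is_basis c c').

Definition tensor_coord (i : I) (j : J) (t : U ⊗ V) : k^o :=
  \tsum_(u, v <- t) (b' i u : k) * (c' j v : k).

Lemma tensor_coord_linear i j : linear (tensor_coord i j).
Proof. by rewrite /tensor_coord; slin. Qed.

Lemma tensor_coord_pure i j u v :
  tensor_coord i j (u ⊗ v) = (b' i u : k) * (c' j v : k).
Proof. by rewrite /tensor_coord (@tsum_pure _ _ _ k^o) //; slin. Qed.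

Lemma tensor_basisE t : t = \sum_i \sum_j (tensor_coord i j t : k) *: (b i ⊗ c j).
Proof.
move: t; apply: tens_ext => [//||u v].
  by apply: lin_bigr => i; apply: lin_bigr => j; apply: lin_scalel;
    exact: tensor_coord_linear.
rewrite {1}(hb.1 u) (lin_sumE (L := fun x => x ⊗ v)); last by lin.
apply: eq_bigr => i _; rewrite {1}(hc.1 v).
rewrite (lin_sumE (L := fun x => _ ⊗ x)); last by lin.
by apply: eq_bigr => j _; rewrite tensor_coord_pure pureZl pureZr scalerA.
Qed.

Lemma tensor_basis_independent : independent (fun q : I * J => b q.1 ⊗ c q.2).
Proof.
move=> a ha [i j]; have := congr1 (tensor_coord i j) ha.
have hL := tensor_coord_linear i j.
rewrite (lin_sumE _ hL) (lin_eq0 hL) => <-.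
rewrite -[LHS](sum_delta (V := k^o) a (i, j)); apply: eq_bigr => [[i' j'] _] /=.
rewrite (lin_scaleE _ _ hL) tensor_coord_pure hb.2 hc.2 -natrM mulnb.
by rewrite xpair_eqE [i == _]eq_sym [j == _]eq_sym; exact: mulrC.
Qed.

Lemma tensor_basis_ext (W : lmodType k) (f g : U ⊗ V -> W) : linear f -> linear g ->
  (forall i j, f (b i ⊗ c j) = g (b i ⊗ c j)) -> f =1 g.
Proof.
move=> hf hg h t; rewrite (tensor_basisE t) !lin_sumE //; apply: eq_bigr => i _.
by rewrite !lin_sumE //; apply: eq_bigr => j _; rewrite !lin_scaleE // h.
Qed.

End TensorBases.

Section ComoduleBases.
Variables (k : fieldType) (C : coalgebra k) (M : lmodType k) (r : coaction C M).
Variables (I : finType) (b : I -> M) (b' : I -> {linear M -> k^o}).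
Hypothesis hb : is_basis b b'.

Definition coaction_matrix (i j : I) : C := slicer (b' j) (r (b i)).

Lemma coaction_matrixP : coefficients r b coaction_matrix.
Proof.
move=> i; rewrite /coaction_matrix; move: (r (b i)); apply: tens_ext => [//||c v].
  apply: lin_bigr => j; apply: lin_purel; exact: slicer_linear.
rewrite {1}(hb.1 v) (lin_sumE (L := fun x => c ⊗ x)); last by lin.
by apply: eq_bigr => j _; rewrite slicer_pure pureZl pureZr.
Qed.

Lemma coaction_matrix_comatrix : comatrix coaction_matrix.
Proof. exact: coefficients_comatrix (is_basis_independent hb) coaction_matrixP. Qed.

End ComoduleBases.

Section Translation.
Variables (k : fieldType) (B : coquasi_bialgebra k).

Lemma pure_scalar (a : B) (c : k^o) : a ⊗ c = ((c : k) *: a) ⊗ (1 : k^o).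
Proof. by rewrite pureZl -pureZr -[_ *: _]/(_ * _) mulr1. Qed.

Lemma pure_one_inj (a b : B) : a ⊗ (1 : k^o) = b ⊗ (1 : k^o) -> a = b.
Proof.
move=> /(congr1 (tsum (fun (a : B) (c : k^o) => (c : k) *: a))).
by rewrite !tsum_pure ?scale1r //; lin.
Qed.

Section Duals.
Variables (X Y : fdcomod B) (I J : finType).
Variables (b : I -> X) (b' : I -> {linear X -> k^o}) (hb : is_basis b b').
Variables (c : J -> Y) (c' : J -> {linear Y -> k^o}) (hc : is_basis c c').
Variables (A : I -> I -> B) (A' : J -> J -> B).
Hypotheses (hA : coefficients (fdcomod_coact X) b A).
Hypotheses (hA' : coefficients (fdcomod_coact Y) c A').
Variables (ev : 'Hom(tensC X Y, unitC B)) (db : 'Hom(unitC B, tensC Y X)).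
Variables (E : I -> J -> k) (D : J -> I -> k).
Hypothesis hE : forall i j, ev (b i ⊗ c j) = E i j.
Hypothesis hD : db (1 : k^o) = \sum_j \sum_i D j i *: (c j ⊗ b i).

Lemma tens_coact_basis (U V : fdcomod B) (I1 J1 : finType) (u : I1 -> U) (v : J1 -> V)
    (P : I1 -> I1 -> B) (Q : J1 -> J1 -> B) i j :
  coefficients (fdcomod_coact U) u P -> coefficients (fdcomod_coact V) v Q ->
  ρ (tensC U V) (u i ⊗ v j) = \sum_i' \sum_j' (P i i' ⋅ Q j j') ⊗ (u i' ⊗ v j').
Proof.
move=> hP hQ; rewrite [LHS]tens_coact_pure (tsum_coefficients _ hP); last by lin.
by apply: eq_bigr => i' _; rewrite (tsum_coefficients _ hQ) //; lin.
Qed.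

Lemma ev_colinearP : colinear ev <-> invariant_pairing A A' E.
Proof.
have h i j : ρ (unitC B) (ev (b i ⊗ c j)) = (E i j *: 1_[B]) ⊗ (1 : k^o).
  by rewrite hE -pure_scalar.
have h' i j : tmap idfun ev (ρ (tensC X Y) (b i ⊗ c j)) =
    (\sum_i' \sum_j' E i' j' *: (A i i' ⋅ A' j j')) ⊗ (1 : k^o).
  rewrite (tens_coact_basis _ _ hA hA') linear_sum.
  rewrite (lin_sumE (L := fun x => x ⊗ (1 : k^o))); last by lin.
  apply: eq_bigr => i' _; rewrite linear_sum.
  rewrite (lin_sumE (L := fun x => x ⊗ (1 : k^o))); last by lin.
  apply: eq_bigr => j' _; rewrite -pure_scalar -hE; exact: tmap_pure.
split=> [col i j|inv].
  by apply: pure_one_inj; rewrite -h -h' col.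
apply: (tensor_basis_ext hb hc) => [||i j]; first by lin.
  by move=> a x y; rewrite !linearP.
by rewrite h h' inv.
Qed.

Lemma db_colinearP : colinear db <-> invariant_copairing A' A D.
Proof.
have h : ρ (tensC Y X) (db (1 : k^o)) = \sum_(q : J * I)
    (\sum_j \sum_i D j i *: (A' j q.1 ⋅ A i q.2)) ⊗ (c q.1 ⊗ b q.2).
  transitivity (\sum_j \sum_i D j i *: (\sum_j' \sum_i'
      (A' j j' ⋅ A i i') ⊗ (c j' ⊗ b i') : B ⊗ (Y ⊗ X))).
    rewrite hD linear_sum; apply: eq_bigr => j _; rewrite linear_sum.
    by apply: eq_bigr => i _; rewrite linearZ (tens_coact_basis _ _ hA' hA).
  under eq_bigr => j _.
    under eq_bigr do rewrite pair_bigA scaler_sumr.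
    rewrite exchange_big; over.
  rewrite exchange_big; apply: eq_bigr => q _ /=.
  rewrite (lin_sumE (L := fun x => x ⊗ (c q.1 ⊗ b q.2))); last by lin.
  apply: eq_bigr => j _.
  rewrite (lin_sumE (L := fun x => x ⊗ (c q.1 ⊗ b q.2))); last by lin.
  by apply: eq_bigr => i _; rewrite pureZl.
have h' : tmap idfun db (ρ (unitC B) (1 : k^o)) =
    \sum_(q : J * I) (D q.1 q.2 *: 1_[B]) ⊗ (c q.1 ⊗ b q.2).
  transitivity (1_[B] ⊗ (db (1 : k^o) : Y ⊗ X)); first exact: tmap_pure.
  rewrite hD pair_bigA.
  rewrite (lin_sumE (L := fun x => 1_[B] ⊗ x)); last by lin.
  by apply: eq_bigr => q _; rewrite pureZl pureZr.
split=> [col j i|inv x].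
  have := col (1 : k^o); rewrite h h' => hq.
  exact: (independent_tensor_inj (tensor_basis_independent hc hb) hq (j, i)).
have -> : x = (x : k) *: (1 : k^o) by exact: esym (mulr1 _).
have hL : linear (fun y : k^o => ρ (tensC Y X) (db y)) by lin.
have hR : linear (fun y : k^o => tmap idfun db (ρ (unitC B) y)).
  by move=> a y z; rewrite !linearP.
rewrite [LHS](lin_scaleE _ _ hL) [RHS](lin_scaleE _ _ hR) h h'; congr (_ *: _).
by apply: eq_bigr => q _; rewrite inv.
Qed.

Lemma lunit_ev_linear :
  linear (fun t : (X ⊗ Y) ⊗ X => lunitC (tmap ev idfun t)).
Proof. by apply: lin_sum; [lin | move=> a x y; exact: linearP]. Qed.

Lemma runit_ev_linear :
  linear (fun t : Y ⊗ (X ⊗ Y) => runitC (tmap idfun ev t)).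
Proof. by apply: lin_sum; [lin | move=> a x y; exact: linearP]. Qed.

Lemma right_dual_objE i :
  lunitC (tmap ev idfun (assocVC (tmap idfun db (runitVC (b i))))) =
  \sum_m comate A A' A E D i m *: b m.
Proof.
have e1 : tmap idfun db (runitVC (b i)) =
    \sum_j \sum_x D j x *: (b i ⊗ (c j ⊗ b x)) :> X ⊗ (Y ⊗ X).
  transitivity (b i ⊗ (db (1 : k^o) : Y ⊗ X)); first exact: tmap_pure.
  rewrite hD (lin_sumE (L := fun x => b i ⊗ x)); last by lin.
  apply: eq_bigr => j _; rewrite (lin_sumE (L := fun x => b i ⊗ x)); last by lin.
  by apply: eq_bigr => x _; rewrite pureZr.
have e2 j x : assocVC (b i ⊗ (c j ⊗ b x)) = \sum_i' \sum_j' \sum_x'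
    omega (A i i') (A' j j') (A x x') *: ((b i' ⊗ c j') ⊗ b x').
  rewrite assocVC_pure (tsum_coefficients _ hA); last by rewrite /omega; lin.
  apply: eq_bigr => i' _; rewrite (tsum_coefficients _ hA'); last by rewrite /omega; lin.
  apply: eq_bigr => j' _; rewrite (tsum_coefficients _ hA) //.
  by rewrite /omega; lin.
have hL := lunit_ev_linear.
have e3 i' j' x' : lunitC (tmap ev idfun ((b i' ⊗ c j') ⊗ b x')) = E i' j' *: b x'.
  transitivity (lunitC ((ev (b i' ⊗ c j') : k^o) ⊗ b x' : unitC B ⊗ X)).
    by congr lunitC; exact: tmap_pure.
  by rewrite hE /lunitC tsum_pure //; lin.
have hL2 : linear (fun t : X ⊗ (Y ⊗ X) => lunitC (tmap ev idfun (assocVC t))).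
  by apply: (lin_comp hL) => a x y; exact: linearP.
rewrite e1 (lin_sumE _ hL2).
transitivity (\sum_m \sum_j \sum_x \sum_i' \sum_j'
    (D j x * E i' j' * omega (A i i') (A' j j') (A x m)) *: b m); last first.
  apply: eq_bigr => m _; rewrite comateE; do 4 (rewrite scaler_suml; apply: eq_bigr => ? _).
  by [].
rewrite exchange_big; apply: eq_bigr => j _ /=; rewrite (lin_sumE _ hL2) exchange_big.
apply: eq_bigr => x _ /=; rewrite (lin_scaleE _ _ hL2) e2 (lin_sumE _ hL).
rewrite scaler_sumr [RHS]exchange_big; apply: eq_bigr => i' _ /=.
rewrite (lin_sumE _ hL) scaler_sumr [RHS]exchange_big; apply: eq_bigr => j' _ /=.
rewrite (lin_sumE _ hL) scaler_sumr; apply: eq_bigr => x' _.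
by rewrite (lin_scaleE _ _ hL) e3 !scalerA mulrAC.
Qed.

Lemma right_dual_dualE l :
  runitC (tmap idfun ev (assocC (tmap db idfun (lunitVC (c l))))) =
  \sum_m mate A' A A' D E l m *: c m.
Proof.
have e1 : tmap db idfun (lunitVC (c l)) =
    \sum_j \sum_x D j x *: ((c j ⊗ b x) ⊗ c l) :> (Y ⊗ X) ⊗ Y.
  transitivity ((db (1 : k^o) : Y ⊗ X) ⊗ c l); first exact: tmap_pure.
  rewrite hD (lin_sumE (L := fun x => x ⊗ c l)); last by lin.
  apply: eq_bigr => j _; rewrite (lin_sumE (L := fun x => x ⊗ c l)); last by lin.
  by apply: eq_bigr => x _; rewrite pureZl.
have e2 j x : assocC ((c j ⊗ b x) ⊗ c l) = \sum_j' \sum_x' \sum_l'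
    omegaV (A' j j') (A x x') (A' l l') *: (c j' ⊗ (b x' ⊗ c l')).
  rewrite assocC_pure (tsum_coefficients _ hA'); last by rewrite /omegaV; lin.
  apply: eq_bigr => i' _; rewrite (tsum_coefficients _ hA); last by rewrite /omegaV; lin.
  apply: eq_bigr => j' _; rewrite (tsum_coefficients _ hA') //.
  by rewrite /omegaV; lin.
have hL := runit_ev_linear.
have e3 j' x' l' : runitC (tmap idfun ev (c j' ⊗ (b x' ⊗ c l'))) = E x' l' *: c j'.
  transitivity (runitC (c j' ⊗ (ev (b x' ⊗ c l') : k^o) : Y ⊗ unitC B)).
    by congr runitC; exact: tmap_pure.
  by rewrite hE /runitC tsum_pure //; lin.
have hL2 : linear (fun t : (Y ⊗ X) ⊗ Y => runitC (tmap idfun ev (assocC t))).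
  by apply: (lin_comp hL) => a x y; exact: linearP.
rewrite e1 (lin_sumE _ hL2).
transitivity (\sum_m \sum_j \sum_x \sum_x' \sum_l'
    (D j x * E x' l' * omegaV (A' j m) (A x x') (A' l l')) *: c m); last first.
  apply: eq_bigr => m _; rewrite mateE; do 4 (rewrite scaler_suml; apply: eq_bigr => ? _).
  by [].
rewrite exchange_big; apply: eq_bigr => j _ /=; rewrite (lin_sumE _ hL2) exchange_big.
apply: eq_bigr => x _ /=; rewrite (lin_scaleE _ _ hL2) e2 (lin_sumE _ hL).
rewrite scaler_sumr; apply: eq_bigr => m _ /=.
rewrite (lin_sumE _ hL) scaler_sumr; apply: eq_bigr => x' _ /=.
rewrite (lin_sumE _ hL) scaler_sumr; apply: eq_bigr => l' _.
by rewrite (lin_scaleE _ _ hL) e3 !scalerA mulrAC.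
Qed.

(** The evaluation, the dual basis map and the two snake composites have been
    computed on bases; compare coefficients. *)
Lemma right_dualP : right_dual ev db <-> matrix_dual A A' E D.
Proof.
have hA'c : comatrix A' := coefficients_comatrix (is_basis_independent hc) hA'.
have delta (V : lmodType k) (K : finType) (v : K -> V) (F : K -> k) l :
    independent v -> \sum_m F m *: v m = v l -> forall m, F m = (l == m)%:R.
  move=> iv hF m; apply/eqP; rewrite -subr_eq0; apply/eqP.
  apply: (iv (fun m => F m - (l == m)%:R)).
  by under eq_bigr do rewrite scalerBl; rewrite sumrB hF sum_deltaC subrr.
split=> h; split.
- exact: hA'c.
- exact/ev_colinearP/(ev_colinear h).
- exact/db_colinearP/(db_colinear h).
- move=> i; apply: (delta _ _ b _ _ (is_basis_independent hb)).
  by rewrite -right_dual_objE (right_dual_obj h).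
- move=> l; apply: (delta _ _ c _ _ (is_basis_independent hc)).
  by rewrite -right_dual_dualE (right_dual_dual h).
- exact/ev_colinearP/(dual_ev h).
- exact/db_colinearP/(dual_db h).
- have lin_obj : linear (fun x : X =>
      lunitC (tmap ev idfun (assocVC (tmap idfun db (runitVC x))))).
    apply: (lin_comp lunit_ev_linear) => a x y.
    by rewrite /runitVC pureDl pureZl !linearP.
  apply: (basis_ext hb lin_obj) => [//|i]; rewrite right_dual_objE.
  by under eq_bigr do rewrite (dual_obj h); exact: sum_deltaC.
- have lin_dual : linear (fun y : Y =>
      runitC (tmap idfun ev (assocC (tmap db idfun (lunitVC y))))).
    apply: (lin_comp runit_ev_linear) => a x y.
    by rewrite /lunitVC pureDr pureZr !linearP.
  apply: (basis_ext hc lin_dual) => [//|l]; rewrite right_dual_dualE.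
  by under eq_bigr do rewrite (dual_dual h); exact: sum_deltaC.
Qed.

End Duals.
End Translation.

(** * Rigidity in bases *)

Section Rigidity.
Variables (k : fieldType) (B : coquasi_bialgebra k).

Lemma right_dual_of_matrix (X Y : fdcomod B) (I J : finType)
    (b : I -> X) (b' : I -> {linear X -> k^o}) (c : J -> Y) (c' : J -> {linear Y -> k^o})
    (A : I -> I -> B) (A' : J -> J -> B) (E : I -> J -> k) (D : J -> I -> k) :
  is_basis b b' -> is_basis c c' ->
  coefficients (fdcomod_coact X) b A -> coefficients (fdcomod_coact Y) c A' ->
  matrix_dual A A' E D ->
  exists (ev : 'Hom(tensC X Y, unitC B)) (db : 'Hom(unitC B, tensC Y X)),
    right_dual ev db /\ forall i j, ev (b i ⊗ c j) = E i j.
Proof.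
move=> hb hc hA hA' h.
pose ev0 (t : X ⊗ Y) : k^o := \sum_i \sum_j E i j *: tensor_coord b' c' i j t.
have ev0_lin : linear ev0.
  by apply: lin_bigr => i; apply: lin_bigr => j; apply: lin_scaler;
    exact: tensor_coord_linear.
pose ev1 : {linear tensC X Y -> unitC B} :=
  HB.pack ev0 (GRing.isLinear.Build _ _ _ _ ev0 ev0_lin).
pose d : Y ⊗ X := \sum_j \sum_i D j i *: (c j ⊗ b i).
pose db0 (a : k^o) : Y ⊗ X := (a : k) *: d.
have db0_lin : linear db0 := lin_scalel d (@lin_id k k^o).
pose db1 : {linear unitC B -> tensC Y X} :=
  HB.pack db0 (GRing.isLinear.Build _ _ _ _ db0 db0_lin).
have evE i j : linfun ev1 (b i ⊗ c j) = E i j.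
  rewrite lfunE /= /ev0 -[RHS](sum_delta2 (W := k^o) E i j).
  apply: eq_bigr => i' _; apply: eq_bigr => j' _.
  rewrite tensor_coord_pure hb.2 hc.2 [i == _]eq_sym [j == _]eq_sym; exact: mulrC.
have dbE : linfun db1 (1 : k^o) = d by rewrite lfunE /= /db0 scale1r.
exists (linfun ev1), (linfun db1); split=> //.
by apply/(right_dualP hb hc hA hA' evE dbE).
Qed.

Definition matrix_comodule (I : finType) (A : I -> I -> B) (hA : comatrix A) : fdcomod B :=
  FdComod (matrix_coaction (std_basisP k I) hA).

Lemma right_rigid_matrix_rigid : right_rigid B <-> matrix_rigid B.
Proof.
split=> [rig I A hA|rig X].
  have [Y [ev [db h]]] := rig (matrix_comodule hA).
  have hb := std_basisP k I; have hc := vect_basisP Y.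
  exists _, (coaction_matrix (fdcomod_coact Y) (@vect_basis k Y) (@vect_coord k Y)).
  exists (fun i j => ev (std_basis k i ⊗ vect_basis j)).
  exists (fun j i => tensor_coord (@vect_coord k Y) (@std_coord k I) j i (db (1 : k^o))).
  apply/(right_dualP (ev := ev) (db := db) (Y := Y) (X := matrix_comodule hA) hb hc
    (matrix_coactionP hb hA) (coaction_matrixP _ hc) (fun _ _ => erefl)
    (tensor_basisE hc hb _)).
  exact: h.
have hb := vect_basisP X.
have hA := coaction_matrix_comatrix (fdcomod_coact X) hb.
have [J [A' [E [D d]]]] := rig _ _ hA.
have hA' := dual_comatrix d; have hc := std_basisP k J.
have [ev [db [h _]]] := right_dual_of_matrix (Y := matrix_comodule hA') hb hc
  (coaction_matrixP (fdcomod_coact X) hb) (matrix_coactionP hc hA') d.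
by exists (matrix_comodule hA'), ev, db.
Qed.

Lemma colinear_intertwines (X Y : fdcomod B) (I J : finType)
    (b : I -> X) (b' : I -> {linear X -> k^o}) (c : J -> Y) (c' : J -> {linear Y -> k^o})
    (A : I -> I -> B) (C : J -> J -> B) (f : 'Hom(X, Y)) (G : I -> J -> k) :
  is_basis b b' -> is_basis c c' ->
  coefficients (fdcomod_coact X) b A -> coefficients (fdcomod_coact Y) c C ->
  (forall i, f (b i) = \sum_j G i j *: c j) ->
  colinear f <-> intertwines A C G.
Proof.
move=> hb hc hA hC hf.
have h1 i : ρ Y (f (b i)) = \sum_j (\sum_j' G i j' *: C j' j) ⊗ c j.
  transitivity (\sum_j G i j *: (\sum_j' C j j' ⊗ c j' : B ⊗ Y)).
    by rewrite hf linear_sum; apply: eq_bigr => j _; rewrite linearZ hC.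
  under eq_bigr do rewrite scaler_sumr.
  rewrite exchange_big; apply: eq_bigr => j _.
  rewrite (lin_sumE (L := fun x => x ⊗ c j)); last by lin.
  by apply: eq_bigr => j' _; rewrite pureZl.
have h2 i : tmap idfun f (ρ X (b i)) = \sum_j (\sum_i' G i' j *: A i i') ⊗ c j.
  transitivity (\sum_i' A i i' ⊗ f (b i')).
    by rewrite hA linear_sum; apply: eq_bigr => i' _; exact: tmap_pure.
  under eq_bigr do rewrite hf.
  transitivity (\sum_i' \sum_j (G i' j *: A i i') ⊗ c j).
    apply: eq_bigr => i' _; rewrite (lin_sumE (L := fun x => A i i' ⊗ x)); last by lin.
    by apply: eq_bigr => j _; rewrite pureZl pureZr.
  rewrite exchange_big; apply: eq_bigr => j _.
  by rewrite (lin_sumE (L := fun x => x ⊗ c j)) //; lin.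
split=> [col i j|h].
  have := col (b i); rewrite h1 h2.
  move=> /(independent_tensor_inj (is_basis_independent hc)) /(_ j) /= ->.
  by [].
apply: (basis_ext hb) => [||i]; try by move=> a x y; rewrite !linearP.
by rewrite h1 h2; apply: eq_bigr => j _; rewrite h.
Qed.

Lemma linear_right_duals_right_rigid : linear_right_duals B -> right_rigid B.
Proof.
by move=> [r [ev [db [h _]]]] X; exists (FdComod (r X)), (ev X), (db X).
Qed.

(** The antipode transports the coefficients of X to its linear dual.  Transposes
    are dual morphisms: apply s and β to the relation between the coefficients of the
    source and of the target. *)
Lemma coquasi_Hopf_linear_right_duals : is_coquasi_Hopf B -> linear_right_duals B.
Proof.
move=> [s [α [β /coquasi_antipodeP h]]].
pose A (X : fdcomod B) := coaction_matrix (fdcomod_coact X) (@vect_basis k X) (@vect_coord k X).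
have hA (X : fdcomod B) : comatrix (A X) := coaction_matrix_comatrix _ (vect_basisP X).
pose A' (X : fdcomod B) j i : B := s (A X i j).
have hA' (X : fdcomod B) : comatrix (A' X) := dual_comatrix (h _ _ (hA X)).
pose r (X : fdcomod B) := matrix_coaction (dual_basisP (vect_basisP X)) (hA' X).
have hr (X : fdcomod B) : coefficients (r X) (dual_basis (@vect_coord k X)) (A' X).
  exact: matrix_coactionP.
have dual (X : fdcomod B) := right_dual_of_matrix (X := X) (Y := FdComod (r X)) (vect_basisP X)
  (dual_basisP (vect_basisP X)) (coaction_matrixP _ (vect_basisP X)) (hr X) (h _ _ (hA X)).
pose ev (X : fdcomod B) := projT1 (cid (dual X)).
have evP (X : fdcomod B) : exists db, right_dual (ev X) db /\
    forall i j, ev X (vect_basis i ⊗ dual_basis (@vect_coord k X) j) = β (A X i j) :=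
  projT2 (cid (dual X)).
pose db (X : fdcomod B) := projT1 (cid (evP X)).
have dbP (X : fdcomod B) : right_dual (ev X) (db X) /\ _ := projT2 (cid (evP X)).
exists r, ev, db; split=> [X|X Y f colf]; first by case: (dbP X).
pose G i j : k := vect_coord j (f (vect_basis i)).
have fG i : f (vect_basis i) = \sum_j G i j *: vect_basis j.
  exact: (vect_basisP Y).1.
have hG : intertwines (A X) (A Y) G.
  by apply/(colinear_intertwines (vect_basisP X) (vect_basisP Y)
    (coaction_matrixP _ (vect_basisP X)) (coaction_matrixP _ (vect_basisP Y)) fG).
have fG' j : transpose f (dual_basis (@vect_coord k Y) j) =
    \sum_i G i j *: dual_basis (@vect_coord k X) i.
  apply: etrans ((dual_basisP (vect_basisP X)).1 _) _.
  by apply: eq_bigr => i _; rewrite /= transposeE lfunE.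
split.
  apply/(colinear_intertwines (X := FdComod (r Y)) (Y := FdComod (r X))
    (dual_basisP (vect_basisP Y)) (dual_basisP (vect_basisP X)) (hr Y) (hr X) fG').
  move=> j i; have := congr1 s (hG i j); rewrite !linear_sum /= => h'.
  by under eq_bigr do rewrite -linearZ; under [RHS]eq_bigr do rewrite -linearZ; rewrite h'.
apply: (tensor_basis_ext (vect_basisP X) (dual_basisP (vect_basisP Y))).
- by move=> a x y; rewrite !linearP.
- by move=> a x y; rewrite !linearP.
move=> i j.
have evX := (dbP X).2; have evY := (dbP Y).2.
transitivity (\sum_i' G i' j *: β (A X i i')).
  transitivity (ev X (vect_basis i ⊗ transpose f (dual_basis (@vect_coord k Y) j))).
    by congr (ev X _); exact: tmap_pure.
  have hL : linear (fun φ : 'Hom(X, k^o) => ev X (vect_basis i ⊗ φ)).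
    by move=> a x y; rewrite pureDr pureZr linearP.
  rewrite fG' (lin_sumE _ hL); apply: eq_bigr => i' _.
  by rewrite (lin_scaleE _ _ hL) evX.
transitivity (\sum_j' G i j' *: β (A Y j' j)).
  have := congr1 β (hG i j); rewrite !linear_sum /= => h'.
  by under eq_bigr do rewrite -linearZ; under [RHS]eq_bigr do rewrite -linearZ; rewrite h'.
transitivity (ev Y (f (vect_basis i) ⊗ dual_basis (@vect_coord k Y) j)); last first.
  by congr (ev Y _); symmetry; exact: tmap_pure.
have hL : linear (fun y : Y => ev Y (y ⊗ dual_basis (@vect_coord k Y) j)).
  by move=> a x y; rewrite pureDl pureZl linearP.
rewrite fG (lin_sumE _ hL); apply: eq_bigr => j' _.
by rewrite (lin_scaleE _ _ hL) evY.
Qed.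

End Rigidity.

Section LinearDuals.
Variables (k : fieldType) (B : coquasi_bialgebra k).

(** The comodules attached to comatrices provide duals of all comatrices, with the
    same index set; since the dual morphisms are transposes, these are natural. *)
Lemma linear_right_duals_coquasi_Hopf : linear_right_duals B -> is_coquasi_Hopf B.
Proof.
move=> [r [ev [db [dual morph]]]].
pose X (I : finType) (A : I -> I -> B) (hA : comatrix A) := matrix_comodule hA.
pose e (I : finType) := dual_basis (@std_coord k I).
have he (I : finType) : is_basis (e I) (dual_coord (@std_basis k I)) :=
  dual_basisP (std_basisP k I).
pose s0 (I : finType) (A : I -> I -> B) (hA : comatrix A) (i j : I) : B :=
  coaction_matrix (r (@X I A hA)) (e I) (dual_coord (@std_basis k I)) j i.
pose ev0 (I : finType) (A : I -> I -> B) (hA : comatrix A) (i j : I) : k := ev (@X I A hA) (std_basis k i ⊗ e I j).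
pose db0 (I : finType) (A : I -> I -> B) (hA : comatrix A) (j i : I) : k :=
  tensor_coord (dual_coord (@std_basis k I)) (@std_coord k I) j i (db (@X I A hA) (1 : k^o)).
(* total functions of A, as the universal property of B asks for *)
pose s (I : finType) (A : I -> I -> B) : I -> I -> B :=
  if pselect (comatrix A) is left hA then s0 I A hA else fun _ _ => 0.
pose ev1 (I : finType) (A : I -> I -> B) : I -> I -> k :=
  if pselect (comatrix A) is left hA then ev0 I A hA else fun _ _ => 0.
pose db1 (I : finType) (A : I -> I -> B) : I -> I -> k :=
  if pselect (comatrix A) is left hA then db0 I A hA else fun _ _ => 0.
have hs (I : finType) (A : I -> I -> B) (hA : comatrix A) :
    coefficients (r (X I A hA)) (e I) (fun j i => s0 I A hA i j).
  exact: coaction_matrixP (he I).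
pose f (I : finType) (A : I -> I -> B) (hA : comatrix A) (J : finType) (C : J -> J -> B) (hC : comatrix C) (G : I -> J -> k) : 'Hom(@X I A hA, @X J C hC) :=
  linfun (fun x : {ffun I -> k^o} => \sum_i (x i : k) *: \sum_j G i j *: std_basis k j).
have fE (I : finType) (A : I -> I -> B) (hA : comatrix A) (J : finType) (C : J -> J -> B) (hC : comatrix C) (G : I -> J -> k) i : @f I A hA J C hC G (std_basis k i) =
    \sum_j G i j *: std_basis k j.
  pose f0 (x : {ffun I -> k^o}) := \sum_i (x i : k) *: \sum_j G i j *: std_basis k j.
  have f0_lin : linear f0.
    by apply: lin_bigr => i'; apply: lin_scalel; exact: std_coord_linear.
  pose f1 : {linear _ -> _} := HB.pack f0 (GRing.isLinear.Build _ _ _ _ f0 f0_lin).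
  transitivity (f0 (std_basis k i)); first exact: (lfunE f1).
  by rewrite /f0; under eq_bigr do rewrite ffunE; exact: sum_deltaC.
have fE' (I : finType) (A : I -> I -> B) (hA : comatrix A) (J : finType) (C : J -> J -> B) (hC : comatrix C) (G : I -> J -> k) j : transpose (@f I A hA J C hC G) (e J j) =
    \sum_i G i j *: e I i.
  apply: etrans ((he I).1 _) _; apply: eq_bigr => i _; congr (_ *: _) => /=.
  rewrite transposeE fE linear_sum -[RHS](sum_delta (V := k^o) (fun j' => G i j') j).
  apply: eq_bigr => j' _; transitivity (G i j' *: ((j' == j)%:R : k^o)); last exact: mulrC.
  by rewrite linearZ; apply: eq_scale; exact: (he J).2.
have colf (I : finType) (A : I -> I -> B) (hA : comatrix A) (J : finType) (C : J -> J -> B) (hC : comatrix C) (G : I -> J -> k) : intertwines A C G -> colinear (@f I A hA J C hC G).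
  move=> hG; apply: (colinear_intertwines (X := X I A hA) (Y := X J C hC)
    (std_basisP k I) (std_basisP k J) (matrix_coactionP _ hA) (matrix_coactionP _ hC)
    (fE I A hA J C hC G)).2.
  exact: hG.
apply: (@natural_duals_coquasi_Hopf k B s ev1 db1).
- move=> I A; rewrite /s /ev1 /db1; case: pselect => // hA _.
  apply/(right_dualP (X := X I A hA) (Y := FdComod (r (X I A hA)))
    (ev := ev (X I A hA)) (db := db (X I A hA))
    (std_basisP k I) (he I) (matrix_coactionP _ hA) (hs I A hA) (fun _ _ => erefl)
    (tensor_basisE (he I) (std_basisP k I) _)).
  exact: dual.
- move=> I J A C G + + hG i j; rewrite /s.
  case: pselect => // hA _; case: pselect => // hC _.
  have [colt _] := morph _ _ _ (colf I A hA J C hC G hG).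
  move/(colinear_intertwines (X := FdComod (r (X J C hC))) (Y := FdComod (r (X I A hA)))
    (he J) (he I) (hs J C hC) (hs I A hA) (fE' I A hA J C hC G)): colt => h.
  exact: esym (h j i).
move=> I J A C G + + hG i j; rewrite /ev1.
case: pselect => // hA _; case: pselect => // hC _.
have [_ h] := morph _ _ _ (colf I A hA J C hC G hG).
have {h} := h (std_basis k i ⊗ e J j).
have -> : tmap idfun (transpose (f I A hA J C hC G)) (std_basis k i ⊗ e J j) =
    std_basis k i ⊗ (\sum_i' G i' j *: e I i').
  by rewrite -(fE' I A hA J C hC); exact: tmap_pure.
have -> : tmap (f I A hA J C hC G) idfun (std_basis k i ⊗ e J j) =
    (\sum_j' G i j' *: std_basis k j') ⊗ e J j.
  by rewrite -(fE I A hA J C hC); exact: tmap_pure.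
have hL : linear (fun φ => ev (X I A hA) (std_basis k i ⊗ φ)).
  by move=> a x y; rewrite pureDr pureZr linearP.
have hR : linear (fun x => ev (X J C hC) (x ⊗ e J j)).
  by move=> a x y; rewrite pureDl pureZl linearP.
rewrite (lin_sumE _ hL) (lin_sumE _ hR) => h.
transitivity (\sum_i' ev (X I A hA) (std_basis k i ⊗ (G i' j *: e I i'))).
  by apply: eq_bigr => i' _; rewrite (lin_scaleE _ _ hL).
rewrite h; apply: eq_bigr => j' _.
by rewrite (lin_scaleE _ _ hR).
Qed.

End LinearDuals.

Unset Implicit Arguments.

Theorem theorem2p19 (k : fieldType) (B : coquasi_bialgebra k) :
  (has_preantipode B <-> right_rigid B) /\
  (is_coquasi_Hopf B <-> right_rigid B /\ linear_right_duals B).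
Proof.
split; split=> [h|h].
- by case: h => S /preantipode_matrix_rigid /right_rigid_matrix_rigid.
- by apply/matrix_rigid_preantipode/right_rigid_matrix_rigid.
- have duals := coquasi_Hopf_linear_right_duals h.
  by split=> //; exact: linear_right_duals_right_rigid.
- exact: linear_right_duals_coquasi_Hopf h.2.
Qed.
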